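(* Let $n\ge 4$ be even and let $K$ be an $n$-dimensional indecomposable exp-maximal minimal cone whose extreme vectors $x_1,\ldots,x_{n+1}$ satisfy the relation $$x_1+x_2+x_4+\cdots+x_{n-2}+x_n=x_3+x_5+\cdots+x_{n-1}+x_{n+1}.$$ For every $\alpha>0$, let $A_\alpha$ be the exp-maximal $K$-primitive matrix given by $$A_\alpha x_1=\alpha x_2,\qquad A_\alpha x_i=x_{i+1}\ (2\le i\le n),\qquad A_\alpha x_{n+1}=x_1+(1+\alpha)x_2.$$ For every $\alpha,\beta>0$, let $A_{\alpha,\beta}$ be the $K$-nonnegative matrix defined by $$A_{\alpha,\beta}x_1=\beta x_2,\quad A_{\alpha,\beta}x_3=(1+\alpha)x_1+(1+\beta)x_2,\quad A_{\alpha,\beta}x_n=x_3+\alpha x_1,$$ $$A_{\alpha,\beta}x_i=x_{i+3}\text{ when } i \text{ is even},\ i\ne n,\qquad A_{\alpha,\beta}x_i=x_{i-1}\text{ when } i\text{ is odd},\ i\ne 1,3.$$ Then: (i) $\Phi(A_\alpha)$ is a $2$-dimensional face of $\pi(K)$, independent of the choice of the positive scalar $\alpha$; its relative interior consists of positive multiples of matrices of the form $A_{\tilde\alpha}$, $\tilde\alpha>0$. (ii) $\Phi(A_{\alpha,\beta})$ is a $3$-dimensional simplicial face of $\pi(K)$, independent of the choice of the positive scalars $\alpha,\beta$; its relative interior consists of positive multiples of matrices of the form $A_{\tilde\alpha,\tilde\beta}$, $\tilde\alpha,\tilde\beta>0$. (iii) Every exp-maximal $K$-primitive matrix is cone-equivalent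 to a positive multiple of some $A_\alpha$ or some $A_{\alpha,\beta}$ and thus is a positive multiple of a matrix of the form $P_\sigma^{-1}A_\alpha P_\sigma$ or $P_\sigma^{-1}A_{\alpha,\beta}P_\sigma$, where $P_\sigma$ is the automorphism of $K$ given by $P_\sigma x_j=x_{\sigma(j)}$ for $j=1,\ldots,n+1$, $\sigma$ being a permutation of $\{1,\ldots,n+1\}$ that maps the set $\{1,2,4,\ldots,n-2,n\}$ onto itself. (iv) The $A_\alpha$'s and $A_{\alpha,\beta}$'s, or their positive multiples, are pairwise not cone-equivalent.
   Context: A proper cone is a closed, pointed ($K\cap(-K)=\{0\}$) convex cone with nonempty interior. A face of a cone $K$ is a subcone $F\subseteq K$ such that $y\in F$ whenever $x\in F$ and $y,x-y\in K$; $\Phi(x)$ is the smallest face of the cone containing $x$. A nonzero $x\in K$ is an extreme vector if $\Phi(x)=\{\lambda x:\lambda\ge0\}$ (an extreme ray). A polyhedral cone is a proper cone (in its span) with finitely many extreme rays; it is simplicial if the number of extreme rays equals its dimension. $\mathcal{P}(m,n)$ is the set of $n$-dimensional polyhedral cones with exactly $m$ extreme rays. An $n$-dimensional minimal cone is a member of $\mathcal{P}(n+1,n)$; its extreme vectors satisfy a unique nonzero linear relation up to multiples. A cone is indecomposable if it is not the direct sum of two nonzero subcones. $\pi(K)$, the set of real matrices $A$ with $AK\subseteq K$ (the $K$-nonnegative matrices), is itself a proper cone in the space of $n\times n$ real matrices, and $\Phi(A)$ for $A\in\pi(K)$ is the face of $\pi(K)$ generated by $A$. $A\in\pi(K)$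 is $K$-primitive if $A^p(K\setminus\{0\})\subseteq\operatorname{int}K$ for some positive integer $p$; the least such $p$ is the exponent $\gamma(A)$. For polyhedral $K$, $\gamma(K)=\max\{\gamma(A):A\text{ is }K\text{-primitive}\}$; a $K$-primitive $A$ is exp-maximal if $\gamma(A)=\gamma(K)$; $K_0\in\mathcal{P}(m,n)$ is exp-maximal if $\gamma(K_0)=\max\{\gamma(K):K\in\mathcal{P}(m,n)\}$. $A_1\in\pi(K_1)$ and $A_2\in\pi(K_2)$ are cone-equivalent if there is a linear isomorphism $P$ with $PK_2=K_1$ and $P^{-1}A_1P=A_2$. An automorphism of $K$ is an invertible matrix $P$ with $PK=K$. *)

(* Defs.v *)
From HB Require Import structures.
From mathcomp Require Import all_boot all_order all_algebra.
From mathcomp Require Import all_classical all_reals all_analysis.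
Import Order.TTheory GRing.Theory Num.Theory numFieldNormedType.Exports.

Set Implicit Arguments.
Unset Strict Implicit.
Unset Printing Implicit Defensive.

Local Open Scope classical_set_scope.
Local Open Scope ring_scope.

(* Cones live in 'M[R]_(p, q), which covers both K in R^n = 'cV[R]_n and the
   cone pi(K) in 'M[R]_n. *)

Definition convex_cone (R : realType) (p q : nat) (C : set 'M[R]_(p, q)) :=
  [/\ C 0, (forall x y, C x -> C y -> C (x + y))
    & forall (a : R) x, 0 <= a -> C x -> C (a *: x)].

Definition pointed_cone (R : realType) (p q : nat) (C : set 'M[R]_(p, q)) :=
  C `&` [set - x | x in C] = [set 0].

Definition lin_span (R : realType) (p q : nat) (C : set 'M[R]_(p, q)) :
    set 'M[R]_(p, q) :=
  [set v | forall U : {vspace 'M[R]_(p, q)}, C `<=` [set` U] -> v \in U].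

Definition has_dim (R : realType) (p q : nat) (C : set 'M[R]_(p, q))
    (d : nat) :=
  exists U : {vspace 'M[R]_(p, q)}, [set` U] = lin_span C /\ \dim U = d.

(* Since a cone contains 0, its affine hull is its linear span. *)
Definition rel_interior (R : realType) (p q : nat) (C : set 'M[R]_(p, q)) :
    set 'M[R]_(p, q) :=
  [set x | C x /\ \forall y \near x, lin_span C y -> C y].

Definition proper_in_span (R : realType) (p q : nat)
    (C : set 'M[R]_(p, q)) :=
  [/\ convex_cone C, closed C, pointed_cone C & rel_interior C !=set0].

Definition is_face (R : realType) (p q : nat) (C F : set 'M[R]_(p, q)) :=
  [/\ convex_cone F, F `<=` C
    & forall x y, F x -> C y -> C (x - y) -> F y].

Definition Phi (R : realType) (p q : nat) (C : set 'M[R]_(p, q))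
    (x : 'M[R]_(p, q)) : set 'M[R]_(p, q) :=
  [set y | forall F, is_face C F -> F x -> F y].

Definition extreme_vector (R : realType) (p q : nat)
    (C : set 'M[R]_(p, q)) (x : 'M[R]_(p, q)) :=
  [/\ C x, x <> 0 & Phi C x = [set a *: x | a in [set a : R | 0 <= a]]].

Definition extreme_rays (R : realType) (p q : nat)
    (C : set 'M[R]_(p, q)) : set (set 'M[R]_(p, q)) :=
  [set Phi C x | x in extreme_vector C].

Definition polyhedral_cone (R : realType) (p q : nat)
    (C : set 'M[R]_(p, q)) :=
  proper_in_span C /\ finite_set (extreme_rays C).

(* [in_P m d C] is membership in P(m, d). *)
Definition in_P (R : realType) (p q : nat) (m d : nat)
    (C : set 'M[R]_(p, q)) :=
  [/\ polyhedral_cone C, has_dim C d & (extreme_rays C #= `I_m)%card].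

Definition simplicial_cone (R : realType) (p q : nat)
    (C : set 'M[R]_(p, q)) :=
  exists d, in_P d d C.

Definition minimal_cone (R : realType) (n : nat) (K : set 'cV[R]_n) :=
  in_P n.+1 n K.

Definition is_direct_sum (R : realType) (p q : nat)
    (C C1 C2 : set 'M[R]_(p, q)) :=
  C = [set v | exists a b, [/\ C1 a, C2 b & v = a + b]] /\
  lin_span C1 `&` lin_span C2 = [set 0].

Definition indecomposable (R : realType) (p q : nat)
    (C : set 'M[R]_(p, q)) :=
  ~ exists C1 C2, [/\ convex_cone C1 /\ convex_cone C2,
      C1 `<=` C /\ C2 `<=` C, C1 <> [set 0] /\ C2 <> [set 0]
    & is_direct_sum C C1 C2].

Definition cone_pi (R : realType) (n : nat) (K : set 'cV[R]_n) :
    set 'M[R]_n :=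
  [set A | forall x, K x -> K (A *m x)].

Definition prim_power (R : realType) (n : nat) (K : set 'cV[R]_n)
    (A : 'M[R]_n) (p : nat) :=
  (0 < p)%N /\ mulmx (A ^+ p) @` (K `\ 0) `<=` K°.

Definition primitive (R : realType) (n : nat) (K : set 'cV[R]_n)
    (A : 'M[R]_n) :=
  cone_pi K A /\ exists p, prim_power K A p.

(* gamma(A) = p *)
Definition exponent (R : realType) (n : nat) (K : set 'cV[R]_n)
    (A : 'M[R]_n) (p : nat) :=
  prim_power K A p /\ forall p', prim_power K A p' -> (p <= p')%N.

Definition is_max (S : set nat) (g : nat) :=
  S g /\ forall h, S h -> (h <= g)%N.

(* gamma(K) = g *)
Definition cone_exponent (R : realType) (n : nat) (K : set 'cV[R]_n)
    (g : nat) :=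
  is_max [set p | exists A, primitive K A /\ exponent K A p] g.

Definition exp_maximal_mx (R : realType) (n : nat) (K : set 'cV[R]_n)
    (A : 'M[R]_n) :=
  primitive K A /\ exists g, exponent K A g /\ cone_exponent K g.

Definition exp_maximal_cone (R : realType) (n m : nat)
    (K : set 'cV[R]_n) :=
  in_P m n K /\
  exists g, cone_exponent K g /\
    is_max [set h | exists K' : set 'cV[R]_n,
                      in_P m n K' /\ cone_exponent K' h] g.

Definition cone_equivalent (R : realType) (n : nat) (K1 K2 : set 'cV[R]_n)
    (A1 A2 : 'M[R]_n) :=
  [/\ cone_pi K1 A1, cone_pi K2 A2
    & exists P : 'M[R]_n, [/\ P \in unitmx, mulmx P @` K2 = K1
        & invmx P *m A1 *m P = A2]].

Definition cone_automorphism (R : realType) (n : nat) (K : set 'cV[R]_n)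
    (P : 'M[R]_n) :=
  P \in unitmx /\ mulmx P @` K = K.

(* The vectors x_1, ..., x_m are represented by x : nat -> 'cV[R]_n; values
   of x outside of 1..m are irrelevant. *)
Definition idx (m : nat) : set nat := [set i | (1 <= i <= m)%N].

(* x_1, ..., x_m is a system of representatives of the extreme rays. *)
Definition extreme_vectors_of (R : realType) (n m : nat)
    (K : set 'cV[R]_n) (x : nat -> 'cV[R]_n) :=
  (forall i, idx m i -> extreme_vector K (x i)) /\
  set_bij (idx m) (extreme_rays K) (fun i => Phi K (x i)).

(* For n even, the i in 1..n+1 with [lhs_index i] are 1, 2, 4, ..., n. *)
Definition lhs_index (i : nat) : bool := (i == 1)%N || ~~ odd i.

Definition vector_relation (R : realType) (n : nat) (x : nat -> 'cV[R]_n) :=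
  \sum_(1 <= i < n.+2 | lhs_index i) x i =
  \sum_(1 <= i < n.+2 | ~~ lhs_index i) x i.

Definition A1_spec (R : realType) (n : nat) (x : nat -> 'cV[R]_n) (a : R)
    (A : 'M[R]_n) :=
  [/\ A *m x 1%N = a *: x 2%N,
      (forall i, (2 <= i <= n)%N -> A *m x i = x i.+1)
    & A *m x n.+1 = x 1%N + (1 + a) *: x 2%N].

Definition A2_spec (R : realType) (n : nat) (x : nat -> 'cV[R]_n) (a b : R)
    (A : 'M[R]_n) :=
  [/\ A *m x 1%N = b *: x 2%N,
      A *m x 3%N = (1 + a) *: x 1%N + (1 + b) *: x 2%N,
      A *m x n = x 3%N + a *: x 1%N,
      (forall i, (1 <= i <= n.+1)%N -> ~~ odd i -> i <> n ->
         A *m x i = x (i + 3)%N)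
    & forall i, (1 <= i <= n.+1)%N -> odd i -> i <> 1%N -> i <> 3%N ->
         A *m x i = x i.-1].

(* A_alpha, A_{alpha,beta} and P_sigma; the last argument of [xget] is the
   defining property, its first one a junk value. *)
Definition A1 (R : realType) (n : nat) (x : nat -> 'cV[R]_n) (a : R) :
    'M[R]_n :=
  xget 0 [set A | A1_spec x a A].

Definition A2 (R : realType) (n : nat) (x : nat -> 'cV[R]_n) (a b : R) :
    'M[R]_n :=
  xget 0 [set A | A2_spec x a b A].

Definition admissible_perm (n : nat) (s : nat -> nat) :=
  set_bij (idx n.+1) (idx n.+1) s /\
  s @` (idx n.+1 `&` [set i | lhs_index i]) =
    idx n.+1 `&` [set i | lhs_index i].

Definition P_spec (R : realType) (n : nat) (x : nat -> 'cV[R]_n)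
    (s : nat -> nat) (P : 'M[R]_n) :=
  forall j, idx n.+1 j -> P *m x j = x (s j).

Definition Psigma (R : realType) (n : nat) (x : nat -> 'cV[R]_n)
    (s : nat -> nat) : 'M[R]_n :=
  xget 0 [set P | P_spec x s P].

(* Main.v *)
(* The support of a vector y of K is the set of generators x_i dominated by a
   multiple of y; a K-nonnegative A acts on supports by a monotone map, and y is
   interior iff its support is full, which by the relation happens as soon as
   it contains one of its two sides.  A vertex on a closed walk of length s of
   the support digraph becomes interior after s(n-1) steps, since a support
   that is not full has at most n-1 elements.  Hence an exponent of at least
   n^2-n forces every reachable circuit of every choice function of the digraph
   to have length n or n+1, and so the digraph is a circuit v_1, ..., v_{n+1}
   with the chord v_{n+1} -> v_2 and possibly the chord v_n -> v_1.  Applying A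
   to the relation then fixes the signs of the v_i and all the coefficients up
   to the three parameters (c0, c1, c2) of [face_mx] (one sign pattern
   of the second digraph is excluded by its smaller exponent).  The same
   computation describes the faces of pi(K) generated by these matrices as
   simplicial cones, and an equivalence of two of them permutes the generators,
   so it preserves the parameters. *)
Require Import Defs.
From HB Require Import structures.
From mathcomp Require Import all_boot zify.

Set Implicit Arguments.
Unset Strict Implicit.
Unset Printing Implicit Defensive.

(** * Closed walks and supports *)

(** A support evolves as in a digraph, except that it jumps to the full set once it contains a side.
    The classical bounds for primitive digraphs therefore do not apply, and the dynamics of sets is
    studied on its own, with [P] and [Q] for the two sides. The constant comes from the circuits of
    lengths n and n + 1: the largest number that is not a sum of copies of n and n + 1 is n^2 - n -
    1, and n^2 - n is such a sum only without any copy of n + 1. This is why one vertex of each side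
    is still missing after n^2 - n - 1 steps from [v 1] when the chord [v n -> v 1] is absent. The
    bound n >= 4 is what rules out circuits of length at most n - 1. The evenness of n makes the
    sides differ in size by one, which fixes the sign of [v 1] and prevents an automorphism from
    exchanging the sides. *)

Lemma min_period (T : finType) (g : T -> T) z l :
  0 < l -> iter l g z = z ->
  exists m, [/\ 0 < m, m <= l, iter m g z = z & uniq (traject g z m)].
Proof.
move=> l0 gl; have exP : exists m, (0 < m) && (iter m g z == z).
  by exists l; rewrite l0 gl eqxx.
case: (ex_minnP exP) => -[|m] //= /eqP gm minm; exists m.+1; split=> //.
  by apply: minm; rewrite l0 gl eqxx.
rewrite looping_uniq; apply/negP => /trajectP[i ltim gi].
have gi1 : iter i.+1 g z = z by rewrite iterS -gi.
have : m.+1 <= i.+1 by apply: minm; apply/andP; split=> //; apply/eqP.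
by rewrite ltnS leqNgt ltim.
Qed.

(** A choice function modified at one or two vertices may be replaced by the old one along a stretch
    of the orbit that avoids them. *)
Lemma eq_iter_along (T : Type) (f g : T -> T) x l :
  (forall a, a < l -> g (iter a f x) = f (iter a f x)) ->
  iter l g x = iter l f x.
Proof.
elim: l => //= l IH gf; rewrite IH ?gf // => a al; apply: gf.
exact: ltn_trans al _.
Qed.

Lemma connect_iter (T : finType) (e : rel T) (f : T -> T) x k :
  (forall y, e y (f y)) -> connect e x (iter k f x).
Proof.
by move=> ef; elim: k => //= k IH; exact: connect_trans IH (connect1 (ef _)).
Qed.

Section Dynamics.
Variables (T : finType) (P Q : {set T}) (E : T -> {set T}).

Implicit Types S : {set T}.

(** The proper faces of a minimal cone correspond to the sets of generators that contain neither
    side of the relation. *)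
Definition face_hull (S : {set T}) : {set T} :=
  if (P \subset S) || (Q \subset S) then [set: T] else S.

Definition face_step (S : {set T}) : {set T} := face_hull (\bigcup_(i in S) E
  i).

Lemma sub_hull S : S \subset face_hull S.
Proof. by rewrite /face_hull; case: ifP => // _; exact: subsetT. Qed.

Lemma hullS S1 S2 : S1 \subset S2 -> face_hull S1 \subset face_hull S2.
Proof.
move=> S12; rewrite /face_hull; case: ifP => [PQ1|_]; last first.
  exact: subset_trans S12 (sub_hull S2).
by case/orP: PQ1 => H; rewrite (subset_trans H S12) ?orbT.
Qed.

Lemma hull_id S : face_hull (face_hull S) = face_hull S.
Proof. by rewrite {2 3}/face_hull; case: ifP => PQ;
  rewrite /face_hull ?PQ // !subsetT. Qed.

Lemma stepS S1 S2 : S1 \subset S2 -> face_step S1 \subset face_step S2.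
Proof.
move=> /subsetP S12; apply/hullS/bigcupsP => i /S12 iS2.
exact: (bigcup_max i).
Qed.

Lemma iter_stepS t S1 S2 :
  S1 \subset S2 -> iter t face_step S1 \subset iter t face_step S2.
Proof. by move=> S12; elim: t => //= t; exact: stepS. Qed.

Lemma mem_step S i j : i \in S -> j \in E i -> j \in face_step S.
Proof.
by move=> iS jE; apply: (subsetP (sub_hull _)); apply/bigcupP; exists i.
Qed.

Lemma path_iter_step x p :
  path [rel i j | j \in E i] x p -> last x p \in iter (size p) face_step [set
    x].
Proof.
elim/last_ind: p => [|p y IH]; first by rewrite set11.
rewrite rcons_path last_rcons size_rcons => /andP[/IH yp Ey].
exact: mem_step yp Ey.
Qed.

Lemma hull1 i : 1 < #|P| -> 1 < #|Q| -> face_hull [set i] = [set i].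
Proof.
move=> P2 Q2; rewrite /face_hull; case: ifP => // /orP[] /subset_leq_card;
  by rewrite cards1 leqNgt (P2, Q2).
Qed.

Hypothesis hullE : forall i, face_hull (E i) = E i.

Lemma step1 i : face_step [set i] = E i.
Proof. by rewrite /face_step big_set1 hullE. Qed.

Variable n : nat.
Hypothesis n4 : 4 <= n.
Hypothesis cardT : #|T| = n.+1.
Hypothesis dPQ : [disjoint P & Q].
Hypothesis P2 : 1 < #|P|.
Hypothesis Q2 : 1 < #|Q|.

Lemma hull_iter_step t i : face_hull (iter t face_step [set i]) = iter t
  face_step [set i].
Proof. by case: t => [|t]; rewrite ?hull1 //= hull_id. Qed.

(** Such a set misses an element of each side, and the sides are disjoint. *)
Lemma card_hull S : face_hull S = S -> S != [set: T] -> #|S| < n.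
Proof.
rewrite /face_hull; case: ifP => [_ <-|/norP[]]; first by rewrite eqxx.
move=> /subsetPn[p pP pS] /subsetPn[q qQ qS] _ _.
have npq : p != q.
  by apply/eqP => pq; move: (disjointFr dPQ pP); rewrite pq qQ.
have : [set p; q] \subset ~: S by rewrite subUset !sub1set !inE pS.
move/subset_leq_card; rewrite cards2 npq => c2.
by have := cardsC S; rewrite cardT; lia.
Qed.

Hypothesis prim : exists p, forall i, iter p face_step [set i] = [set: T].

Lemma neq_set1T i : [set i] != [set: T].
Proof. by apply/eqP => /(congr1 (fun S : {set T} => #|S|));
  rewrite cards1 cardsT cardT; lia. Qed.

(** By primitivity the full set is the image of some set under [face_step], and the full set has an
    image at least as large. *)
Lemma stepT : face_step [set: T] = [set: T].
Proof.
case: prim => p primp; have [i _] : exists i : T, i \in predT.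
  by apply/card_gt0P; rewrite cardT.
apply/eqP; rewrite -subTset -{1}(primp i).
case: p primp => [|p] primp; first by case/eqP: (neq_set1T i); exact: primp.
by apply: stepS; exact: subsetT.
Qed.

Lemma full_leq t t' S :
  t <= t' -> iter t face_step S = [set: T] -> iter t' face_step S = [set: T].
Proof.
move=> /subnK <- fS; rewrite iterD fS; elim: (t' - t) => //= k ->.
exact: stepT.
Qed.

(** The sets [S k] increase because [z] belongs to [S 1]. Two equal consecutive ones would stay
    equal forever, against primitivity, so each round adds an element until the set is full. *)
Lemma closed_walk_full z s : 0 < s -> z \in iter s face_step [set z] ->
  iter (s * n.-1) face_step [set z] = [set: T].
Proof.
move=> s0 zs; pose S k := iter (s * k) face_step [set z].
have SS k : S k \subset S k.+1.
  by rewrite /S mulnS addnC iterD; apply: iter_stepS; rewrite sub1set.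
have zS k : z \in S k.
  by elim: k => [|k /(subsetP (SS k))//]; rewrite /S muln0 set11.
suff claim k : S k = [set: T] \/ k < #|S k|.
  case: (claim n.-1) => // ltn; apply/eqP/negPn/negP => SnT.
  have := card_hull (hull_iter_step (s * n.-1) z) SnT.
  by rewrite -/(S n.-1); lia.
elim: k => [|k IH]; first by right; rewrite /S muln0 /= cards1.
have [->|SkT] := eqVneq (S k.+1) [set: T]; [by left | right].
case: IH => [Sk|ltk]; first by move: SkT (SS k); rewrite Sk subTset => /negP.
apply: leq_ltn_trans ltk _; apply: proper_card; rewrite properEneq SS andbT.
apply/eqP => Sk; have fixS j : iter (s * j) face_step (S k) = S k.
  elim: j => [|j IH]; first by rewrite muln0.
  by rewrite mulnS iterD IH {2}Sk /S mulnS iterD.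
case: prim => p primp; move: SkT; rewrite -Sk -subTset -(fixS p).
rewrite -(full_leq (leq_pmull p s0) (primp z)) => /negP; apply.
by apply: iter_stepS; rewrite sub1set.
Qed.

Local Notation arc := [rel i j | j \in E i].

(** A circuit of length m that is met after r steps fills the support of [i0] in m (n - 1) + r
    steps. If r is least along a simple path, then r + m <= n + 1, which makes a short circuit too
    fast for [i0]. *)
Lemma period_ge i0 g z l : iter (n ^ 2 - n - 1) face_step [set i0] != [set: T]
  ->
  connect arc i0 z -> (forall i, g i \in E i) -> 0 < l -> iter l g z = z ->
  n <= l.
Proof.
move=> bad0 i0z gE l0 gl; have [m [m0 ml gm Um]] := min_period l0 gl.
apply: leq_trans ml; case/connectP: i0z => p0 /shortenP[p ep Up _] zp.
set C := traject g z m.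
have hasC : has (mem C) (i0 :: p).
  apply/hasP; exists z; first by rewrite {1}zp mem_last.
  by rewrite /= /C -(prednK m0) trajectS mem_head.
(* The simple path meets the circuit at index [r] and not before, so its initial [r] vertices are
   distinct from each other and from the circuit. *)
set r := find (mem C) (i0 :: p).
have rp : r < (size p).+1 by rewrite -[(size p).+1]/(size (i0 :: p)) -has_find.
set z' := nth i0 (i0 :: p) r.
have z'C : z' \in C by exact: (nth_find i0 hasC).
have z'r : z' \in iter r face_step [set i0].
  have := path_iter_step (take_path r ep).
  rewrite (last_nth i0) size_takel // -[i0 :: take r p]/(take r.+1 (i0 :: p)).
  by rewrite nth_take.
have rm : r + m <= n.+1.
  rewrite -cardT -[X in _ + X](size_traject g z m).
  rewrite -[X in X + _](@size_takel r _ (i0 :: p)); last exact: ltnW.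
  have Ucat : uniq (take r (i0 :: p) ++ C).
    by rewrite cat_uniq take_uniq // Um andbT has_sym has_take ?ltnn.
  by rewrite -size_cat -(card_uniqP Ucat); exact: max_card.
have gz' : iter m g z' = z'.
  case/trajectP: z'C => k _ ->.
  by rewrite -iterD addnC iterD gm.
have zm : z' \in iter m face_step [set z'].
  rewrite -{1}gz'; elim: (m) => [|k IH]; first by rewrite set11.
  exact: mem_step IH (gE _).
rewrite leqNgt; apply/negP => mn; case/eqP: bad0.
(* For m <= n - 1 and r <= n + 1 - m this number is at most n^2 - 2n + 3, hence at most n^2 - n - 1
   because n >= 4. *)
apply: (@full_leq (m * n.-1 + r)).
  by nia.
apply/eqP; rewrite iterD -subTset -(closed_walk_full m0 zm).
by apply: iter_stepS; rewrite sub1set.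
Qed.

Definition labelled_circuit (v : nat -> T) :=
  [/\ forall i j, 1 <= i <= n.+1 -> 1 <= j <= n.+1 -> v i = v j -> i = j,
      forall i, 1 <= i < n -> E (v i) = [set v i.+1],
      E (v n) = [set v n.+1] \/ E (v n) = [set v n.+1; v 1]
    & E (v n.+1) = [set v 1; v 2]].

Variable i0 : T.
Hypothesis bad0 : iter (n ^ 2 - n - 1) face_step [set i0] != [set: T].

(* A chord u -> u' closes a circuit with the path from u' to u, so it skips just
   one vertex; two chords that can be used in the same circuit would give a
   circuit of length n - 1. *)
Lemma hamiltonian_labelled f z : (forall i, f i \in E i) ->
  uniq (traject f z n.+1) -> iter n.+1 f z = z -> exists v, labelled_circuit v.
Proof.
move=> fE Uz fz.
have fT u : exists2 k, k <= n & u = iter k f z.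
  have cz : #|traject f z n.+1| = #|T|.
    by rewrite (card_uniqP Uz) size_traject cardT.
  have : u \in traject f z n.+1 by rewrite (subset_cardP cz (subset_predT _)).
  by case/trajectP => k; rewrite ltnS; exists k.
have fu u : iter n.+1 f u = u.
  by have [k _ ->] := fT u; rewrite -iterD addnC iterD fz.
have injz a b : a <= n -> b <= n -> iter a f z = iter b f z -> a = b.
  move=> an bn fab; apply/eqP; have := nth_uniq z _ _ Uz => <-.
  - by rewrite !nth_traject // fab.
  - by rewrite size_traject.
  - by rewrite size_traject.
have zu u : exists j, z = iter j f u.
  have [k kn ->] := fT u; exists (n.+1 - k).
  by rewrite -iterD subnK ?fz // leqW.
have per u c : 0 < c <= n -> iter c f u <> u.
  case/andP=> c0 cn fc; have [j zj] := zu u.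
  by have := injz c 0 cn isT; rewrite zj -iterD addnC iterD fc => /(_ erefl);
    lia.
have injf u a b : a <= n -> b <= n -> iter a f u = iter b f u -> a = b.
  wlog ltab : a b / a < b => [wl an bn fab|an bn fab].
    by case: (ltngtP a b) => // ltab; [|symmetry]; apply: wl.
  exfalso; apply: (per u (b - a)); first by lia.
  rewrite -[RHS](fu u) -[in RHS](subnK (leqW an)) iterD fab -iterD.
  by rewrite -[LHS]fu -iterD; congr (iter _ f u); lia.
have fT' u u' : exists2 j, j <= n & u' = iter j f u.
  have [a an ->] := fT u'; have [b bn ->] := fT u.
  case: (leqP b a) => ab.
    by exists (a - b); [lia | rewrite -iterD subnK].
  exists (n.+1 - b + a); first by lia.
  rewrite -iterD; have -> : n.+1 - b + a + b = a + n.+1 by lia.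
  by rewrite iterD fz.
have con u : connect arc i0 u.
  have [j _ ->] := fT' i0 u; exact: connect_iter.
have chord u u' : u' \in E u -> u' = f u \/ u' = f (f u).
  move=> uE; pose g x := if x == u then u' else f x.
  have gE i : g i \in E i by rewrite /g; case: eqP => [->|].
  have [j jn uj] := fT' u u'.
  have gu : g u = u' by rewrite /g eqxx.
  case: j jn uj => [_ u'u|j jn uj].
    have n1 : n <= 1 by apply: (period_ge bad0 (con u) gE) => //=; rewrite gu.
    by have := leq_trans n4 n1.
  have: iter (n - j).+1 g u = u.
    rewrite iterSr gu (eq_iter_along (f := f)) uj.
      by rewrite -iterD -{2}(fu u); congr (iter _ f u); lia.
    move=> a al; rewrite /g -iterD; case: eqP => // /(injf u _ 0).
    by move=> /(_ _ isT) H; have := H; lia.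
  move/(period_ge bad0 (con u) gE (ltn0Sn _)).
  by case: j {jn} uj => [|[|j]] uj; [left|right|lia].
have two_chords u k : 2 <= k <= n.-1 -> f (f u) \in E u ->
    f (f (iter k f u)) \in E (iter k f u) -> False.
  case/andP=> k2 kn uE; set w := iter k f u => wE.
  pose g x := if x == u then f (f u) else if x == w then f (f w) else f x.
  have gE i : g i \in E i.
    by rewrite /g; case: eqP => [->|_] //; case: eqP => [->|].
  have gf a : 0 < a <= n -> a != k -> g (iter a f u) = f (iter a f u).
    case/andP=> a0 an ak; rewrite /g; case: eqP => [/(injf u a 0 an isT)|_].
      by lia.
    by case: eqP => // /injf; lia.
  have gw : iter k.-1 g u = w.
    have -> : k.-1 = (k - 2).+1 by lia.
    rewrite iterSr {2}/g eqxx -[f (f u)]/(iter 2 f u).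
    rewrite (eq_iter_along (f := f)) -?iterD; first by rewrite subnK.
    by move=> a al; rewrite -iterD gf //; lia.
  have wu : w != u by apply/eqP => /(injf u k 0); lia.
  have gu : iter n.-1 g u = u.
    have -> : n.-1 = (n.-1 - k).+1 + k.-1 by lia.
    rewrite iterD gw iterSr {2}/g (negPf wu) eqxx.
    rewrite -[f (f w)]/(iter 2 f w) /w -iterD.
    rewrite (eq_iter_along (f := f)) -?iterD.
      by rewrite -{2}(fu u); congr (iter _ f u); lia.
    by move=> a al; rewrite -iterD gf //; lia.
  by have := period_ge bad0 (con u) gE _ gu; lia.
pose ch := [pred u | E u != [set f u]].
have chE u : ch u -> E u = [set f u; f (f u)].
  move=> /= chu; apply/setP => u'; rewrite !inE; apply/idP/orP.
    by case/chord => ->; [left|right].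
  case=> /eqP -> //; apply: contraNT chu => nE; apply/eqP/setP => u2.
  rewrite inE; apply/idP/eqP => [u2E|-> //].
  by case: (chord _ _ u2E) => // u2E'; rewrite -u2E' u2E in nE.
have nchE u : ~~ ch u -> E u = [set f u] by move=> /negPn/eqP.
(* Without chords a one-element support would keep one element forever. *)
have [u chu] : exists u, ch u.
  have [/existsP //|/existsPn nch] := boolP [exists u, ch u];
    case: prim => p /(_ z).
  have -> : iter p face_step [set z] = [set iter p f z].
    by elim: p => //= p ->; rewrite step1 nchE.
  by move/eqP; rewrite (negPf (neq_set1T _)).
(* In the two exceptional cases one chord skips the tail of the other, so no circuit uses both.
   Hence at most two vertices carry a chord, and two such vertices are adjacent. *)
have ch_adj u1 k : 0 < k <= n -> ch u1 -> ch (iter k f u1) -> k = 1 \/ k = n.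
  move=> k1n /chE E1 /chE E2.
  have [->|k1] := eqVneq k 1; first by left.
  have [->|kn] := eqVneq k n; first by right.
  by case: (two_chords u1 k); [lia| |]; rewrite ?E1 ?E2 !inE eqxx orbT.
have injv w i j : 1 <= i <= n.+1 -> 1 <= j <= n.+1 ->
    iter i f w = iter j f w -> i = j.
  by case: i j => [|i] [|j] // Hi Hj; rewrite !iterSr => /injf ->.
(* The origin is chosen so that the chord into [v 2] leaves [v n.+1]: this vertex is [f u1] if [u1]
   and [f u1] both carry a chord, and otherwise the only vertex with a chord. *)
have [/existsP[u1 /andP[ch1 ch2]]|/existsPn nadj] :=
    boolP [exists u1, ch u1 && ch (f u1)].
  exists (fun i => iter i f (f u1)); split.
  - exact: injv.
  - move=> i i1n; rewrite nchE ?iterS //; apply/negP => chi.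
    have := @ch_adj u1 i.+1; rewrite iterSr => /(_ _ ch1 chi) ni.
    by have := @ch_adj (f u1) i _ ch2 chi; lia.
  - by right; rewrite fu -iterSr fu (chE _ ch1).
  - by rewrite fu (chE _ ch2).
exists (fun i => iter i f u); split.
- exact: injv.
- move=> i i1n; rewrite nchE ?iterS //; apply/negP => chi.
  have [|i1|] := @ch_adj u i _ chu chi; [lia| |lia].
  by have := nadj u; rewrite chu -[f u]/(iter 1 f u) -{1}i1 chi.
- left; rewrite nchE ?iterS //; apply/negP => chn.
  by have := nadj (iter n f u); rewrite chn -iterS fu chu.
- by rewrite fu (chE _ chu).
Qed.

Lemma E_neq0 i : E i != set0.
Proof.
apply/eqP => Ei0; case: prim => p /(_ i); case: p => [|p].
  by move/eqP; rewrite (negPf (neq_set1T _)).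
have h0 : face_hull set0 = set0.
  rewrite /face_hull !subset0; case: ifP => // /orP[] /eqP PQ0.
    by move: P2; rewrite PQ0 cards0.
  by move: Q2; rewrite PQ0 cards0.
rewrite iterSr step1 Ei0; have -> : iter p face_step set0 = set0.
  by elim: p => //= p ->; rewrite /face_step big_set0 h0.
by move/setP/(_ i); rewrite !inE.
Qed.

(* If no choice function is a circuit through all the vertices, then one of them
   has a circuit of length n, and the remaining vertex w runs parallel to some
   f u on it: u -> w -> f (f u).  Then the support of f (f u) is n-periodic. *)
Theorem slow_digraph : exists v, labelled_circuit v.
Proof.
have [f fE] : exists f : T -> T, forall i, f i \in E i.
  exists (fun i => odflt i [pick j in E i]) => i; case: pickP => //= E0.
  by case/eqP: (E_neq0 i); apply/setP => j; rewrite E0 inE.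
(* The orbit of [i0] ends in a circuit, through [z], whose length can only be n or n + 1 by
   [period_ge]. *)
have /trajectP[a alt fa] := looping_order f i0.
set z := iter a f i0; have iz : connect arc i0 z by exact: connect_iter.
have {alt fa} [m [m0 _ fm Um]] : exists m,
    [/\ 0 < m, m <= order f i0 - a, iter m f z = z & uniq (traject f z m)].
  by apply: min_period; rewrite ?subn_gt0 // -iterD subnK // ltnW.
have mn := period_ge bad0 iz fE m0 fm.
have : m <= n.+1.
  by have := max_card [in traject f z m];
    rewrite (card_uniqP Um) size_traject cardT.
rewrite leq_eqVlt => /orP[/eqP mn1|];
  first by apply: (@hamiltonian_labelled f z); rewrite -?mn1.
rewrite ltnS => mn'; have {mn mn'} ? : m = n by lia.
subst m; pose C := [set x in traject f z n].
have cardC : #|C| = n by rewrite cardsE (card_uniqP Um) size_traject.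
have [w Cw] : exists w, ~: C = [set w].
  by apply/cards1P; have := cardsC C; rewrite cardT cardC; lia.
have wC : w \notin C by rewrite -in_setC Cw set11.
have Cor x : x \in C \/ x = w.
  by case: (boolP (x \in C)) => [|xC]; [left|right; apply/set1P;
    rewrite -Cw inE].
have Cz u : u \in C -> exists2 k, k < n & u = iter k f z.
  by rewrite inE => /trajectP.
have zC k : iter k f z \in C.
  have [q [r [-> rn]]] : exists q r, k = r + q * n /\ r < n.
    by exists (k %/ n), (k %% n); rewrite addnC -divn_eq ltn_mod.
  have -> : iter (r + q * n) f z = iter r f z.
    by rewrite iterD; congr iter; elim: q => // q IH; rewrite mulSn iterD IH.
  by rewrite inE; apply/trajectP; exists r.
have fC u k : u \in C -> iter k f u \in C.
  by case/Cz => j _ ->; rewrite -iterD zC.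
have fu u : u \in C -> iter n f u = u.
  by case/Cz => j _ ->; rewrite -iterD addnC iterD fm.
have con u : u \in C -> connect arc i0 u.
  by case/Cz => k _ ->; apply: connect_trans iz _; exact: connect_iter.
have fT' u u' : u \in C -> u' \in C -> exists2 j, j < n & u' = iter j f u.
  case/Cz=> b bn -> /Cz[c cn ->].
  case: (leqP b c) => bc.
    by exists (c - b); [lia | rewrite -iterD subnK].
  exists (n - b + c); first by lia.
  rewrite -iterD; have -> : n - b + c + b = c + n by lia.
  by rewrite iterD fm.
have per u c : u \in C -> 0 < c < n -> iter c f u <> u.
  move=> uC cn fc; have := period_ge bad0 (con u uC) fE _ fc; lia.
have chord u u' : u \in C -> u' \in E u -> u' = f u \/ u' = w.
  move=> uC uE; case: (Cor u') => [u'C|]; [left|by right].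
  pose g x := if x == u then u' else f x.
  have gE i : g i \in E i by rewrite /g; case: eqP => [->|].
  have [j jn uj] := fT' u u' uC u'C.
  have gu : g u = u' by rewrite /g eqxx.
  case: j jn uj => [_ u'u|j jn uj].
    have n1 : n <= 1 by apply: (period_ge bad0 (con u uC) gE) => //=;
      rewrite gu.
    by have := leq_trans n4 n1.
  have: iter (n - j.+1).+1 g u = u.
    rewrite iterSr gu (eq_iter_along (f := f)) uj.
      by rewrite -iterD -{2}(fu u uC); congr (iter _ f u); lia.
    move=> b bl; rewrite /g -iterD; case: eqP => // /(per u _ uC); lia.
  move/(period_ge bad0 (con u uC) gE (ltn0Sn _)).
  by case: j {jn} uj => [|j] uj; [|lia].
have [u uC uw] : exists2 u, u \in C & w \in E u.
  have [/existsP[u /andP[]]|/existsPn nw] := boolP [exists u, (u \in C) && (w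
    \in E u)].
    by exists u.
  case: prim => p /(_ z); have -> : iter p face_step [set z] = [set iter p f z].
    elim: p => //= p ->; rewrite step1; apply/setP => u'; rewrite inE.
    apply/idP/eqP => [u'E|->//]; case: (chord _ _ (zC p) u'E) => // u'w.
    by have := nw (iter p f z); rewrite zC -u'w u'E.
  by move/eqP; rewrite (negPf (neq_set1T _)).
(* If [w] has an arc to some [w'] other than [f (f u1)], then the detour [u1 -> w -> w'] will
   produce a circuit through all the vertices. *)
have [/exists_inP[u1 u1C /andP[wu1 Ewn]]|/exists_inPn Ew] :=
    boolP [exists u1 in C, (w \in E u1) && (E w != [set f (f u1)])].
  have [w' wE nw'] : exists2 w', w' \in E w & w' != f (f u1).
    have [/exists_inP[w' ? ?]|/exists_inPn nw'] :=
      boolP [exists w' in E w, w' != f (f u1)]; first by exists w'.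
    case/set0Pn: (E_neq0 w) => w' wE; case/eqP: Ewn; apply/setP => x.
    rewrite inE; apply/idP/eqP => [xE|->]; first exact/eqP/negPn/nw'.
    by have /negPn/eqP <- := nw' _ wE.
  have wu1n : u1 != w by apply: contraNneq wC => <-.
  pose h x := if x == u1 then w else if x == w then w' else f x.
  have hE i : h i \in E i.
    by rewrite /h; case: eqP => [->|_] //; case: eqP => [->|].
  have hu1 : h u1 = w by rewrite /h eqxx.
  have hw : h w = w' by rewrite /h eq_sym (negPf wu1n) eqxx.
  have cw : connect arc i0 w.
    by apply: connect_trans (con u1 u1C) _; apply: connect1.
  case: (Cor w') => [w'C|w'w]; last first.
    have n1 : n <= 1 by apply: (period_ge bad0 cw hE) => //=; rewrite hw.
    by have := leq_trans n4 n1.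
  have [j jn w'j] := fT' u1 w' u1C w'C.
  have j0 : j != 0.
    apply/eqP => j0; rewrite j0 in w'j.
    have n2 : n <= 2.
      by apply: (period_ge bad0 (con u1 u1C) hE) => //=; rewrite hu1 hw.
    by have := leq_trans n4 n2.
  (* After the detour, [h] follows the old circuit from [w' = iter j f u1] back to [u1]. By
     [period_ge] this forces j <= 2, and j = 2 is excluded by [nw']. *)
  have hper : iter (n - j).+2 h u1 = u1.
    rewrite iterSr hu1 iterSr hw w'j (eq_iter_along (f := f)).
      by rewrite -iterD subnK; [exact: fu | exact: ltnW].
    move=> b bl; rewrite /h -iterD; case: eqP => [ub|_].
      by case: (@per u1 (b + j) u1C _ ub); clear -bl j0 jn; lia.
    by case: eqP => // fw; case/negP: wC; rewrite -fw fC.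
  have j1 : j = 1.
    have nj : n <= (n - j).+2 by apply: (period_ge bad0 (con u1 u1C) hE _ hper).
    have j2 : j != 2 by apply: contraNneq nw' => j2; rewrite w'j j2.
    by clear -nj j2 j0 jn; lia.
  have {}hper : iter n.+1 h u1 = u1.
    by rewrite -{2}hper j1; congr (iter _ h u1); clear -n4; lia.
  have [c [c0 cn hc Uc]] := min_period (ltn0Sn n) hper.
  have nc := period_ge bad0 (con u1 u1C) hE c0 hc.
  move: cn; rewrite leq_eqVlt => /orP[/eqP cn|cn].
    by apply: (hamiltonian_labelled hE _ hper); rewrite -cn.
  have cE : c = n by apply/eqP; rewrite eqn_leq -ltnS cn.
  by case/eqP: wu1n; rewrite -hu1 -{2}hc cE -iterS hper.
have {}Ew u1 : u1 \in C -> w \in E u1 -> E w = [set f (f u1)].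
  by move=> u1C wu1; have := Ew _ u1C; rewrite wu1 => /negPn/eqP.
(* Another vertex with an arc to [w] would have the same second iterate as [u], since [E w] is a
   singleton; but [f] is injective on the circuit. *)
have EC u1 : u1 \in C -> u1 != u -> E u1 = [set f u1].
  move=> u1C u1u; apply/setP => x; rewrite inE; apply/idP/eqP => [xE|->] //.
  case: (chord _ _ u1C xE) => // xw; case/eqP: u1u.
  have wu1 : w \in E u1 by rewrite -xw.
  have /set1P ff : f (f u) \in [set f (f u1)].
    by rewrite -(Ew u1) // (Ew u) // set11.
  rewrite -(fu u) // -(fu u1) //.
  have -> : n = n - 2 + 2 by rewrite subnK // (leq_trans _ n4).
  by rewrite !iterD /= ff.
have Eu : E u = [set f u; w].
  apply/setP => x; rewrite !inE; apply/idP/orP.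
    by case/(chord _ _ uC) => ->; [left|right].
  by case=> /eqP ->.
(* The two branches at [u] merge after one more step, so the support of [f (f u)] returns to a
   singleton in every round of n steps and never stays full. *)
have ffu : face_step [set f u; w] = [set f (f u)].
  rewrite /face_step bigcup_setU !big_set1 (Ew u) // EC ?setUid ?hull1 ?fC //.
    by apply: (fC _ 1).
  by apply/eqP; apply: (per u 1) => //; lia.
have walk k : k < n.-1 -> iter k face_step [set f (f u)] = [set iter k.+2 f u].
  elim: k => //= k IH kn; rewrite IH ?step1; last exact: ltn_trans kn.
  rewrite EC //; first exact: (fC _ k.+2).
  by apply/eqP; apply: (per u k.+2) => //; lia.
have fix_ffu : iter n face_step [set f (f u)] = [set f (f u)].
  have -> : n = (n - 2).+2 by lia.
  rewrite !iterS walk; last by lia.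
  by rewrite (_ : (n - 2).+2 = n) ?fu ?step1 ?Eu //; lia.
case: prim => p /(_ (f (f u))) /(@full_leq p (p * n)).
have -> : iter (p * n) face_step [set f (f u)] = [set f (f u)].
  by elim: (p) => // k IH; rewrite mulSn addnC iterD fix_ffu.
move=> /(_ (leq_pmulr _ _)) full; have /eqP[] := neq_set1T (f (f u)).
by apply: full; lia.
Qed.

End Dynamics.

(** * Lengths of walks in a circuit with chords *)

Section CircuitExponent.
Variables (T : finType) (P Q : {set T}) (E : T -> {set T}) (n : nat).
Local Notation step := (face_step P Q E).
Local Notation hull := (face_hull P Q).

Lemma iter_step_trans s t x y z : y \in iter s step [set x] ->
  z \in iter t step [set y] -> z \in iter (t + s) step [set x].
Proof.
by move=> yx zy; rewrite iterD; apply: (subsetP (iter_stepS _ _ _ _ _)) zy;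
  rewrite sub1set.
Qed.

Hypothesis n4 : 4 <= n.
Hypothesis cardT : #|T| = n.+1.
Hypothesis hullE : forall i, hull (E i) = E i.
Variable v : nat -> T.
Hypothesis vE : labelled_circuit E n v.

Lemma labelled_surj x : exists2 i, 1 <= i <= n.+1 & x = v i.
Proof.
have [injv _ _ _] := vE.
have U : uniq [seq v i | i <- iota 1 n.+1].
  rewrite map_inj_in_uniq ?iota_uniq // => i j; rewrite !mem_iota => iI jI.
  by apply: injv; lia.
have cU : #|[seq v i | i <- iota 1 n.+1]| = #|T|.
  by rewrite (card_uniqP U) size_map size_iota cardT.
have : x \in [seq v i | i <- iota 1 n.+1].
  by rewrite (subset_cardP cU (subset_predT _)).
by case/mapP => i; rewrite mem_iota => iI ->; exists i => //; lia.
Qed.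

Lemma labelled_arc i : 1 <= i <= n -> v i.+1 \in E (v i).
Proof.
have [_ Ei En _] := vE; case: (ltnP i n) => [ltin|lein] iI.
  by rewrite Ei ?set11 //; lia.
have -> : i = n by lia.
by case: En => ->; rewrite ?set21 ?set11.
Qed.

Lemma labelled_back : v 1 \in E (v n.+1) /\ v 2 \in E (v n.+1).
Proof. by have [_ _ _ ->] := vE; rewrite set21 set22. Qed.

Lemma labelled_stepT : step [set: T] = [set: T].
Proof.
apply/eqP; rewrite -subTset; apply/subsetP => x _.
have [[|[|i]] iI ->] := labelled_surj x; first by [].
  by apply: (mem_step P Q (i := v n.+1)) => //; case: labelled_back.
by apply: (mem_step P Q (i := v i.+1)) => //; apply: labelled_arc; lia.
Qed.

Lemma labelled_walk i d :
  1 <= i -> i + d <= n.+1 -> v (i + d) \in iter d step [set v i].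
Proof.
move=> i1; elim: d => [|d IH] id; first by rewrite addn0 set11.
rewrite addnS /=; apply: (mem_step P Q (i := v (i + d))); first by apply: IH;
  lia.
by apply: labelled_arc; lia.
Qed.

(** At [v 2] there are closed walks of length n, through the chord [v n.+1 -> v 2], and of length n
    + 1, through [v 1]. The walk consists of [a] of the former, [b] of the latter and the path from
    [v 2] to [v j]. *)
Lemma labelled_walk2 j a b : 2 <= j <= n.+1 ->
  v j \in iter (j - 2 + (a * n + b * n.+1)) step [set v 2].
Proof.
have [b1 b2] := labelled_back; have := @labelled_walk 2 n.-1 isT.
have -> : 2 + n.-1 = n.+1 by lia.
move=> /(_ (leqnn _)) w2.
have c0 : v 2 \in iter n step [set v 2].
  rewrite (_ : n = (n.-1).+1) /=; last by lia.
  exact: mem_step w2 b2.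
have c1 : v 2 \in iter n.+1 step [set v 2].
  rewrite (_ : n = (n.-1).+1) /=; last by lia.
  by apply: (mem_step P Q (i := v 1));
    [exact: mem_step w2 b1 | apply: labelled_arc; lia].
move=> jI; apply: (@iter_step_trans _ _ _ (v 2)); last first.
  by have := @labelled_walk 2 (j - 2) isT; rewrite subnKC; [apply|]; lia.
apply: (@iter_step_trans _ _ _ (v 2)).
  by elim: b => [|b IH]; [rewrite mul0n set11 | rewrite mulSn;
    exact: iter_step_trans IH c1].
by elim: a => [|a IH]; [rewrite mul0n set11 | rewrite mulSn;
  exact: iter_step_trans IH c0].
Qed.

(** After at least one step a support is closed under [face_hull]. *)
Lemma full_step t x S : 0 < t -> S = P \/ S = Q ->
  {subset S <= iter t step [set x]} -> iter t step [set x] = [set: T].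
Proof.
case: t => // t _ SPQ sS; rewrite iterS /face_step -hull_id -/(face_step _ _ _
  _) -iterS /face_hull.
by case: SPQ sS => <- /subsetP ->; rewrite ?orbT.
Qed.

(** From [v 1] and [v n.+1] an arc leads to [v 2], at the price of one step. The singletons of the
    other vertices occur among the iterates of [v 2], so these vertices are not slower than
    [v 2]. *)
Lemma labelled_full_all t : iter t step [set v 2] = [set: T] ->
  forall x, iter t.+1 step [set x] = [set: T].
Proof.
move=> full2; have fullS s : t <= s -> iter s step [set v 2] = [set: T].
  move=> ts; rewrite -(subnK ts) iterD full2; elim: (s - t) => //= k ->.
  exact: labelled_stepT.
have mono x : v 2 \in E x -> iter t.+1 step [set x] = [set: T].
  move=> x2; apply/eqP; rewrite iterSr step1 // -subTset -full2.
  by apply: iter_stepS; rewrite sub1set.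
have [_ Ei _ _] := vE.
have iter2 k : k.+2 <= n -> iter k step [set v 2] = [set v k.+2].
  by elim: k => //= k IH kn; rewrite IH ?step1 ?Ei //; lia.
move=> x; have [[|[|i]] iI ->] := labelled_surj x; first by [].
  by apply: mono; apply: labelled_arc; lia.
have [ilt|ige] := ltnP i.+1 n.
  by rewrite -iter2 // -iterD fullS //; lia.
have -> : i.+2 = n.+1 by lia.
by apply: mono; case: labelled_back.
Qed.

(* v 2 reaches v j by j - 3 circuits of length n, n + 1 - j circuits of length
   n + 1 and a path of length j - 2. *)
Lemma labelled_full S : S = P \/ S = Q ->
  (forall x, x \in S -> exists2 j, 3 <= j <= n.+1 & x = v j) ->
  forall x, iter (n ^ 2 - n) step [set x] = [set: T].
Proof.
move=> SPQ Sv; have -> : n ^ 2 - n = (n ^ 2 - n - 1).+1 by nia.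
apply/labelled_full_all/(full_step _ SPQ); first by nia.
move=> _ /Sv[j jI ->].
have -> : n ^ 2 - n - 1 = j - 2 + ((j - 3) * n + (n.+1 - j) * n.+1) by nia.
by apply: labelled_walk2; lia.
Qed.

(** For j between 2 and n, the vertex [v j] is reached from [v 2] by j - 2 circuits of length n, n -
    j circuits of length n + 1 and a path of length j - 2: one step less than in [labelled_full]. *)
Lemma labelled_fast S : S = P \/ S = Q ->
  (forall x, x \in S -> exists2 j, 2 <= j <= n & x = v j) ->
  forall x, iter (n ^ 2 - n - 1) step [set x] = [set: T].
Proof.
move=> SPQ Sv; have -> : n ^ 2 - n - 1 = (n ^ 2 - n - 2).+1 by nia.
apply/labelled_full_all/(full_step _ SPQ); first by nia.
move=> _ /Sv[j jI ->].
have -> : n ^ 2 - n - 2 = j - 2 + ((j - 2) * n + (n - j) * n.+1) by nia.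
by apply: labelled_walk2; lia.
Qed.

End CircuitExponent.

From mathcomp Require Import all_order all_algebra.
From mathcomp Require Import all_classical all_reals all_analysis.
From mathcomp Require Import ring lra.
Import Order.TTheory GRing.Theory Num.Theory numFieldNormedType.Exports.
Local Open Scope classical_set_scope.
Local Open Scope ring_scope.

(** * Faces and generators of cones *)

Lemma continuous_mx_form (R : realType) (p q : nat)
    (f : {scalar 'M[R]_(p, q)}) : continuous (f : 'M[R]_(p, q) -> R).
Proof.
have -> : (f : 'M[R]_(p, q) -> R) =
    fun M => \sum_i \sum_j M i j * f (delta_mx i j).
  apply/funext => M; rewrite {1}(matrix_sum_delta M) linear_sum.
  by apply: eq_bigr => i _; rewrite linear_sum; apply: eq_bigr => j _;
    rewrite linearZ.
apply: continuous_big => [|i _]; first exact: add_continuous.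
apply: continuous_big => [|j _]; first exact: add_continuous.
by move=> M; apply: (@continuousM R _ (fun M : 'M[R]_(p, q) => M i j)
  (fun=> f (delta_mx i j)) M); [exact: (@coord_continuous _ _ _ i j M) | exact:
    cst_continuous].
Qed.

Lemma nbhs_line (R : realType) (p q : nat) (A : set 'M[R]_(p, q))
    (x z : 'M[R]_(p, q)) :
  nbhs x A -> exists2 e : R, 0 < e & A (x - e *: z).
Proof.
move=> Ax; have: {for 0, continuous (fun e : R => x - e *: z)}.
  by apply: cvgB; [exact: cvg_cst | exact: scalel_continuous].
rewrite /prop_for /continuous_at scale0r subr0 => /(_ _ Ax) /nbhs_ballP[e /= e0
  eA].
exists (e / 2); first lra.
by apply: eA; rewrite /ball /= sub0r normrN gtr0_norm; lra.
Qed.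

Lemma near_form_gt (R : realType) (p q : nat) (f : {scalar 'M[R]_(p, q)}) v a :
  a < f v -> \forall y \near v, a < f y.
Proof.
move=> afv; have : nbhs (f v) [set r | a < r].
  by apply: open_nbhs_nbhs; split; [exact: open_gt | exact: afv].
by move/(@continuous_mx_form R p q f v).
Qed.

Section ConvexCones.
Variables (R : realType) (p q : nat).
Implicit Types (C F G : set 'M[R]_(p, q)) (x y z : 'M[R]_(p, q)).

Lemma coneB_scale C (t : R) x y : convex_cone C -> 0 < t ->
  C (t *: x - y) -> C (x - t^-1 *: y).
Proof.
move=> [_ _ CZ] t0 Ct; have := CZ t^-1 _ (ltW _) Ct.
by rewrite scalerBr scalerA mulVf ?gt_eqF // scale1r invr_gt0; apply.
Qed.

(** The right-hand side is a face that contains [x], and each of its elements is dominated by a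
    multiple of [x], so it lies in every face through [x]. *)
Lemma PhiE C x : convex_cone C -> C x ->
  Phi C x = [set y | C y /\ exists2 t : R, 0 <= t & C (t *: x - y)].
Proof.
move=> [C0 CD CZ] Cx; apply/seteqP; split=> [y|y [Cy [t t0 Cty]] F]; last first.
  move=> [[_ _ FZ] _ Fface] Fx; apply: (Fface (t *: x)) => //; exact: FZ.
apply=> /=; last first.
  by split=> //; exists 1; rewrite // scale1r subrr.
split=> [|z []//|u z [Cu [t t0 Ctu]] Cz Cuz]; last first.
  by split=> //; exists t => //; rewrite -(subrK u (t *: x)) -addrA; exact: CD.
split=> [|u z [Cu [t t0 Ctu]] [Cz [s s0 Csz]]|a u a0 [Cu [t t0 Ctu]]].
- by split=> //; exists 0; rewrite // scale0r subrr.
- split; first exact: CD.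
  exists (t + s); first exact: addr_ge0.
  by rewrite scalerDl opprD addrACA; exact: CD.
- split; first exact: CZ.
  exists (a * t); first exact: mulr_ge0.
  by rewrite -scalerA -scalerBr; exact: CZ.
Qed.

Lemma Phi_face C x : convex_cone C -> C x -> is_face C (Phi C x).
Proof.
move=> cC Cx; have PE := PhiE cC Cx; case: (cC) => C0 CD CZ.
split=> [|z|u z].
- split=> [F [[]//]|u z Fu Fz F|a u a0 Fu F] Ff Fx;
  case: (Ff) => -[_ FD FZ] _ _.
    by apply: FD; [exact: Fu | exact: Fz].
  by apply: FZ => //; exact: Fu.
- by rewrite PE => -[].
- move=> Fu Cz Cuz F Ff Fx; case: (Ff) => _ _; apply;
  [exact: Fu Ff Fx | exact: Cz | exact: Cuz].
Qed.

Lemma Phi_id C x : Phi C x x. Proof. by move=> F. Qed.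

Lemma PhiS C x y : Phi C x y -> Phi C y `<=` Phi C x.
Proof. by move=> Pxy z Pyz F fF Fx; apply: Pyz => //; exact: Pxy. Qed.

(** A finite family in [F] whose span has maximal dimension: an element of [F] outside this span
    would enlarge it. *)
Lemma cone_span F : convex_cone F -> exists s : seq 'M[R]_(p, q),
  {in s, forall z, F z} /\ F `<=` [set` (span s)].
Proof.
move=> cF; pose Pd := [pred k : nat | `[< exists s : seq 'M[R]_(p, q),
  {in s, forall z, F z} /\ \dim (span s) = k >]].
have ex0 : exists k, Pd k by exists (\dim (span ([::] : seq 'M[R]_(p, q))));
  apply/asboolP; exists [::].
have bd k : Pd k -> (k <= \dim {:'M[R]_(p, q)})%N.
  by move=> /asboolP[s [_ <-]]; apply: dimvS; exact: subvf.
case: (ex_maxnP ex0 bd) => k /asboolP[s [sF sk]] maxk.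
exists s; split=> // z Fz /=; apply/negPn/negP => zs.
have /maxk : Pd (\dim (span (z :: s))).
  apply/asboolP; exists (z :: s); split=> // u; rewrite inE => /orP[/eqP->//|].
  exact: sF.
rewrite -sk leqNgt => /negP; apply.
rewrite span_cons ltnNge (geq_leqif (dimv_leqif_sup (addvSr _ _))).
by rewrite subv_add subvv andbT -memvE.
Qed.

Lemma cone_sum F (I : Type) (r : seq I) (c : I -> R) (v : I -> 'M[R]_(p, q)) :
  convex_cone F -> (forall i, 0 <= c i) -> (forall i, F (v i)) ->
  F (\sum_(i <- r) c i *: v i).
Proof.
move=> [F0 FD FZ] c0 Fv; elim: r => [|i r IH]; rewrite ?big_nil ?big_cons //.
by apply: FD => //; apply: FZ.
Qed.

Lemma span_coneB F (s : seq 'M[R]_(p, q)) z : convex_cone F ->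
  {in s, forall z, F z} -> z \in (span s) ->
  exists a b, [/\ F a, F b & z = a - b].
Proof.
move=> cF sF /(@coord_span _ _ _ (in_tuple s)) ->.
pose c i := coord (in_tuple s) i z.
have sF' i : F s`_i.
  have [lti|gei] := ltnP i (size s); first exact/sF/mem_nth.
  by rewrite nth_default //; case: cF.
exists (\sum_i Num.max (c i) 0 *: s`_i), (\sum_i Num.max (- c i) 0 *: s`_i);
  split.
- by apply: cone_sum => // i; rewrite le_max lexx orbT.
- by apply: cone_sum => // i; rewrite le_max lexx orbT.
- rewrite -sumrB; apply: eq_bigr => i _; rewrite -scalerBl -/(c i);
  congr (_ *: _).
  by have [c0|c0] := leP (c i) 0; rewrite /Num.max ?oppr_lt0; case: ifPn; lra.
Qed.

(** With equal dimensions [z] would be a difference a - b of elements of [F1]; then [a] dominates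
    [z], and the face [F1] contains [z]. *)
Lemma dim_face_lt C F1 F2 (s1 s2 : seq 'M[R]_(p, q)) z :
  is_face C F1 -> is_face C F2 -> F1 `<=` F2 -> F2 z -> ~ F1 z ->
  {in s1, forall z, F1 z} -> {in s2, forall z, F2 z} ->
  F2 `<=` [set` (span s2)] -> (\dim (span s1) < \dim (span s2))%N.
Proof.
move=> [cF1 _ fF1] [cF2 F2C _] F12 F2z nF1z s1F s2F F2s.
have s12 : (span s1 <= span s2)%VS by apply/span_subvP => u /s1F/F12/F2s.
rewrite ltnNge (geq_leqif (dimv_leqif_sup s12)); apply/negP => s21.
have /(span_coneB cF1 s1F)[a [b [Fa Fb zab]]] : z \in (span s1).
  by apply: (subvP s21); exact: F2s.
apply: nF1z; apply: (fF1 a) => //; first exact: F2C.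
by rewrite zab opprB addrC subrK; exact/F2C/F12.
Qed.

(* t is the largest value for which x - t z belongs to C. *)
Lemma cone_exit C x z : convex_cone C -> closed C -> pointed_cone C ->
  C x -> C z -> z != 0 ->
  exists2 t : R, 0 <= t & C (x - t *: z) /\ ~ Phi C (x - t *: z) z.
Proof.
move=> cC clC ptC Cx Cz z0; case: (cC) => C0 CD CZ.
have nCz : ~ C (- z).
  move=> CNz; have : (C `&` [set - x | x in C]) z.
    by split=> //; exists (- z); rewrite ?opprK.
  by rewrite ptC /= => zz; rewrite zz eqxx in z0.
pose S := [set t : R | 0 <= t /\ C (x - t *: z)].
have back s t : s <= t -> C (x - t *: z) -> C (x - s *: z).
  move=> st Ct; have -> : x - s *: z = x - t *: z + (t - s) *: z.
    by rewrite scalerBl addrA subrK.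
  by apply: CD => //; apply: CZ => //; rewrite subr_ge0.
have S0 : S 0 by split; rewrite // scale0r subr0.
(* If t were unbounded, then e x - z would belong to [C] for every e > 0, and closedness would put -
   z into [C]. *)
have [B SB] : exists B, ubound S B.
  apply: contrapT => /forallNP nB; apply/nCz/clC => A /(nbhs_line (- x))[e e0].
  rewrite scalerN opprK addrC => Ae; exists (e *: x - z); split=> //.
  have /existsNP[t /not_implyP[[t0 Ct] /negP]] := nB e^-1; rewrite -ltNge => et.
  have -> : e *: x - z = e *: (x - e^-1 *: z).
    by rewrite scalerBr scalerA mulfV ?gt_eqF // scale1r.
  by apply: CZ; [exact: ltW | exact: back (ltW et) Ct].
have supS : has_sup S by split; [exists 0 | exists B].
exists (sup S); first by apply: sup_upper_bound.
have Csup : C (x - sup S *: z).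
  apply: clC => A /(nbhs_line (- z))[e e0 Ae]; exists (x - (sup S - e) *: z).
  split; last by move: Ae; rewrite scalerN opprK scalerBl opprB addrCA addrC
    addrAC.
  by have [t [_ Ct] et] := sup_adherent e0 supS; exact: back (ltW et) Ct.
(* If r (x - sup S z) dominated [z], then sup S + 1/r would still belong to [S]. *)
split=> //; rewrite PhiE // => -[_ [r r0 Cr]].
move: r0; rewrite le_eqVlt => /orP[/eqP r0|r0].
  by apply: nCz; move: Cr; rewrite -r0 scale0r sub0r.
have /(sup_upper_bound supS) : S (sup S + r^-1).
  split; first by rewrite addr_ge0 ?invr_ge0 ?(ltW r0) //;
    apply: sup_upper_bound.
  by have := coneB_scale cC r0 Cr; rewrite scalerDl opprD addrA.
by apply/negP; rewrite -ltNge ltrDl invr_gt0.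
Qed.

(* Minkowski's theorem, by induction on the dimension of Phi C x: if x is not
   extreme, then two applications of cone_exit write x as x'' + t0 y' where x''
   and y' generate smaller faces. *)
Theorem cone_extreme_gen C G : convex_cone C -> closed C -> pointed_cone C ->
  convex_cone G -> extreme_vector C `<=` G -> C `<=` G.
Proof.
move=> cC clC ptC cG exG; have [G0 GD GZ] := cG; have [C0 CD CZ] := cC.
suff claim d x s : C x -> {in s, forall z, Phi C x z} ->
    Phi C x `<=` [set` span s] -> (\dim (span s) < d)%N -> G x.
  move=> x Cx; have [cF _ _] := Phi_face cC Cx.
  by have [s [sF Fs]] := cone_span cF; exact: claim Cx sF Fs (ltnSn _).
elim: d x s => // d IH x s Cx sF Fs; rewrite ltnS => ds.
have [->//|x0] := eqVneq x 0.
have [exx|] := pselect (extreme_vector C x); first exact: exG.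
move/not_and3P; case; [by [] | by case; apply/eqP | move=> nray].
have smaller w z : C w -> Phi C x w -> Phi C x z -> ~ Phi C w z -> G w.
  move=> Cw xw xz nwz; have [cF _ _] := Phi_face cC Cw.
  have [s' [s'F Fs']] := cone_span cF; apply: (IH w s') => //.
  apply: leq_trans ds; apply: (dim_face_lt (Phi_face cC Cw) (Phi_face cC Cx)
    (PhiS xw) xz nwz) => //.
have Phix_C z : Phi C x z -> C z by have [_ + _] := Phi_face cC Cx; apply.
have Phix_sub z t : 0 <= t -> Phi C x z -> C (x - t *: z) -> Phi C x (x - t *:
  z).
  move=> t0 xz Cz; have [_ _ fF] := Phi_face cC Cx.
  by apply: (fF x) => //; rewrite opprB addrC subrK; apply/CZ/Phix_C.
have [y xy ny] : exists2 y, Phi C x y & ~ exists2 a, 0 <= a & y = a *: x.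
  apply: contrapT => nex; apply: nray; apply/seteqP; split=> y /=.
    move=> xy; apply: contrapT => ny; apply: nex; exists y => // -[a a0 ya].
    by apply: ny; exists a.
  move=> [a a0 <-]; have [[_ _ FZ] _ _] := Phi_face cC Cx.
  by apply: FZ => //; exact: Phi_id.
(* Moving [y] along [- x] expels [x] from its face, so [y'] generates a smaller face than [x];
   moving [x] along [- y'] below has the same effect for [x'']. *)
have [s0 s00 [Cy' ny']] := cone_exit cC clC ptC (Phix_C _ xy) Cx x0.
set y' := y - s0 *: x in Cy' ny'.
have xy' : Phi C x y'.
  have [_ _ fF] := Phi_face cC Cx; apply: (fF y) => //.
  by rewrite opprB addrC subrK; exact: CZ.
have y'0 : y' != 0.
  apply/eqP => /subr0_eq yx; apply: ny; by exists s0.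
have [t0 t00 [Cx'' nx'']] := cone_exit cC clC ptC Cx Cy' y'0.
rewrite -(subrK (t0 *: y') x); apply: GD;
  first exact: smaller (Phix_sub _ _ t00 xy' Cx'') xy' nx''.
by apply: GZ => //; apply: smaller Cy' xy' (@Phi_id _ _) ny'.
Qed.

End ConvexCones.

(** * Cones generated by linearly independent vectors *)

Section SimplicialCone.
Variables (R : realType) (p q d : nat) (e : d.-tuple 'M[R]_(p, q)).
Hypothesis free_e : free e.

(** Coordinates are used instead of nonnegative combinations because closedness and the relative
    interior then become conditions on linear forms. *)
Definition scone : set 'M[R]_(p, q) :=
  [set v | v \in span e /\ forall i, 0 <= coord e i v].

Let e_in (i : 'I_d) : e`_i \in span e.
Proof. by apply: memv_span; rewrite mem_nth ?size_tuple. Qed.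

Lemma coordE (i j : 'I_d) : coord e i e`_j = (i == j)%:R.
Proof. by rewrite coord_free // eq_sym. Qed.

Lemma scone_e (i : 'I_d) : scone e`_i.
Proof. by split=> [|j]; rewrite ?e_in // coordE ler0n. Qed.

Lemma scone_convex : convex_cone scone.
Proof.
split.
- by split=> [|i]; rewrite ?mem0v // linear0.
- move=> x y [xe xi] [ye yi]; split=> [|i]; first exact: memvD.
  by rewrite linearD /= addr_ge0 ?xi ?yi.
- move=> a x a0 [xe xi]; split=> [|i]; first exact: memvZ.
  by rewrite linearZ /= mulr_ge0 ?xi.
Qed.

Lemma scone_eq0 v : scone v -> (forall i, coord e i v = 0) -> v = 0.
Proof.
by move=> [/coord_span ve _] v0; rewrite ve big1 // => i _; rewrite v0 scale0r.
Qed.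

Lemma scone_pointed : pointed_cone scone.
Proof.
apply/seteqP; split=> [v [sv [w sw wv]]|v ->]; last first.
  have [s0 _ _] := scone_convex; split=> //; exists 0 => //.
  by rewrite oppr0.
apply: scone_eq0 (sv) _ => i; have [_ vi] := sv; have [_ wi] := sw.
by have := vi i; have := wi i; rewrite -wv linearN /=; lra.
Qed.

Lemma scone_closed : closed scone.
Proof.
(* The forms [coord e i] are defined on the whole space, so membership in the span is the vanishing
   of all entries of the difference between [v] and its expansion. *)
have -> : scone = \bigcap_(i : 'I_d) [set v | 0 <= coord e i v] `&`
    \bigcap_(ij : 'I_p * 'I_q)
      [set v | (v - \sum_i coord e i v *: e`_i) ij.1 ij.2 = 0].
  apply/seteqP; split=> [v [ve vi]|v [vi v0]].
    by split=> [i _|ij _] //=; rewrite -coord_span // subrr mxE.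
  split=> [|i]; last exact: vi.
  have -> : v = \sum_i coord e i v *: e`_i.
    by apply/subr0_eq/matrixP => i j; rewrite (v0 (i, j)) // mxE.
  by apply: memv_suml => i _; exact: memvZ.
apply: closedI; [apply: closed_bigI => i _ | apply: closed_bigI => ij _].
  by apply: (closed_comp _ (@closed_ge R 0)) => v _; exact: continuous_mx_form.
have -> : [set v | (v - \sum_i coord e i v *: e`_i) ij.1 ij.2 = 0] =
    (fun v : 'M[R]_(p, q) => v ij.1 ij.2 -
       \sum_i coord e i v * (e`_i : 'M[R]_(p, q)) ij.1 ij.2) @^-1` [set 0].
  apply/funext => v; rewrite /preimage /= 2!mxE summxE; congr (_ - _ = 0).
  by apply: eq_bigr => i _; rewrite mxE.
apply: (closed_comp _ (@closed_eq R 0)) => v _.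
apply: (@continuousB _ _ _ (fun v : 'M[R]_(p, q) => v ij.1 ij.2)).
  exact: coord_continuous.
apply: continuous_big => [|i _]; first exact: add_continuous.
move=> u; apply: (@continuousM R _ (coord e i : 'M[R]_(p, q) -> R)
  (fun=> (e`_i : 'M[R]_(p, q)) ij.1 ij.2) u).
  exact: continuous_mx_form.
exact: cst_continuous.
Qed.

Lemma scone_span : [set` span e] = lin_span scone.
Proof.
apply/seteqP; split=> v /=; last by apply=> u [].
move=> ve U sU; apply: subvP ve; apply/span_subvP => u /(nthP 0)[i].
by rewrite size_tuple => ltid <-; exact: sU (scone_e (Ordinal ltid)).
Qed.

Lemma scone_dim : has_dim scone d.
Proof.
exists (span e); split; first exact: scone_span.
by move: free_e; rewrite /free size_tuple => /eqP.
Qed.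

Lemma scone_rel_interior :
  rel_interior scone = [set v | v \in span e /\ forall i, 0 < coord e i v].
Proof.
apply/seteqP; split=> v.
  move=> [sv nv]; have [ve vi] := sv; split=> // i.
  rewrite lt_neqAle vi andbT eq_sym; apply/eqP => vi0.
  have [a a0] := nbhs_line e`_i nv; case.
    by rewrite -scone_span /= memvB // memvZ.
  by move=> _ /(_ i); rewrite linearB linearZ /= vi0 coordE eqxx mulr1; lra.
move=> [ve vi]; split; first by split=> // i; exact: ltW.
have nv (i : 'I_d) : \forall y \near v, 0 < coord e i y.
  by apply: near_form_gt; exact: vi.
have : \forall y \near v, forall i : 'I_d, 0 < coord e i y.
  exact: (filter_forall (f := fun i : 'I_d => [set y | 0 < coord e i y])) nv.
apply: filterS => y yi; rewrite -scone_span => ye.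
by split=> // i; exact: ltW.
Qed.

Lemma PhiE_scone (i : 'I_d) :
  Phi scone e`_i = [set a *: e`_i | a in [set a : R | 0 <= a]].
Proof.
rewrite (PhiE scone_convex (scone_e i)); apply/seteqP; split=> v /=.
  move=> [[ve vi] [t t0 [_ tv]]]; exists (coord e i v) => //.
  rewrite [RHS](coord_span ve) (bigD1 i) //= big1 ?addr0 // => j ji.
  have := tv j; rewrite linearB linearZ /= coordE (negPf ji) mulr0.
  have := vi j => H1 H2; have -> : coord e j v = 0 by lra.
  by rewrite scale0r.
move=> [a a0 <-]; have [s0 _ sZ] := scone_convex.
by split; [apply: sZ => //; exact: scone_e | exists a; rewrite ?subrr].
Qed.

Lemma e_neq0 (i : 'I_d) : e`_i <> 0.
Proof.
by move=> /(congr1 (coord e i)); rewrite coordE eqxx linear0 => /eqP;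
  rewrite oner_eq0.
Qed.

(** If the i-th coordinate of an extreme vector is positive, then [e]_i[lies in its face, which is a
    ray and so must be the ray of]e[_i]. *)
Lemma scone_rays :
  extreme_rays scone = (fun i : nat => Phi scone e`_i) @` `I_d.
Proof.
apply/seteqP; split=> F; last first.
  move=> [i ltid <-]; exists e`_i => //; split.
  - exact: scone_e (Ordinal ltid).
  - exact: (e_neq0 (i := Ordinal ltid)).
  - exact: PhiE_scone (Ordinal ltid).
move=> [v [sv v0 vray] <-]; have [ve vi] := sv.
have [i vi0] : exists i, coord e i v != 0.
  apply: contrapT => /forallNP nv; apply/v0/(scone_eq0 sv) => i.
  by apply/eqP/negPn/negP; exact: nv.
exists (i : nat); first exact: ltn_ord.
have vi_gt0 : 0 < coord e i v by rewrite lt_neqAle eq_sym vi0 vi.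
have ev : Phi scone v e`_i.
  rewrite (PhiE scone_convex sv); split; first exact: scone_e.
  exists (coord e i v)^-1; first by rewrite invr_ge0 vi.
  split=> [|j]; first by rewrite memvB // memvZ.
  rewrite linearB linearZ /= coordE; case: eqVneq => [->|_].
    by rewrite mulVf ?subrr.
  by rewrite subr0 mulr_ge0 // invr_ge0.
apply/seteqP; split; apply: PhiS => //.
move: (ev); rewrite vray => -[a a0 eav].
have a1 : a != 0 by apply/eqP => a1; apply: (e_neq0 (i := i));
  rewrite -eav a1 scale0r.
have -> : v = a^-1 *: e`_i by rewrite -eav scalerA mulVf ?scale1r.
by rewrite PhiE_scone; exists a^-1; rewrite /= ?invr_ge0.
Qed.

Lemma scone_card_rays : (extreme_rays scone #= `I_d)%card.
Proof.
rewrite scone_rays; apply: inj_card_eq => i j; rewrite !inE => lti ltj Pij.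
have := @Phi_id _ _ _ scone e`_j; rewrite -Pij (PhiE_scone (Ordinal lti)).
case=> a _ /(congr1 (coord e (Ordinal ltj)));
  rewrite linearZ /= (coordE _ (Ordinal lti)) (coordE _ (Ordinal ltj)) eqxx.
case: eqVneq => [[]//|_]; rewrite mulr0 => /esym/eqP; by rewrite oner_eq0.
Qed.

Lemma scone_in_P : in_P d d scone.
Proof.
split; [split; [split|] | exact: scone_dim | exact: scone_card_rays].
- exact: scone_convex.
- exact: scone_closed.
- exact: scone_pointed.
- exists (\sum_(i < d) e`_i); rewrite scone_rel_interior; split.
    by apply: memv_suml => i _.
  move=> i; rewrite linear_sum /= (bigD1 i) //= coordE eqxx big1 ?addr0 // => j
    ji.
  by rewrite coordE eq_sym (negPf ji).
- by exists d; exact: scone_card_rays.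
Qed.

Lemma sconeP v :
  scone v <-> exists2 c : 'I_d -> R, forall i, 0 <= c i & v = \sum_i c i *:
    e`_i.
Proof.
split=> [[ve vi]|[c c0 ->]].
  by exists (fun i => coord e i v) => //; exact: coord_span.
by apply: cone_sum => // [|i]; [exact: scone_convex | exact: scone_e].
Qed.

Lemma scone_rel_interiorP v : rel_interior scone v <->
  exists2 c : 'I_d -> R, forall i, 0 < c i & v = \sum_i c i *: e`_i.
Proof.
rewrite scone_rel_interior; split=> [[ve vi]|[c c0 ->]].
  by exists (fun i => coord e i v) => //; exact: coord_span.
split=> [|i]; last by rewrite coord_sum_free.
by apply: memv_suml => i _; exact: memvZ.
Qed.

End SimplicialCone.

Local Close Scope classical_set_scope.

(** * Supports in a minimal cone *)

Section MinimalCone.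
Variables (R : realType) (n : nat).

Definition lhs_set : {set 'I_n.+1} := [set i : 'I_n.+1 | lhs_index i.+1].
Definition rhs_set : {set 'I_n.+1} := ~: lhs_set.
Definition rel_sign (i : 'I_n.+1) : R := if lhs_index i.+1 then 1 else -1.

(* X i stands for x_{i+1}; D is a right inverse of the matrix of the X i. *)
Definition minimal_gens (K : set 'cV[R]_n) (X : 'I_n.+1 -> 'cV[R]_n) :=
  [/\ forall y, K y <->
        exists2 c : 'I_n.+1 -> R, forall i, 0 <= c i & y = \sum_i c i *: X i,
      forall c : 'I_n.+1 -> R, \sum_i c i *: X i = 0 <->
        exists l, forall i, c i = l * rel_sign i
    & exists D : 'M[R]_(n.+1, n), forall y, y = \sum_i (D *m y) i 0 *: X i].

Variables (K : set 'cV[R]_n) (X : 'I_n.+1 -> 'cV[R]_n).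
Hypothesis gK : minimal_gens K X.

Local Notation comb c := (\sum_i c i *: X i).
Local Notation hull := (face_hull lhs_set rhs_set).

Lemma K_comb c : (forall i, 0 <= c i) -> K (comb c).
Proof. by case: gK => KE _ _ c0; apply/KE; exists c. Qed.

Lemma combP y : K y -> exists2 c : 'I_n.+1 -> R, forall i, 0 <= c i & y = comb
  c.
Proof. by case: gK => KE _ _ /KE. Qed.

Lemma comb_eq c d : comb c = comb d -> exists l, forall i, c i = d i + l *
  rel_sign i.
Proof.
case: gK => _ rel _ cd; have [|l lE] := (rel (fun i => c i - d i)).1.
  by under eq_bigr do rewrite scalerBl; rewrite sumrB cd subrr.
by exists l => i; rewrite -lE addrC subrK.
Qed.

Lemma comb_shift l c : comb (fun i => c i + l * rel_sign i) = comb c.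
Proof.
case: gK => _ rel _; under eq_bigr do rewrite scalerDl.
rewrite big_split /= [X in _ + X](rel _).2 ?addr0 //; by exists l.
Qed.

Lemma combD c d : comb c + comb d = comb (fun i => c i + d i).
Proof. by rewrite -big_split; apply: eq_bigr => i _; rewrite scalerDl. Qed.

Lemma combZ a c : a *: comb c = comb (fun i => a * c i).
Proof. by rewrite scaler_sumr; apply: eq_bigr => i _; rewrite scalerA. Qed.

Lemma comb1 i : X i = comb (fun j => (j == i)%:R).
Proof.
by rewrite (bigD1 i) //= eqxx scale1r big1 ?addr0 // => j /negPf ->;
  rewrite scale0r.
Qed.

Lemma KX i : K (X i).
Proof. by rewrite comb1; apply: K_comb => j; rewrite ler0n. Qed.

Lemma K_convex : convex_cone K.
Proof.
split=> [|_ _ /combP[c c0 ->] /combP[d d0 ->]|a _ a0 /combP[c c0 ->]].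
- have -> : 0 = comb (fun=> 0) by rewrite big1 // => i _; rewrite scale0r.
  exact: K_comb.
- by rewrite combD; apply: K_comb => i; apply: addr_ge0.
- by rewrite combZ; apply: K_comb => i; apply: mulr_ge0.
Qed.

Definition supp (y : 'cV[R]_n) : {set 'I_n.+1} :=
  [set i | `[< exists2 a : R, 0 < a & K (y - a *: X i) >]].

Lemma suppP y i : reflect (exists2 a : R, 0 < a & K (y - a *: X i)) (i \in supp
  y).
Proof. by rewrite inE; apply: asboolP. Qed.

Lemma sgn_cases i : (i \in lhs_set /\ rel_sign i = 1) \/ (i \in rhs_set /\
  rel_sign i = -1).
Proof. by rewrite /rel_sign !inE; case: ifP; [left|right]. Qed.

Lemma pos_lower_bound (c : 'I_n.+1 -> R) (S : {set 'I_n.+1}) :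
  {in S, forall i, 0 < c i} -> exists2 d, 0 < d & {in S, forall i, d <= c i}.
Proof.
(* The inverse exceeds each [(c i)^-1], and the summand 1 covers an empty [S]. *)
move=> cS; exists (1 + \sum_(i in S) (c i)^-1)^-1.
  by rewrite invr_gt0 ltr_pwDl // sumr_ge0 // => i /cS/ltW; rewrite invr_ge0.
move=> i iS; rewrite -[leRHS]invrK lef_pV2 ?posrE ?invr_gt0 ?cS //; last first.
  by rewrite ltr_pwDl // sumr_ge0 // => j /cS/ltW; rewrite invr_ge0.
rewrite (bigD1 i) //= addrCA lerDl addr_ge0 // sumr_ge0 // => j /andP[/cS/ltW].
by rewrite invr_ge0.
Qed.

(** Two representations of a vector differ by a multiple of the relation. To make a zero coefficient
    positive, the multiple must lower all the coefficients of the opposite side, which have to be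
    positive for that. Conversely, if one side is positive, a small multiple of the relation makes
    all coefficients positive. *)
Lemma supp_comb c : (forall i, 0 <= c i) ->
  supp (comb c) = hull [set i | 0 < c i].
Proof.
move=> c0; apply/setP => i; apply/suppP/idP => [[a a0 /combP[d d0 cd]]|].
  have [|ci] := boolP (0 < c i).
    by move=> ci; apply: (fintype.subsetP (sub_hull _ _ _)); rewrite inE.
  have /comb_eq[l lE] : comb c = comb (fun j => d j + a * (j == i)%:R).
    by rewrite -combD -cd -combZ -comb1 subrK.
  have {}ci : c i = 0 by apply/eqP; rewrite eq_le c0 leNgt ci.
  have := lE i; rewrite eqxx mulr1 ci => li.
  suff PQ : (lhs_set \subset [set i | 0 < c i]) || (rhs_set \subset [set i | 0
    < c i]).
    by rewrite /face_hull PQ inE.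
  have := d0 i => di.
  case: (sgn_cases i) li => -[_ ->] li; [apply/orP; right | apply/orP; left];
    apply/fintype.subsetP => j jS; rewrite inE lE; have := d0 j;
      have : 0 <= a * (j == i)%:R
      by rewrite mulr_ge0 ?ler0n ?ltW.
  - by move: jS; case: (sgn_cases j) => -[+ ->]; rewrite !inE => jl;
    rewrite ?jl //; lra.
  - by move: jS; case: (sgn_cases j) => -[+ ->]; rewrite !inE => jl;
    rewrite ?(negPf jl) //; lra.
have pos (d : 'I_n.+1 -> R) : comb d = comb c -> (forall j, 0 <= d j) -> 0 < d
  i ->
    exists2 a : R, 0 < a & K (comb c - a *: X i).
  move=> <- d0 di; exists (d i) => //; rewrite comb1 combZ -sumrB.
  under eq_bigr do rewrite -scalerBl.
  apply: K_comb => j; case: eqVneq => [->|_]; first by rewrite mulr1 subrr.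
  by rewrite mulr0 subr0.
rewrite /face_hull; case: ifP => [PQ _|_]; last by rewrite inE; exact: pos.
have [ci|ci] := boolP (0 < c i); first exact: pos.
case/orP: PQ => /fintype.subsetP sub.
  have [|d d0 dP] := @pos_lower_bound c lhs_set; first by move=> j /sub;
    rewrite inE.
  apply: (pos (fun j => c j + (- d) * rel_sign j)); first exact: comb_shift.
    move=> j; case: (sgn_cases j) => -[jS ->]; first by have := dP j jS; lra.
    by have := c0 j; lra.
  case: (sgn_cases i) => -[iS ->]; last by have := c0 i; lra.
  by move: (sub _ iS); rewrite inE (negPf ci).
have [|d d0 dP] := @pos_lower_bound c rhs_set; first by move=> j /sub;
  rewrite inE.
apply: (pos (fun j => c j + d * rel_sign j)); first exact: comb_shift.
  move=> j; case: (sgn_cases j) => -[jS ->]; last by have := dP j jS; lra.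
  by have := c0 j; lra.
case: (sgn_cases i) => -[iS ->]; first by have := c0 i; lra.
by move: (sub _ iS); rewrite inE (negPf ci).
Qed.

(** Each index of the support is positive in some representation; averaging, one index at a time,
    gives a representation positive on all of [S]. *)
Lemma supp_sub_comb y (S : {set 'I_n.+1}) : K y -> S \subset supp y ->
  exists2 c : 'I_n.+1 -> R, forall i, 0 <= c i
    & y = comb c /\ {in S, forall i, 0 < c i}.
Proof.
move=> Ky; move: {2}#|S| (leqnn #|S|) => k; elim: k S => [|k IH] S.
  rewrite leqn0 cards_eq0 => /eqP -> _; have [c c0 ->] := combP Ky.
  by exists c => //; split=> // i; rewrite inE.
have [->|[i iS]] := set_0Vmem S.
  by move=> _; apply: IH; rewrite cards0.
rewrite (cardsD1 i) iS => Sk Ssub; have [||c c0 [yc cS]] := IH (S :\ i);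
  first by [].
  by apply: fintype.subset_trans Ssub; exact: finset.subsetDl.
have /suppP[a a0 /combP[d d0 yd]] := fintype.subsetP Ssub i iS.
exists (fun j => 2^-1 * (c j + (d j + a * (j == i)%:R))).
  by move=> j; rewrite mulr_ge0 ?invr_ge0 // !addr_ge0 // mulr_ge0 ?ler0n ?ltW.
split=> [|j jS].
  have yd' : y = comb (fun j => d j + a * (j == i)%:R).
    by rewrite -combD -yd -combZ -comb1 subrK.
  rewrite -combZ -combD -yc -yd' -mulr2n -[y *+ 2]scaler_nat scalerA.
  by rewrite mulVf ?scale1r.
rewrite mulr_gt0 ?invr_gt0 //; case: (eqVneq j i) => [->|ji].
  by rewrite mulr1; have := c0 i; have := d0 i; lra.
by rewrite mulr0 addr0 ltr_pwDl // cS // !inE ji.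
Qed.

Lemma supp_rep y : K y -> exists2 c : 'I_n.+1 -> R, forall i, 0 <= c i
    & y = comb c /\ forall i, (0 < c i) = (i \in supp y).
Proof.
move=> Ky; have [c c0 [yc cS]] := supp_sub_comb Ky (subxx _).
exists c => //; split=> // i; apply/idP/idP => [ci|]; last exact: cS.
by rewrite {1}yc supp_comb //; apply: (fintype.subsetP (sub_hull _ _ _));
  rewrite inE.
Qed.

Lemma hull_supp y : K y -> hull (supp y) = supp y.
Proof. by move=> /combP[c c0 ->]; rewrite supp_comb // hull_id. Qed.

(** With representations that are positive exactly on the supports, the coefficients of [A *m y] are
    sums of nonnegative products, and nothing cancels. *)
Lemma supp_mul A y : cone_pi K A -> K y ->
  supp (A *m y) = face_step lhs_set rhs_set (fun i => supp (A *m X i)) (supp y).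
Proof.
move=> piA Ky; have [c c0 [yc cS]] := supp_rep Ky.
have /choice[M MP] : forall i, exists d : 'I_n.+1 -> R, [/\ forall j, 0 <= d j,
    A *m X i = comb d & forall j, (0 < d j) = (j \in supp (A *m X i))].
  by move=> i; have [d ? [? ?]] := supp_rep (piA _ (KX i)); exists d.
have Ay : A *m y = comb (fun j => \sum_i c i * M i j).
  rewrite yc mulmx_sumr; under eq_bigr => i _.
    rewrite -scalemxAr; have [_ -> _] := MP i; rewrite combZ; over.
  rewrite exchange_big; apply: eq_bigr => j _.
  by rewrite -scaler_suml.
have cM0 i j : 0 <= c i * M i j by have [d0 _ _] := MP i; rewrite mulr_ge0.
rewrite Ay supp_comb => [|j]; last exact: sumr_ge0.
rewrite /face_step; congr (hull _); apply/setP => j; rewrite inE.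
apply/idP/bigcupP => [|[i iy iA]].
  rewrite lt_neqAle sumr_ge0 // andbT eq_sym psumr_neq0 //.
  case/hasP => i _ /= cMij; exists i.
    rewrite -cS lt_neqAle c0 andbT eq_sym; apply/eqP => ci0.
    by rewrite ci0 mul0r ltxx in cMij.
  have [d0 _ <-] := MP i; rewrite lt_neqAle d0 andbT eq_sym; apply/eqP => Mij.
  by rewrite Mij mulr0 ltxx in cMij.
rewrite (bigD1 i) //= ltr_pwDl // ?sumr_ge0 //.
by have [_ _ MS] := MP i; rewrite mulr_gt0 ?MS ?cS.
Qed.

Lemma interior_supp y : (K°)%classic y <-> K y /\ supp y = [set: 'I_n.+1].
Proof.
split=> [Ky|[Ky suppT]].
  split; first exact: nbhs_singleton.
  apply/setP => i; rewrite [RHS]inE; apply/suppP.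
  by have [a a0 Ka] := nbhs_line (X i) Ky; exists a.
have [_ _ [D DE]] := gK; have [c c0 [yc cS]] := supp_rep Ky.
have [l lE] : exists l, forall i, c i = (D *m y) i 0 + l * rel_sign i.
  by apply: comb_eq; rewrite -yc -DE.
have near_i (i : 'I_n.+1) : (\forall z \near y, 0 < (D *m z) i 0 + l * rel_sign
  i)%classic.
  (* The i-th coefficient given by [D], as a linear form: the trace of a 1 by 1 matrix. With [l]
     fixed by [y], the shifted coefficients stay positive near [y]. *)
  pose f : {scalar 'cV[R]_n} := mxtrace \o (row i \o mulmx D).
  have fE z : f z = (D *m z) i 0 by rewrite /f /= /mxtrace big_ord1 mxE.
  have : - (l * rel_sign i) < f y.
    by have := cS i; rewrite suppT inE lE fE; lra.
  move/near_form_gt; apply: filterS => z; rewrite fE; lra.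
have : (\forall z \near y, forall i : 'I_n.+1, 0 < (D *m z) i 0 + l * rel_sign
  i)%classic.
  exact: (filter_forall (f := fun i z => 0 < (D *m z) i 0 + l * rel_sign i))
    near_i.
apply: filterS => z zpos; rewrite [z]DE -(comb_shift l).
by apply: K_comb => i; exact/ltW.
Qed.

Hypothesis n4 : (4 <= n)%N.

Lemma card_lhs_rhs : (1 < #|lhs_set|)%N /\ (1 < #|rhs_set|)%N.
Proof.
have lt2 i : (i <= 4)%N -> (i < n.+1)%N by move=> i4;
  rewrite ltnS (leq_trans i4 n4).
pose o i (Hi : (i <= 4)%N) := Ordinal (lt2 i Hi).
split.
  rewrite (cardsD1 (o 0 isT)) (cardsD1 (o 1 isT)) !inE //=.
rewrite (cardsD1 (o 2 isT)) (cardsD1 (o 4 isT)) !inE //=.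
Qed.

Lemma suppX i : supp (X i) = [set i].
Proof.
have [l2 r2] := card_lhs_rhs.
rewrite {1}comb1 supp_comb => [|j]; last exact: ler0n.
rewrite -(hull1 i l2 r2); congr (hull _); apply/setP => j.
by rewrite !inE ltr0n lt0b.
Qed.

Lemma supp0 : supp 0 = finset.set0.
Proof.
have [l2 r2] := card_lhs_rhs.
have -> : 0 = comb (fun=> 0) by rewrite big1 // => i _; rewrite scale0r.
rewrite supp_comb //; have -> : [set i : 'I_n.+1 | 0 < 0 :> R] = finset.set0.
  by apply/setP => i; rewrite !inE ltxx.
rewrite /face_hull !finset.subset0; case: ifP => // /orP[] /eqP PQ.
  by rewrite PQ cards0 in l2.
by rewrite PQ cards0 in r2.
Qed.

Lemma supp_neq0 y : K y -> y != 0 -> exists i, i \in supp y.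
Proof.
move=> Ky y0; apply: contrapT => /forallNP ns.
have [c c0 [yc cS]] := supp_rep Ky; case/eqP: y0; rewrite yc big1 // => i _.
have /negP := ns i; rewrite -cS -leNgt => ci.
have -> : c i = 0 by apply/eqP; rewrite eq_le ci c0.
by rewrite scale0r.
Qed.

Local Notation stepA A := (face_step lhs_set rhs_set (fun i => supp (A *m X
  i))).

Lemma pi_exp A t : cone_pi K A -> cone_pi K (A ^+ t).
Proof.
move=> piA; elim: t => [|t IH] y Ky; first by rewrite expr0 mul1mx.
by rewrite exprS -mulmxE -mulmxA; apply/piA/IH.
Qed.

Lemma supp_exp A t y : cone_pi K A -> K y ->
  supp (A ^+ t *m y) = iter t (stepA A) (supp y).
Proof.
move=> piA Ky; elim: t => [|t IH]; first by rewrite expr0 mul1mx.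
by rewrite exprS -mulmxE -mulmxA supp_mul // ?IH //; exact: pi_exp.
Qed.

Lemma prim_powerP A t : cone_pi K A -> prim_power K A t <->
  (0 < t)%N /\ forall i, iter t (stepA A) [set i] = [set: 'I_n.+1].
Proof.
move=> piA; split=> -[t0 At]; split=> //.
  move=> i; rewrite -suppX -supp_exp //; last exact: KX.
  have /interior_supp[//] : (K°)%classic (A ^+ t *m X i).
  apply: At; exists (X i) => //; split; first exact: KX.
  by move=> X0; have := suppX i; rewrite X0 supp0 => /setP/(_ i);
    rewrite !inE eqxx.
move=> _ [y [Ky y0] <-]; apply/interior_supp; split; first exact: pi_exp.
have [|i iy] := supp_neq0 Ky; first exact/eqP.
apply/eqP; rewrite supp_exp // -finset.subTset -(At i).
by apply: iter_stepS; rewrite finset.sub1set.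
Qed.

End MinimalCone.

(** * Matrices given by their values on the generators *)

Section CircuitMatrices.
Variables (R : realType) (n : nat) (K : set 'cV[R]_n) (X : 'I_n.+1 -> 'cV[R]_n).
Hypothesis gK : minimal_gens K X.
Hypothesis n4 : (4 <= n)%N.

Local Notation lhs := (lhs_set n).
Local Notation rhs := (rhs_set n).
Local Notation comb c := (\sum_i c i *: X i).
Local Notation sgn := (rel_sign R).
Local Notation supp := (supp K X).

Lemma mul_gens_inj (A B : 'M[R]_n) : (forall i, A *m X i = B *m X i) -> A = B.
Proof.
have [_ _ [D DE]] := gK => AB.
have AB' (y : 'cV[R]_n) : A *m y = B *m y.
  rewrite (DE y) !mulmx_sumr; apply: eq_bigr => i _.
  by rewrite -!scalemxAr AB.
apply/matrixP => i j; have := congr1 (fun M : 'cV_n => M i 0) (AB' (delta_mx j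
  0)).
by rewrite -!colE !mxE.
Qed.

(** The matrix sends the coefficients given by [D] to combinations of the [y i]. On [X i] these
    coefficients are a unit vector plus a multiple of the signs, and the hypothesis kills the
    latter. *)
Lemma mul_gens_ex (y : 'I_n.+1 -> 'cV[R]_n) : \sum_i sgn i *: y i = 0 ->
  exists A : 'M[R]_n, forall i, A *m X i = y i.
Proof.
have [_ rel [D DE]] := gK => sy.
pose Y : 'M[R]_(n, n.+1) := \matrix_(r, c) y c r 0.
have YE (d : 'cV_n.+1) : Y *m d = \sum_i d i 0 *: y i.
  apply/colP => r; rewrite !mxE summxE; apply: eq_bigr => i _.
  by rewrite !mxE mulrC.
exists (Y *m D) => i; rewrite -mulmxA YE.
have [l lE] : exists l, forall j, (D *m X i) j 0 = (j == i)%:R + l * sgn j.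
  by apply: (comb_eq gK); rewrite -DE -comb1.
under eq_bigr do rewrite lE scalerDl -scalerA.
rewrite big_split /= -scaler_sumr sy scaler0 addr0 (bigD1 i) //= eqxx scale1r.
by rewrite big1 ?addr0 // => j /negPf ->; rewrite scale0r.
Qed.

Lemma pi_gens A : (forall i, K (A *m X i)) -> cone_pi K A.
Proof.
move=> KA y /(combP gK)[c c0 ->]; rewrite mulmx_sumr.
under eq_bigr do rewrite -scalemxAr.
exact: (cone_sum _ (K_convex gK)).
Qed.

Lemma pi_convex : convex_cone (cone_pi K).
Proof.
have [K0 KD KZ] := K_convex gK.
split=> [y _|A B piA piB y Ky|a A a0 piA y Ky].
- by rewrite mul0mx.
- by rewrite mulmxDl; apply: KD; [exact: piA | exact: piB].
- by rewrite -scalemxAl; apply: KZ => //; exact: piA.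
Qed.

Lemma suppZ a y : 0 < a -> supp (a *: y) = supp y.
Proof.
have [_ _ KZ] := K_convex gK.
move=> a0; apply/setP => i; apply/suppP/suppP => -[b b0 Kb].
  exists (a^-1 * b); first by rewrite mulr_gt0 ?invr_gt0.
  rewrite -scalerA -[y]scale1r -(mulVf (lt0r_neq0 a0)) -scalerA -scalerBr.
  by apply: KZ => //; rewrite invr_ge0 ltW.
exists (a * b); first exact: mulr_gt0.
by rewrite -scalerA -scalerBr; apply: KZ => //; exact: ltW.
Qed.

Lemma supp_leq y z (t : R) : K z -> 0 <= t -> K (t *: z - y) ->
  supp y \subset supp z.
Proof.
have [_ KD _] := K_convex gK.
move=> Kz t0 Ktzy; apply/fintype.subsetP => i /suppP[a a0 Ka].
have : i \in supp (t *: z).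
  by apply/suppP; exists a => //; rewrite -(subrK y (t *: z)) -addrA; exact: KD.
move: t0; rewrite le_eqVlt => /orP[/eqP <-|t0]; last by rewrite suppZ.
by rewrite scale0r (supp0 gK n4) inE.
Qed.

Lemma supp_subset_rep y (S : {set 'I_n.+1}) : K y -> supp y \subset S ->
  exists2 c : 'I_n.+1 -> R, forall i, 0 <= c i
    & y = \sum_(i in S) c i *: X i /\ forall i, (0 < c i) = (i \in supp y).
Proof.
move=> Ky yS; have [c c0 [yc cS]] := supp_rep gK Ky; exists c => //; split=> //.
rewrite {1}yc (bigID (mem S)) /= [X in _ + X]big1 ?addr0 // => i iS.
have : ~~ (0 < c i) by rewrite cS; apply: contra iS;
  exact: (fintype.subsetP yS).
by rewrite lt_neqAle c0 andbT negbK => /eqP <-; rewrite scale0r.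
Qed.

Lemma supp_subset1 y i : K y -> supp y \subset [set i] ->
  exists2 a, 0 <= a & y = a *: X i /\ (i \in supp y -> 0 < a).
Proof.
move=> Ky /(supp_subset_rep Ky)[c c0 [yc cS]]; exists (c i) => //.
by rewrite cS; split=> //; rewrite yc big_set1.
Qed.

Lemma supp_subset2 y i j : i != j -> K y -> supp y \subset [set i; j] ->
  exists a b, [/\ 0 <= a, 0 <= b, y = a *: X i + b *: X j,
    i \in supp y -> 0 < a & j \in supp y -> 0 < b].
Proof.
move=> ij Ky /(supp_subset_rep Ky)[c c0 [yc cS]]; exists (c i), (c j).
by rewrite !cS; split=> //; rewrite yc big_setU1 ?inE //= big_set1.
Qed.

Variable v : nat -> 'I_n.+1.
Hypothesis injv : forall i j, (1 <= i <= n.+1)%N -> (1 <= j <= n.+1)%N ->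
  v i = v j -> i = j.

Lemma label_ord_inj : injective (fun k : 'I_n.+1 => v k.+1).
Proof.
have I (k : 'I_n.+1) : (1 <= k.+1 <= n.+1)%N by rewrite /= ltn_ord.
by move=> i j /(injv (I i) (I j)) [] /val_inj.
Qed.

Lemma sum_label (V : nmodType) (F : 'I_n.+1 -> V) :
  \sum_i F i = \sum_(1 <= k < n.+2) F (v k).
Proof.
by rewrite big_add1 big_mkord (reindex_inj label_ord_inj).
Qed.

Lemma label_inv : exists u : 'I_n.+1 -> nat,
  [/\ forall i, (1 <= u i <= n.+1)%N, forall i, v (u i) = i
    & forall k, (1 <= k <= n.+1)%N -> u (v k) = k].
Proof.
exists (fun i => (invF label_ord_inj i).+1); split=> [i|i|k kI].
- by rewrite /= ltn_ord.
- exact: (f_invF label_ord_inj).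
- by apply: injv => //; [rewrite /= ltn_ord | exact: (f_invF label_ord_inj)].
Qed.

Lemma label_rel (g : nat -> R) : \sum_(1 <= k < n.+2) g k *: X (v k) = 0 <->
  exists l, forall k, (1 <= k <= n.+1)%N -> g k = l * sgn (v k).
Proof.
have [u [uI vu uv]] := label_inv; have [_ rel _] := gK.
have -> : \sum_(1 <= k < n.+2) g k *: X (v k) = comb (fun i => g (u i)).
  by rewrite sum_label; apply: eq_big_nat => k kI; rewrite uv.
rewrite rel; split=> -[l lE]; exists l.
  by move=> k kI; rewrite -lE uv.
by move=> i; rewrite lE ?uI ?vu.
Qed.

Lemma mul_label_ex (y : nat -> 'cV[R]_n) :
  \sum_(1 <= k < n.+2) sgn (v k) *: y k = 0 ->
  exists A : 'M[R]_n, forall k, (1 <= k <= n.+1)%N -> A *m X (v k) = y k.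
Proof.
have [u [uI vu uv]] := label_inv => sy.
have [|A AE] := mul_gens_ex (y := fun i => y (u i)).
  by rewrite sum_label; apply: etrans sy; apply: eq_big_nat => k kI; rewrite uv.
by exists A => k kI; rewrite AE uv.
Qed.

Lemma mul_label_inj (A B : 'M[R]_n) :
  (forall k, (1 <= k <= n.+1)%N -> A *m X (v k) = B *m X (v k)) -> A = B.
Proof.
have [u [uI vu uv]] := label_inv => AB; apply: mul_gens_inj => i.
by rewrite -(vu i) AB.
Qed.

(** The terms are collected by the arcs that enter [v k]. If [y] lists the images of the generators
    under a matrix and [s] their signs, then the sum vanishes and [label_rel] yields the equations
    for the coefficients. *)
Lemma sum_circuit (y : nat -> 'cV[R]_n) (s a : nat -> R) (b c d : R) :
  (forall k, (1 <= k < n)%N -> y k = a k *: X (v k.+1)) ->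
  y n = a n *: X (v n.+1) + d *: X (v 1) ->
  y n.+1 = b *: X (v 1) + c *: X (v 2) ->
  \sum_(1 <= k < n.+2) s k *: y k =
  \sum_(1 <= k < n.+2) (if k == 1%N then s n.+1 * b + s n * d
     else if k == 2%N then s 1%N * a 1%N + s n.+1 * c
     else s k.-1 * a k.-1) *: X (v k).
Proof.
move=> yE yn yn1; have n1 : (1 <= n)%N by lia.
rewrite [LHS]big_nat_recr //= [X in X + _ = _]big_nat_recr //=.
rewrite [LHS](_ : _ = \sum_(1 <= k < n.+1) (s k * a k) *: X (v k.+1) +
  ((s n.+1 * b + s n * d) *: X (v 1) + (s n.+1 * c) *: X (v 2))); last first.
  rewrite [in RHS]big_nat_recr //= yn yn1 !scalerDr !scalerA scalerDl.
  rewrite (@eq_big_nat _ _ _ _ _ _ (fun k => (s k * a k) *: X (v k.+1))).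
    by rewrite -!addrA; congr (_ + (_ + _)); rewrite addrCA addrA.
  by move=> k kI; rewrite yE // scalerA.
rewrite [in LHS]big_ltn // [RHS]big_ltn // [X in _ = _ + X]big_ltn //=.
rewrite [X in _ = _ + (_ + X)](_ : _ =
  \sum_(2 <= k < n.+1) (s k * a k) *: X (v k.+1)); last first.
  by rewrite big_add1 /=; apply: eq_big_nat => -[|[|k]].
by rewrite (scalerDl (X (v 2))) [LHS]addrC -!addrA [X in _ + X = _]addrCA.
Qed.

End CircuitMatrices.

(** * The matrices A_alpha and A_{alpha, beta} *)

(** The [X (v k)], in the order of their labels, then satisfy the same relation as the original
    generators. *)
Definition labelling (n : nat) (v : nat -> 'I_n.+1) :=
  (forall i j, (1 <= i <= n.+1)%N -> (1 <= j <= n.+1)%N -> v i = v j -> i = j)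
    /\
  forall k, (1 <= k <= n.+1)%N -> lhs_index (v k).+1 = lhs_index k.

Section FaceMatrices.
Variables (R : realType) (n : nat) (K : set 'cV[R]_n) (X : 'I_n.+1 -> 'cV[R]_n).
Hypothesis gK : minimal_gens K X.
Hypothesis n4 : (4 <= n)%N.
Hypothesis even_n : ~~ odd n.

Local Notation lhs := (lhs_set n).
Local Notation rhs := (rhs_set n).
Local Notation comb c := (\sum_i c i *: X i).
Local Notation sgn := (rel_sign R).
Local Notation supp := (supp K X).
Local Notation hull := (face_hull lhs rhs).

Definition lhs_sign (k : nat) : R := if lhs_index k then 1 else -1.

Lemma lhs_sign1 : lhs_sign 1 = 1. Proof. by []. Qed.
Lemma lhs_sign2 : lhs_sign 2 = 1. Proof. by []. Qed.
Lemma lhs_signS k : (2 <= k)%N -> lhs_sign k.+1 = - lhs_sign k.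
Proof.
by case: k => [|[|k]] // _; rewrite /lhs_sign /lhs_index /= negbK; case: odd;
  rewrite ?opprK.
Qed.
Lemma lhs_sign_n : lhs_sign n = 1.
Proof. by rewrite /lhs_sign /lhs_index even_n orbT. Qed.
Lemma lhs_sign_n1 : lhs_sign n.+1 = -1.
Proof. by rewrite lhs_signS ?lhs_sign_n // ltnW // ltnW. Qed.

Lemma sum_lhs_sign : \sum_(1 <= k < n.+2) lhs_sign k = 1.
Proof.
rewrite big_ltn // lhs_sign1 big_add1 /= (_ : \sum_(1 <= k < n.+1) _ = 0)
  ?addr0 //.
have [m ->] : exists m, n = m.*2.
  by exists n./2; have := odd_double_half n; rewrite (negPf even_n).
elim: m => [|m IH]; first by rewrite big_nil.
rewrite doubleS big_nat_recr // big_nat_recr //= IH add0r.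
by rewrite [X in _ + X]lhs_signS // subrr.
Qed.

(* The three parameters c0, c1, c2 are the coordinates in the face
   Phi(A_{alpha, beta}); (c0, c1, c2) = (1, 0, a) gives A_a and (1, a, b)
   gives A_{a, b}, for suitable labellings v. *)
Definition face_mx (v : nat -> 'I_n.+1) (c0 c1 c2 : R) (A : 'M[R]_n) :=
  [/\ A *m X (v 1) = c2 *: X (v 2),
      forall i, (2 <= i < n)%N -> A *m X (v i) = c0 *: X (v i.+1),
      A *m X (v n) = c0 *: X (v n.+1) + c1 *: X (v 1)
    & A *m X (v n.+1) = (c0 + c1) *: X (v 1) + (c0 + c2) *: X (v 2)].

Variable v : nat -> 'I_n.+1.
Hypothesis lv : labelling v.

Lemma sgn_label k : (1 <= k <= n.+1)%N -> sgn (v k) = lhs_sign k.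
Proof. by move=> kI; rewrite /rel_sign /lhs_sign (proj2 lv k kI). Qed.

Lemma face_mx_ex c0 c1 c2 : exists A, face_mx v c0 c1 c2 A.
Proof.
have [injv _] := lv.
pose y k := if k == 1%N then c2 *: X (v 2) else
  if k == n.+1 then (c0 + c1) *: X (v 1) + (c0 + c2) *: X (v 2) else
  if k == n then c0 *: X (v n.+1) + c1 *: X (v 1) else c0 *: X (v k.+1).
pose a k := if k == 1%N then c2 else c0.
have yk k : (1 <= k < n)%N -> y k = a k *: X (v k.+1).
  move=> kI; rewrite /y /a; case: eqP => [->//|_].
  by rewrite !ifF //; apply/eqP; lia.
have yn : y n = a n *: X (v n.+1) + c1 *: X (v 1).
  rewrite /y /a !(@ifF _ (n == 1%N)) ?eqxx; try by apply/eqP; lia.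
  by rewrite ifF //; apply/eqP; lia.
have yn1 : y n.+1 = (c0 + c1) *: X (v 1) + (c0 + c2) *: X (v 2).
  by rewrite /y (@ifF _ (n.+1 == 1%N)) ?eqxx //; apply/eqP; lia.
have [|A AE] := mul_label_ex gK injv (y := y).
  apply: etrans (sum_circuit n4 (fun k => sgn (v k)) yk yn yn1) _.
  apply/(label_rel gK injv).
  (* Moving one step along the circuit reverses the alternating signs, so the image of the relation
     is [- c0] times the relation. *)
  exists (- c0) => k kI; rewrite (sgn_label kI).
  case: eqP => [->|k1].
    by rewrite lhs_sign1 !sgn_label ?lhs_sign_n1 ?lhs_sign_n;
      [ring | lia | lia].
  case: eqP => [->|k2].
    by rewrite lhs_sign2 /a /= !sgn_label ?lhs_sign_n1 ?lhs_sign1;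
      [ring | lia | lia].
  rewrite sgn_label; last lia.
  rewrite /a ifF; last by apply/eqP; lia.
  by rewrite -{2}(prednK (n := k)) ?lhs_signS; [ring | lia | lia].
exists A; split.
- by rewrite AE.
- move=> i iI; rewrite AE; last lia.
  by rewrite yk; [rewrite /a ifF //; apply/eqP; lia | lia].
- by rewrite AE ?yn; [rewrite /a ifF //; apply/eqP; lia | lia].
- by rewrite AE ?yn1 //; lia.
Qed.

Lemma label_cases k : (1 <= k <= n.+1)%N ->
  [\/ k = 1%N, (2 <= k < n)%N, k = n | k = n.+1].
Proof.
move=> kI; have [->|k1] := eqVneq k 1%N; first by constructor 1.
have [->|kn] := eqVneq k n; first by constructor 3.
have [->|kn1] := eqVneq k n.+1; first by constructor 4.
by constructor 2; lia.
Qed.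

Lemma face_mx_inj c0 c1 c2 A B :
  face_mx v c0 c1 c2 A -> face_mx v c0 c1 c2 B -> A = B.
Proof.
have [injv _] := lv; move=> [A1 A2 A3 A4] [B1 B2 B3 B4].
apply: (mul_label_inj gK injv) => k /label_cases[->|kI|->|->].
- by rewrite A1 B1.
- by rewrite A2 ?B2.
- by rewrite A3 B3.
- by rewrite A4 B4.
Qed.

Lemma face_mxD c0 c1 c2 d0 d1 d2 A B :
  face_mx v c0 c1 c2 A -> face_mx v d0 d1 d2 B ->
  face_mx v (c0 + d0) (c1 + d1) (c2 + d2) (A + B).
Proof.
move=> [A1 A2 A3 A4] [B1 B2 B3 B4]; split.
- by rewrite mulmxDl A1 B1 scalerDl.
- by move=> i iI; rewrite mulmxDl A2 ?B2 // scalerDl.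
- by rewrite mulmxDl A3 B3 !scalerDl addrACA.
- by rewrite mulmxDl A4 B4 addrACA -!scalerDl; congr (_ *: _ + _ *: _); ring.
Qed.

Lemma face_mxZ t c0 c1 c2 A :
  face_mx v c0 c1 c2 A -> face_mx v (t * c0) (t * c1) (t * c2) (t *: A).
Proof.
move=> [A1 A2 A3 A4]; split.
- by rewrite -scalemxAl A1 scalerA.
- by move=> i iI; rewrite -scalemxAl A2 // scalerA.
- by rewrite -scalemxAl A3 scalerDr !scalerA.
- by rewrite -scalemxAl A4 scalerDr !scalerA !mulrDr.
Qed.

Lemma face_mx_pi c0 c1 c2 A : 0 <= c0 -> 0 <= c1 -> 0 <= c2 ->
  face_mx v c0 c1 c2 A -> cone_pi K A.
Proof.
have [injv _] := lv; have [u [uI vu _]] := label_inv injv.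
have [_ KD KZ] := K_convex gK; have KXi i := KX gK i.
move=> c00 c10 c20 [A1 A2 A3 A4]; apply: (pi_gens gK) => i.
rewrite -(vu i); case: (label_cases (uI i)) => [->|kI|->|->].
- by rewrite A1; apply: KZ.
- by rewrite A2 //; apply: KZ.
- by rewrite A3; apply: KD; apply: KZ.
- by rewrite A4; apply: KD; apply: KZ => //; rewrite addr_ge0.
Qed.

Lemma lhs_label k : (1 <= k <= n.+1)%N -> (v k \in lhs) = lhs_index k.
Proof. by move=> kI; rewrite inE (proj2 lv k kI). Qed.

Lemma rhs_label k : (1 <= k <= n.+1)%N -> (v k \in rhs) = ~~ lhs_index k.
Proof. by move=> kI; rewrite inE lhs_label. Qed.

Lemma hull_missing (S : {set 'I_n.+1}) p q : p \in lhs -> p \notin S -> q \in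
  rhs -> q \notin S ->
  hull S = S.
Proof.
move=> pl pS qr qS; rewrite /face_hull ifF //;
  apply/negP => /orP[] /fintype.subsetP.
  by move/(_ p pl); apply/negP.
by move/(_ q qr); apply/negP.
Qed.

Lemma label_eq i j : (1 <= i <= n.+1)%N -> (1 <= j <= n.+1)%N ->
  (v i == v j) = (i == j).
Proof.
by move=> iI jI; apply/eqP/eqP => [|->//]; exact: (proj1 lv).
Qed.

Lemma supp1 a i : 0 < a -> supp (a *: X i) = [set i].
Proof. by move=> a0; rewrite (suppZ gK) // (suppX gK). Qed.

Lemma supp2 a b i j : 0 < a -> 0 < b -> i != j ->
  supp (a *: X i + b *: X j) = hull [set i; j].
Proof.
move=> a0 b0 ij.
have -> : a *: X i + b *: X j =
    comb (fun k => a * (k == i)%:R + b * (k == j)%:R).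
  by rewrite -combD -!combZ -!comb1.
rewrite (supp_comb gK) => [|k]; last by rewrite addr_ge0 ?mulr_ge0 ?ler0n ?ltW.
congr (hull _); apply/setP => k; rewrite !inE.
case: (eqVneq k i) => [->|ki]; first by rewrite (negPf ij) mulr0 addr0 mulr1.
by rewrite mulr0 add0r; case: eqP; rewrite ?mulr1 ?mulr0 ?ltxx.
Qed.

Lemma hull_label12 : hull [set v 1; v 2] = [set v 1; v 2].
Proof.
by apply: (@hull_missing _ (v 4) (v 3));
  rewrite ?lhs_label ?rhs_label ?inE ?label_eq //; lia.
Qed.

Lemma hull_labeln1 : hull [set v n.+1; v 1] = [set v n.+1; v 1].
Proof.
by apply: (@hull_missing _ (v 2) (v 3));
  rewrite ?lhs_label ?rhs_label ?inE ?label_eq //; lia.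
Qed.

Lemma supp_face_mx c0 c1 c2 A : 0 < c0 -> 0 <= c1 -> 0 < c2 ->
  face_mx v c0 c1 c2 A ->
  [/\ forall i, (1 <= i < n)%N -> supp (A *m X (v i)) = [set v i.+1],
      supp (A *m X (v n)) =
        if c1 == 0 then [set v n.+1] else [set v n.+1; v 1]
    & supp (A *m X (v n.+1)) = [set v 1; v 2]].
Proof.
move=> c00 c10 c20 [A1 A2 A3 A4]; split.
- case=> [//|[|i]] iI; first by rewrite A1 supp1.
  by rewrite A2 ?supp1.
- rewrite A3; case: eqP => [->|/eqP c1n]; first by rewrite scale0r addr0 supp1.
  have c1p : 0 < c1 by rewrite lt_neqAle eq_sym c1n.
  by rewrite supp2 ?hull_labeln1 // label_eq; lia.
- rewrite A4 supp2 ?hull_label12 //; [lra|lra|].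
  by rewrite label_eq; lia.
Qed.

Lemma face_mx_circuit c0 c1 c2 A : 0 < c0 -> 0 <= c1 -> 0 < c2 ->
  face_mx v c0 c1 c2 A -> labelled_circuit (fun i => supp (A *m X i)) n v.
Proof.
move=> c00 c10 c20 fA; have [S1 Sn Sn1] := supp_face_mx c00 c10 c20 fA.
split=> //; first exact: (proj1 lv).
by rewrite Sn; case: eqP; [left|right].
Qed.

Lemma face_mx_prim c0 c1 c2 A : 0 < c0 -> 0 <= c1 -> 0 < c2 ->
  face_mx v c0 c1 c2 A -> prim_power K A (n ^ 2 - n)%N.
Proof.
move=> c00 c10 c20 fA; have cA := face_mx_circuit c00 c10 c20 fA.
have piA := face_mx_pi (ltW c00) c10 (ltW c20) fA.
apply/(prim_powerP gK n4 _ piA); split; first by nia.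
(* [v 1] and [v 2] are on the left side, so the right side lies among [v 3], ..., [v n.+1]. *)
apply: (labelled_full n4 _ _ cA (S := rhs)).
- by rewrite card_ord.
- by move=> i; apply: (hull_supp gK); apply/piA/(KX gK).
- by right.
- move=> x xr; have [j jI xj] := labelled_surj n4 (card_ord _) cA x.
  exists j => //; move: xr; rewrite xj rhs_label // /lhs_index; lia.
Qed.

End FaceMatrices.

Definition id_label (n i : nat) : 'I_n.+1 := inord i.-1.

Lemma id_labelE n k : (1 <= k <= n.+1)%N -> (id_label n k).+1 = k.
Proof. by case: k => // k kI; rewrite inordK. Qed.

Lemma id_labelling n : labelling (id_label n).
Proof.
split=> [i j iI jI|k kI]; last by rewrite id_labelE.
by move=> /(congr1 (fun k : 'I_n.+1 => k.+1)); rewrite !id_labelE.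
Qed.

(** * Signs and coefficients of a slow primitive matrix *)

Section Classification.
Variables (R : realType) (n : nat) (K : set 'cV[R]_n) (X : 'I_n.+1 -> 'cV[R]_n).
Hypothesis gK : minimal_gens K X.
Hypothesis n4 : (4 <= n)%N.
Hypothesis even_n : ~~ odd n.

Local Notation lhs := (lhs_set n).
Local Notation rhs := (rhs_set n).
Local Notation sgn := (rel_sign R).
Local Notation pat := (lhs_sign R).
Local Notation supp := (supp K X).

Lemma sum_sgn : \sum_(i : 'I_n.+1) sgn i = 1.
Proof.
rewrite (sum_label (proj1 (id_labelling n))) -(sum_lhs_sign R even_n).
by apply: eq_big_nat => k kI; rewrite (sgn_label R (id_labelling n)).
Qed.

Lemma sgn_pm (i : 'I_n.+1) : sgn i = 1 \/ sgn i = -1.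
Proof. by rewrite /rel_sign; case: ifP; [left|right]. Qed.

(** If l >= 0, all signs agree and cannot sum to 1. So l < 0, and since signs have absolute value 1
    they alternate from label 2 on with equal coefficients. These n signs cancel because n is even,
    whence [s 1 = 1]; the sign at label 2 remains free. *)
Lemma circuit_signs (s a : nat -> R) (b c d l : R) :
  (forall k, (1 <= k <= n)%N -> 0 < a k) -> 0 < b -> 0 <= d ->
  (forall k, s k = 1 \/ s k = -1) -> \sum_(1 <= k < n.+2) s k = 1 ->
  s n.+1 * b + s n * d = l * s 1%N -> s 1%N * a 1%N + s n.+1 * c = l * s 2%N ->
  (forall k, (2 <= k <= n)%N -> s k * a k = l * s k.+1) ->
  [/\ s 1%N = 1, l < 0, forall k, (2 <= k <= n)%N -> a k = - l
    & (forall k, (1 <= k <= n.+1)%N -> s k = pat k) \/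
      (forall k, (2 <= k <= n.+1)%N -> s k = - pat k)].
Proof.
move=> a'0 b0 d0 spm sums e1 e2 ek.
have l_lt0 : l < 0.
  rewrite ltNge; apply/negP => l0.
  have sS k : (2 <= k <= n)%N -> s k.+1 = s k.
    move=> kI; have H1 := ek k kI; have H2 : 0 < a k by apply: a'0; lia.
    by case: (spm k) (spm k.+1) => Hk [] Hk1; rewrite Hk Hk1 in H1 *; lra.
  have s2E k : (2 <= k <= n.+1)%N -> s k = s 2.
    elim: k => // k IH kI; case: (ltnP 1 k) => k2;
      last by have -> : k = 1%N by lia.
    by rewrite sS ?IH //; lia.
  have s1E : s 1%N = s 2.
    move: e1; rewrite (s2E n) ?(s2E n.+1); [|lia|lia].
    by case: (spm 1%N) (spm 2) => -> [] ->; lra.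
  have : \sum_(1 <= k < n.+2) s k = \sum_(1 <= k < n.+2) s 2.
    apply: eq_big_nat => k kI; case: (ltnP 1 k) => k2;
      first by rewrite s2E //; lia.
    by have -> : k = 1%N by lia.
  rewrite sums sumr_const_nat subn1 /=.
  have n4R : 4 <= n%:R :> R by rewrite (ler_nat R 4 n).
  by case: (spm 2) => ->; rewrite ?mulNrn -natr1; lra.
have sS k : (2 <= k <= n)%N -> s k.+1 = - s k /\ a k = - l.
  move=> kI; have H1 := ek k kI; have H2 : 0 < a k by apply: a'0; lia.
  by case: (spm k) (spm k.+1) => Hk [] Hk1; rewrite Hk Hk1 in H1 *; lra.
have sE k : (2 <= k <= n.+1)%N -> s k = s 2 * pat k.
  elim: k => // k IH kI; case: (ltnP 1 k) => k2; last first.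
    have -> : k = 1%N by lia.
    by rewrite lhs_sign2 mulr1.
  by rewrite (proj1 (sS k _)) ?IH ?lhs_signS ?mulrN //; lia.
have s1 : s 1%N = 1.
  have := sum_lhs_sign R even_n; rewrite big_ltn // lhs_sign1 => sp.
  move: sums; rewrite big_ltn // (@eq_big_nat _ _ _ _ _ s (fun k => s 2 * pat
    k)).
    by rewrite -mulr_sumr; move: sp => /(canRL (addKr _)) ->;
      rewrite addNr mulr0 addr0.
  by move=> k kI; apply: sE; lia.
split=> //; first by move=> k /sS[].
case: (spm 2%N) => s2; [left|right] => k kI; last by rewrite sE // s2 mulN1r.
case: (ltnP 1 k) => k2; first by rewrite sE ?s2 ?mul1r //; lia.
by have -> : k = 1%N by lia.
Qed.

Lemma primitive_classification B : primitive K B ->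
  prim_power K B (n ^ 2 - n - 1)%N \/
  exists v c0 c1 c2, [/\ labelling v, 0 < c0, 0 <= c1, 0 < c2
    & face_mx X v c0 c1 c2 B].
Proof.
move=> [piB [p /(prim_powerP gK n4 _ piB)[_ primB]]].
set st := face_step lhs rhs (fun i => supp (B *m X i)) in primB.
have [/forallP full|] := boolP [forall i, iter (n ^ 2 - n - 1) st [set i] ==
  [set: 'I_n.+1]].
  left; apply/(prim_powerP gK n4 _ piB); split; first by nia.
  by move=> i; exact/eqP.
rewrite negb_forall => /existsP[i0 bad0]; right.
have [l2 r2] := card_lhs_rhs n4.
have dlr : [disjoint lhs & rhs] by rewrite -finset.setI_eq0 finset.setICr.
have KB i : K (B *m X i) by apply/piB/(KX gK).
have hullB i : face_hull lhs rhs (supp (B *m X i)) = supp (B *m X i).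
  exact: (hull_supp gK).
have [v cv] := slow_digraph hullB n4 (card_ord _) dlr l2 r2 (ex_intro _ p
  primB) bad0.
have [injv Ei En En1] := cv.
have veq i j : (1 <= i <= n.+1)%N -> (1 <= j <= n.+1)%N -> i != j -> v i != v j.
  by move=> iI jI; apply: contraNneq => /injv ->.
have /choice[a aP] : forall k, exists a, (1 <= k < n)%N ->
    0 < a /\ B *m X (v k) = a *: X (v k.+1).
  move=> k; have [kI|_] := boolP (1 <= k < n)%N; last by exists 0.
  have [|a a0 [Ba ap]] := supp_subset1 gK (KB (v k)) (i := v k.+1).
    by rewrite Ei.
  by exists a => _; split=> //; apply: ap; rewrite Ei ?inE.
have [an [d [an0 d0 Bn]]] : exists an d, [/\ 0 < an, 0 <= d
    & B *m X (v n) = an *: X (v n.+1) + d *: X (v 1)].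
  case: En => En.
    have [|an a0 [Ba ap]] := supp_subset1 gK (KB (v n)) (i := v n.+1).
      by rewrite En.
    exists an, 0; rewrite scale0r addr0; split=> //.
    by apply: ap; rewrite En set11.
  have [||an [d [_ d0 Ba ap _]]] := @supp_subset2 _ _ _ _ gK _ (v n.+1) (v 1%N)
    _ (KB (v n)).
  - by apply: veq; lia.
  - by rewrite En.
  by exists an, d; split=> //; apply: ap; rewrite En set21.
have [b [c [b0 c0 Bn1]]] : exists b c, [/\ 0 < b, 0 < c
    & B *m X (v n.+1) = b *: X (v 1) + c *: X (v 2)].
  have [||b [c [_ _ Ba bp cp]]] := @supp_subset2 _ _ _ _ gK _ (v 1%N) (v 2) _
    (KB (v n.+1)).
  - by apply: veq; lia.
  - by rewrite En1.
  by exists b, c; split=> //; [apply: bp | apply: cp];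
    rewrite En1 ?set21 ?set22.
pose a' (k : nat) : R := if k == n then an else a k.
have a'0 k : (1 <= k <= n)%N -> 0 < a' k.
  move=> kI; rewrite /a'; case: eqP => // kn.
  by have [|//] := aP k; lia.
pose s k := sgn (v k).
have Bk k : (1 <= k < n)%N -> B *m X (v k) = a' k *: X (v k.+1).
  move=> kI; rewrite /a' ifF; last by apply/eqP; lia.
  by have [_ ->] := aP k kI.
have Bn' : B *m X (v n) = a' n *: X (v n.+1) + d *: X (v 1).
  by rewrite /a' eqxx.
have := @sum_circuit R n X n4 v (fun k => B *m X (v k)) s a' b c d Bk Bn' Bn1.
have -> : \sum_(1 <= k < n.+2) s k *: (B *m X (v k)) = 0.
  under eq_bigr do rewrite scalemxAr.
  rewrite -(sum_label injv (fun i => B *m (sgn i *: X i))) -mulmx_sumr.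
  have [_ rel _] := gK; rewrite (rel _).2 ?mulmx0 //.
  by exists 1 => i; rewrite mul1r.
move/esym/(label_rel gK injv) => -[l lE].
have e1 : s n.+1 * b + s n * d = l * s 1%N by have := lE 1%N isT.
have e2 : s 1%N * a' 1%N + s n.+1 * c = l * s 2 by apply: (lE 2%N); lia.
have ek k : (2 <= k <= n)%N -> s k * a' k = l * s k.+1.
  by move=> kI; have := lE k.+1; rewrite !ifF; [apply; lia | apply/eqP; lia..].
have spm k : s k = 1 \/ s k = -1 by exact: sgn_pm.
have sums : \sum_(1 <= k < n.+2) s k = 1 by rewrite -sum_sgn (sum_label injv).
clear lE.
have [s1 l_lt0 aE [sp|sn]] := circuit_signs a'0 b0 d0 spm sums e1 e2 ek.
  (* The common coefficient of the arcs from [v 2] to [v n.+1], that of the chord [v n -> v 1] and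
     that of the arc [v 1 -> v 2]; [e1] and [e2] determine the image of [X (v n.+1)]. *)
  exists v, (- l), d, (a' 1%N); split=> //.
  - split=> // k kI; have := sp k kI; rewrite /s /rel_sign /lhs_sign.
    by case: ifP; case: ifP => // _ _; lra.
  - by lra.
  - by apply: a'0; lia.
  - have spn := sp n; have spn1 := sp n.+1.
    rewrite (lhs_sign_n R even_n) in spn;
      rewrite (lhs_sign_n1 R n4 even_n) in spn1.
    split.
    + by rewrite Bk //; lia.
    + by move=> i iI; rewrite Bk ?aE //; lia.
    + by rewrite Bn' aE //; lia.
    + rewrite Bn1; have s2 := sp 2%N; move: e1 e2;
      rewrite s1 s2 ?spn ?spn1 ?lhs_sign2; try lia.
      by move=> e1 e2; congr (_ *: _ + _ *: _); lra.
(* In the opposite pattern [v n.+1] has sign 1, as [v 1] does, so the right side lies among [v 2],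
   ..., [v n]. *)
case/eqP: bad0; apply: (labelled_fast n4 (card_ord _) hullB cv (S := rhs)).
  by right.
move=> x xr; have [j jI xj] := labelled_surj n4 (card_ord _) cv x.
exists j => //; have sj : s j = -1.
  by move: xr; rewrite xj !inE /s /rel_sign => /negPf ->.
have j1 : j != 1%N by apply/eqP => j1; move: sj; rewrite j1 s1; lra.
have jn : j != n.+1.
  apply/eqP => jn; move: sj; rewrite jn sn ?(lhs_sign_n1 R n4 even_n);
    [lra | lia].
lia.
Qed.

End Classification.

(** * The exponent of the cone *)

Section Exponents.
Variables (R : realType) (n : nat) (K : set 'cV[R]_n) (X : 'I_n.+1 -> 'cV[R]_n).
Hypothesis gK : minimal_gens K X.
Hypothesis n4 : (4 <= n)%N.
Hypothesis even_n : ~~ odd n.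

Local Notation comb c := (\sum_i c i *: X i).
Local Notation supp := (supp K X).

(** In contrast to a condition on [supp], this speaks of one representation, before any hull is
    taken, so that [W] can be followed along walks. *)
Definition gen_on (W : 'I_n.+1 -> Prop) (y : 'cV[R]_n) :=
  exists2 c : 'I_n.+1 -> R, forall i, 0 <= c i
    & y = comb c /\ forall i, 0 < c i -> W i.

Lemma gen_on0 W : gen_on W 0.
Proof.
exists (fun=> 0) => //; split=> [|i]; last by rewrite ltxx.
by rewrite big1 // => i _; rewrite scale0r.
Qed.

Lemma gen_onX W i : W i -> gen_on W (X i).
Proof.
move=> Wi; exists (fun j => (j == i)%:R) => [j|]; first exact: ler0n.
by split=> [|j]; [exact: comb1 | case: eqP => [->//|_]; rewrite ltxx].
Qed.

Lemma gen_onZ W a y : 0 <= a -> gen_on W y -> gen_on W (a *: y).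
Proof.
move=> a0 [c c0 [-> cW]]; exists (fun i => a * c i) => [i|];
  first exact: mulr_ge0.
split=> [|i]; first exact: combZ.
move=> aci; apply: cW; rewrite lt_neqAle c0 andbT eq_sym; apply/eqP => ci0.
by rewrite ci0 mulr0 ltxx in aci.
Qed.

Lemma gen_onD W y z : gen_on W y -> gen_on W z -> gen_on W (y + z).
Proof.
move=> [c c0 [-> cW]] [d d0 [-> dW]]; exists (fun i => c i + d i) => [i|].
  exact: addr_ge0.
split=> [|i cd]; first exact: combD.
have [/cW//|ci] := boolP (0 < c i); apply: dW.
have ci0 : c i = 0 by apply/eqP; rewrite eq_le c0 leNgt ci.
by rewrite ci0 add0r in cd.
Qed.

Lemma gen_on_mul (W W' : 'I_n.+1 -> Prop) A y : gen_on W y ->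
  (forall i, W i -> gen_on W' (A *m X i)) -> gen_on W' (A *m y).
Proof.
move=> [c c0 [-> cW]] AW; rewrite mulmx_sumr.
apply: (big_ind (gen_on W')) => [||i _]; [exact: gen_on0 | exact: gen_onD|].
rewrite -scalemxAr; have [ci|ci] := boolP (0 < c i).
  by apply: gen_onZ => //; apply/AW/cW.
have -> : c i = 0 by apply/eqP; rewrite eq_le c0 leNgt ci.
by rewrite scale0r; exact: gen_on0.
Qed.

Lemma prim_power_leq A p p' : cone_pi K A -> (p <= p')%N ->
  prim_power K A p -> prim_power K A p'.
Proof.
move=> piA pp' /(prim_powerP gK n4 _ piA)[p0 Ap].
apply/(prim_powerP gK n4 _ piA); split=> [|i]; first exact: leq_trans pp'.
have [l2 r2] := card_lhs_rhs n4.
have dlr : [disjoint lhs_set n & rhs_set n] by rewrite -finset.setI_eq0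
  finset.setICr.
exact: (full_leq n4 (card_ord _) dlr l2 r2 (ex_intro _ p Ap) pp' (Ap i)).
Qed.

Lemma primitive_prim_power B : primitive K B -> prim_power K B (n ^ 2 - n)%N.
Proof.
move=> primB; have [piB _] := primB.
have [|[v [c0 [c1 [c2 [lv c0_gt0 c1_ge0 c2_gt0 fB]]]]]] :=
  primitive_classification gK n4 even_n primB.
  by apply: prim_power_leq => //; exact: leq_subr.
exact: (face_mx_prim gK n4 even_n lv _ _ _ fB).
Qed.

Section Slow.
Variables (v : nat -> 'I_n.+1) (c0 c2 : R) (A : 'M[R]_n).
Hypothesis lv : labelling v.
Hypothesis c0_gt0 : 0 < c0.
Hypothesis c2_gt0 : 0 < c2.
Hypothesis fA : face_mx X v c0 0 c2 A.

(* A walk of t steps from v 2 to v j consists of the path from v 2 to v j and of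
   circuits of length n and n + 1.  The vertex v 1 lies on the long circuit
     only,
   whence 0 < b when j = 1. *)
Definition reached (t : nat) (i : 'I_n.+1) : Prop :=
  exists j a b, [/\ (1 <= j <= n.+1)%N, i = v j,
    (t + 2 = j + a * n + b * n.+1)%N & j = 1%N -> (0 < b)%N].

Lemma reached_exp t : gen_on (reached t) (A ^+ t *m X (v 2)).
Proof.
have [A1 A2 A3 A4] := fA; elim: t => [|t IH].
  rewrite expr0 mul1mx; apply: gen_onX; exists 2%N, 0%N, 0%N; split=> //; lia.
rewrite exprS -mulmxE -mulmxA; apply: gen_on_mul IH _ => i.
move=> [j [a [b [jI -> tj jb]]]].
have [j1|j2n|jn|jn1] := label_cases n4 even_n jI.
- rewrite j1 A1; apply: gen_onZ; first exact: ltW.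
  by apply: gen_onX; exists 2%N, a, b; split=> //; lia.
- rewrite A2 //; apply: gen_onZ; first exact: ltW.
  by apply: gen_onX; exists j.+1, a, b; split=> //; lia.
- rewrite jn A3 scale0r addr0; apply: gen_onZ; first exact: ltW.
  by apply: gen_onX; exists n.+1, a, b; split=> //; lia.
- rewrite jn1 A4 addr0; apply: gen_onD; apply: gen_onZ.
  + exact: ltW.
  + by apply: gen_onX; exists 1%N, a, b.+1; split=> //; lia.
  + by rewrite addr_ge0 // ltW.
  + by apply: gen_onX; exists 2%N, a.+1, b; split=> //; lia.
Qed.

(** The length equation writes n^2 - n as a multiple of n plus b + 1, impossible if b < n - 1; for
    larger b the circuits of length n + 1 alone are too long. *)
Lemma not_reached j : j = 1%N \/ j = n.+1 -> ~ reached (n ^ 2 - n - 2) (v j).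
Proof.
move=> jE [k [a [b [kI /(proj1 lv) jk tk kb]]]].
have {jk}jk : j = k by apply: jk => //; case: jE => ->; lia.
have rem q r : (0 < r < n)%N -> (n ^ 2 - n)%N <> (q * n + r)%N.
  by move=> rI; case: (ltnP q n.-1) => qn; nia.
have large : (n.-1 <= b)%N -> (n ^ 2 - n < b * n.+1)%N by nia.
have [bn|bn] := ltnP b n.-1; last first.
  by have := large bn; move: tk; rewrite subnK; nia.
case: jE => jE.
  have b0 := kb (etrans (esym jk) jE).
  by apply: (@rem (a + b)%N b.+1); [lia | nia].
by apply: (@rem (a + b).+1 b.+1); [lia | nia].
Qed.

(** [X (v 1)] spends one step to reach the ray of [X (v 2)]. The remaining steps miss [v 1] on the
    left side and [v n.+1] on the right, so the hull adds nothing. *)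
Lemma slow_face_mx : ~ prim_power K A (n ^ 2 - n - 1)%N.
Proof.
have piA := face_mx_pi gK n4 even_n lv (ltW c0_gt0) (lexx 0) (ltW c2_gt0) fA.
move=> [_ Ap].
have /(interior_supp gK)[_ sT] : (K°)%classic (A ^+ (n ^ 2 - n - 1) *m X (v 1)).
  apply: Ap; exists (X (v 1)) => //; split; first exact: (KX gK).
  move=> X0; have := suppX gK n4 (v 1).
  by rewrite X0 (supp0 gK n4) => /setP/(_ (v 1)); rewrite !inE eqxx.
move: sT; have -> : (n ^ 2 - n - 1 = (n ^ 2 - n - 2).+1)%N by nia.
have [A1 _ _ _] := fA.
rewrite exprSr -mulmxE -mulmxA A1 -scalemxAr (suppZ gK) //.
have [c c_ge0 [-> cW]] := reached_exp (n ^ 2 - n - 2).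
rewrite (supp_comb gK) // (@hull_missing _ _ (v 1) (v n.+1)).
- move=> /setP/(_ (v 1)); rewrite !inE => /cW; apply: not_reached; by left.
- by rewrite (lhs_label lv).
- by rewrite inE; apply/negP => /cW; apply: not_reached; left.
- by rewrite (rhs_label lv) ?leqnn // /lhs_index /= negb_or negbK; lia.
- by rewrite inE; apply/negP => /cW; apply: not_reached; right.
Qed.

Lemma exponent_face_mx : primitive K A /\ exponent K A (n ^ 2 - n)%N.
Proof.
have piA := face_mx_pi gK n4 even_n lv (ltW c0_gt0) (lexx 0) (ltW c2_gt0) fA.
have Ap := face_mx_prim gK n4 even_n lv c0_gt0 (lexx 0) c2_gt0 fA.
split; first by split=> //; exists (n ^ 2 - n)%N.
split=> // p pp; rewrite leqNgt; apply/negP => ltp; apply: slow_face_mx.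
by apply: prim_power_leq pp => //; lia.
Qed.

End Slow.

Lemma cone_exponent_minimal : cone_exponent K (n ^ 2 - n)%N.
Proof.
have [A fA] := face_mx_ex gK n4 even_n (id_labelling n) 1 0 1.
have [pA eA] := exponent_face_mx (id_labelling n) ltr01 ltr01 fA.
split; first by exists A.
by move=> h [B [pB [_ minh]]]; apply: minh; exact: primitive_prim_power.
Qed.

Lemma exp_maximal_face_mx v c0 c2 A : labelling v -> 0 < c0 -> 0 < c2 ->
  face_mx X v c0 0 c2 A -> exp_maximal_mx K A.
Proof.
move=> lv c00 c20 fA; have [pA eA] := exponent_face_mx lv c00 c20 fA.
split=> //; exists (n ^ 2 - n)%N; split=> //; exact: cone_exponent_minimal.
Qed.

Lemma exp_maximal_classification B : exp_maximal_mx K B ->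
  exists v c0 c1 c2, [/\ labelling v, 0 < c0, 0 <= c1, 0 < c2
    & face_mx X v c0 c1 c2 B].
Proof.
move=> [pB [g [[_ ming] [gS gmax]]]].
have [cS cmax] := cone_exponent_minimal.
have gE : g = (n ^ 2 - n)%N by apply/eqP; rewrite eqn_leq cmax ?gmax.
have [/ming|//] := primitive_classification gK n4 even_n pB.
by rewrite gE; nia.
Qed.

End Exponents.

(** * Faces of pi(K) and cone-equivalence *)

Section Faces.
Variables (R : realType) (n : nat) (K : set 'cV[R]_n) (X : 'I_n.+1 -> 'cV[R]_n).
Hypothesis gK : minimal_gens K X.
Hypothesis n4 : (4 <= n)%N.
Hypothesis even_n : ~~ odd n.

Local Notation sgn := (rel_sign R).
Local Notation pat := (lhs_sign R).
Local Notation supp := (supp K X).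

Lemma gen_neq0 i : X i != 0.
Proof.
apply/eqP => X0; have := suppX gK n4 i.
by rewrite X0 (supp0 gK n4) => /setP/(_ i); rewrite !inE eqxx.
Qed.

Lemma gen_scaleI a b i : a *: X i = b *: X i -> a = b.
Proof.
move=> /eqP; rewrite -subr_eq0 -scalerBl scaler_eq0 (negPf (gen_neq0 i)) orbF.
by rewrite subr_eq0 => /eqP.
Qed.

(** The counterpart of [circuit_signs] for known signs; the coefficients may vanish, as they do on
    the boundary of a face. *)
Lemma alternating_coefs (a : nat -> R) (b c d l : R) :
  (forall k, (1 <= k <= n.+1)%N ->
    (if k == 1%N then pat n.+1 * b + pat n * d
     else if k == 2%N then pat 1%N * a 1%N + pat n.+1 * c
     else pat k.-1 * a k.-1) = l * pat k) ->
  [/\ b = - l + d, c = - l + a 1%N & forall k, (2 <= k <= n)%N -> a k = - l].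
Proof.
have n2 : (1 <= 2 <= n.+1)%N by lia.
move=> lE; split=> [||k kI].
- by have := lE 1%N isT; rewrite /= lhs_sign1 (lhs_sign_n R even_n)
  (lhs_sign_n1 R n4 even_n); lra.
- by have := lE 2%N n2; rewrite /= lhs_sign1 lhs_sign2 (lhs_sign_n1 R n4
  even_n); lra.
- have kI' : (1 <= k.+1 <= n.+1)%N by lia.
  have := lE k.+1 kI'; rewrite !ifF; try by apply/eqP; lia.
  by rewrite lhs_signS /= ?/lhs_sign; [case: ifP => _; lra | lia].
Qed.

Section Labelled.
Variable v : nat -> 'I_n.+1.
Hypothesis lv : labelling v.

Lemma face_mxB c0 c1 c2 d0 d1 d2 A B :
  face_mx X v c0 c1 c2 A -> face_mx X v d0 d1 d2 B ->
  face_mx X v (c0 - d0) (c1 - d1) (c2 - d2) (A - B).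
Proof.
move=> fA /(face_mxZ (-1)); rewrite scaleN1r !mulN1r => fB.
exact: face_mxD fA fB.
Qed.

Lemma face_mx_coef c0 c1 c2 d0 d1 d2 A :
  face_mx X v c0 c1 c2 A -> face_mx X v d0 d1 d2 A ->
  [/\ c0 = d0, c1 = d1 & c2 = d2].
Proof.
move=> [A1 A2 A3 _] [B1 B2 B3 _].
have E0 : c0 = d0 by apply: (@gen_scaleI _ _ (v 3)); rewrite -A2 ?B2 //; lia.
split=> //; last by apply: (@gen_scaleI _ _ (v 2)); rewrite -A1 B1.
by apply: (@gen_scaleI _ _ (v 1)); apply: (addrI (c0 *: X (v n.+1)));
  rewrite -A3 B3 E0.
Qed.

(** A matrix dominated by a multiple of [A] has its supports inside those of [A]. It therefore has
    the same circuit shape, and its value on the relation leaves three free parameters. *)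
Lemma face_mx_Phi c0 c1 c2 A B : 0 < c0 -> 0 <= c1 -> 0 < c2 ->
  face_mx X v c0 c1 c2 A ->
  Phi (cone_pi K) A B <-> exists d0 d1 d2,
    [/\ 0 <= d0, 0 <= d1, 0 <= d2, c1 = 0 -> d1 = 0 & face_mx X v d0 d1 d2 B].
Proof.
move=> c00 c10 c20 fA.
have piA : cone_pi K A by exact: (face_mx_pi gK n4 even_n lv (ltW c00) c10 (ltW
  c20)) fA.
rewrite (PhiE (pi_convex gK) piA); split; last first.
  move=> [d0 [d1 [d2 [d00 d10 d20 c1d1 fB]]]].
  split; first exact: face_mx_pi fB.
  have [u0 u00 e0] : exists2 u, 0 <= u & d0 = u * c0.
    by exists (d0 / c0); rewrite ?divr_ge0 ?mulfVK ?gt_eqF // ltW.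
  have [u1 u10 e1] : exists2 u, 0 <= u & d1 = u * c1.
    (* If [c1 = 0], this quotient is 0 by convention, in agreement with [d1 = 0]. *)
    exists (d1 / c1); first by rewrite divr_ge0.
    by have [c1E|c1n] := eqVneq c1 0; [rewrite c1E mulr0 c1d1 | rewrite mulfVK].
  have [u2 u20 e2] : exists2 u, 0 <= u & d2 = u * c2.
    by exists (d2 / c2); rewrite ?divr_ge0 ?mulfVK ?gt_eqF // ltW.
  (* The sum bounds each of the three ratios between the parameters of [B] and [A]. *)
  exists (u0 + u1 + u2); first by rewrite !addr_ge0.
  have := face_mxB (face_mxZ (u0 + u1 + u2) fA) fB.
  apply: (face_mx_pi gK n4 even_n lv).
  - by rewrite e0 -mulrBl; apply: mulr_ge0; [lra | exact: ltW].
  - by rewrite e1 -mulrBl; apply: mulr_ge0 => //; lra.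
  - by rewrite e2 -mulrBl; apply: mulr_ge0; [lra | exact: ltW].
move=> [piB [t t0 piAB]].
have [injv _] := lv; have [S1 Sn Sn1] := supp_face_mx gK n4 even_n lv c00 c10
  c20 fA.
have KB i : K (B *m X i) by apply/piB/(KX gK).
have Bsub i : supp (B *m X i) \subset supp (A *m X i).
  apply: (supp_leq gK n4 _ t0); first exact/piA/(KX gK).
  by rewrite scalemxAl -mulmxBl; apply/piAB/(KX gK).
have /choice[a aP] : forall k, exists a, (1 <= k < n)%N ->
    0 <= a /\ B *m X (v k) = a *: X (v k.+1).
  move=> k; have [kI|_] := boolP (1 <= k < n)%N; last by exists 0.
  have [|a a0 [Ba _]] := supp_subset1 gK (KB (v k)) (i := v k.+1).
    by rewrite -S1.
  by exists a.
have [an [d [an0 d0 Bn dc]]] : exists an d, [/\ 0 <= an, 0 <= d,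
    B *m X (v n) = an *: X (v n.+1) + d *: X (v 1) & c1 = 0 -> d = 0].
  have := Bsub (v n); rewrite Sn; case: eqP => [_|c1n] Bn.
    have [|an a0 [Ba _]] := supp_subset1 gK (KB (v n)) (i := v n.+1) => //.
    by exists an, 0; rewrite scale0r addr0.
  have [||an [d [a0 d0 Ba _ _]]] := @supp_subset2 _ _ _ _ gK _ (v n.+1) (v 1%N)
    _ (KB (v n)) => //.
    by rewrite (label_eq lv); lia.
  by exists an, d.
have [b [c [b0 c0' Bn1]]] : exists b c, [/\ 0 <= b, 0 <= c
    & B *m X (v n.+1) = b *: X (v 1) + c *: X (v 2)].
  have [||b [c [b0 c0' Ba _ _]]] := @supp_subset2 _ _ _ _ gK _ (v 1%N) (v 2) _
    (KB (v n.+1)).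
  - by rewrite (label_eq lv); lia.
  - by rewrite -Sn1.
  by exists b, c.
pose a' (k : nat) : R := if k == n then an else a k.
have Bk k : (1 <= k < n)%N -> B *m X (v k) = a' k *: X (v k.+1).
  move=> kI; rewrite /a' ifF; last by apply/eqP; lia.
  by have [_ ->] := aP k kI.
have Bn' : B *m X (v n) = a' n *: X (v n.+1) + d *: X (v 1) by rewrite /a' eqxx.
have := @sum_circuit R n X n4 v (fun k => B *m X (v k)) pat a' b c d Bk Bn' Bn1.
have -> : \sum_(1 <= k < n.+2) pat k *: (B *m X (v k)) = 0.
  have [_ rel _] := gK; have s0 : \sum_i sgn i *: X i = 0.
    by rewrite (rel _).2 //; exists 1 => i; rewrite mul1r.
  apply: etrans (_ : B *m (\sum_i sgn i *: X i) = 0); last by rewrite s0 mulmx0.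
  rewrite mulmx_sumr (sum_label injv).
  by apply: eq_big_nat => k kI; rewrite -scalemxAr (sgn_label R lv).
move/esym/(label_rel gK injv) => -[l lE].
have [bE cE aE] : [/\ b = - l + d, c = - l + a' 1%N
    & forall k, (2 <= k <= n)%N -> a' k = - l].
  by apply: alternating_coefs => k kI; rewrite lE // (sgn_label R lv).
have a1 : 0 <= a' 1%N.
  have I1 : (1 <= 1 < n)%N by rewrite /= (leq_trans _ n4).
  by rewrite /a' ifF; [have [] := aP 1%N I1 | apply/eqP => n1; move: n4;
    rewrite -n1].
have l0 : 0 <= - l.
  have I2 : (1 <= 2 < n)%N by rewrite /= (leq_trans _ n4).
  rewrite -(aE 2%N) ?(leq_trans _ n4) // /a'; case: eqP => // _.
  by have [] := aP 2%N I2.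
have n1 : (1 <= 1 < n)%N by rewrite /= (leq_trans _ n4).
exists (- l), d, (a' 1%N); split=> //; split.
- by rewrite Bk.
- by move=> i iI; rewrite Bk ?aE //; clear -iI; lia.
- by rewrite Bn' aE // leqnn andbT (leq_trans _ n4).
- by rewrite Bn1 bE cE.
Qed.

End Labelled.
End Faces.

(** * The two faces as simplicial cones *)

Section FaceStructure.
Variables (R : realType) (n : nat) (K : set 'cV[R]_n) (X : 'I_n.+1 -> 'cV[R]_n).
Hypothesis gK : minimal_gens K X.
Hypothesis n4 : (4 <= n)%N.
Hypothesis even_n : ~~ odd n.
Variable v : nat -> 'I_n.+1.
Hypothesis lv : labelling v.

(** The description in [face_mx_Phi] depends on the parameters only through the vanishing of the
    middle one. *)
Lemma eq_Phi_face_mx c0 c1 c2 d0 d1 d2 A B :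
  0 < c0 -> 0 <= c1 -> 0 < c2 -> 0 < d0 -> 0 <= d1 -> 0 < d2 ->
  (c1 == 0) = (d1 == 0) ->
  face_mx X v c0 c1 c2 A -> face_mx X v d0 d1 d2 B ->
  Phi (cone_pi K) A = Phi (cone_pi K) B.
Proof.
move=> c00 c10 c20 d00 d10 d20 cd fA fB; apply/seteqP.
have PA M := face_mx_Phi gK n4 even_n lv M c00 c10 c20 fA.
have PB M := face_mx_Phi gK n4 even_n lv M d00 d10 d20 fB.
split=> M.
  move=> /PA [e0 [e1 [e2 [e00 e10 e20 ce fM]]]]; apply/PB; exists e0, e1, e2.
  by split=> // d1E; apply/ce/eqP; rewrite cd d1E.
move=> /PB [e0 [e1 [e2 [e00 e10 e20 ce fM]]]]; apply/PA; exists e0, e1, e2.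
by split=> // c1E; apply/ce/eqP; rewrite -cd c1E.
Qed.

Section Basis.
Variables E0 E1 E2 : 'M[R]_n.
Hypothesis fE0 : face_mx X v 1 0 0 E0.
Hypothesis fE1 : face_mx X v 0 1 0 E1.
Hypothesis fE2 : face_mx X v 0 0 1 E2.

Lemma face_mx_comb c0 c1 c2 A :
  face_mx X v c0 c1 c2 A <-> A = c0 *: E0 + c1 *: E1 + c2 *: E2.
Proof.
have f : face_mx X v c0 c1 c2 (c0 *: E0 + c1 *: E1 + c2 *: E2).
  have := face_mxD (face_mxD (face_mxZ c0 fE0) (face_mxZ c1 fE1)) (face_mxZ c2
    fE2).
  by rewrite !mulr1 !mulr0 !addr0 !add0r.
by split=> [fA|->//]; exact: (face_mx_inj gK n4 even_n lv fA f).
Qed.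

Lemma face_comb_eq0 c0 c1 c2 :
  c0 *: E0 + c1 *: E1 + c2 *: E2 = 0 -> [/\ c0 = 0, c1 = 0 & c2 = 0].
Proof.
move=> E; have /face_mx_comb f1 := esym E.
have /face_mx_comb f2 : 0 = 0 *: E0 + 0 *: E1 + 0 *: E2 by rewrite !scale0r
  !addr0.
exact: (face_mx_coef gK n4 even_n f1 f2).
Qed.

Lemma free_face2 : free [tuple E0; E2].
Proof.
apply/freeP => k; rewrite !big_ord_recl big_ord0 addr0 /= => kE.
have [|k0 _ k1] := @face_comb_eq0 (k 0) 0 (k (lift ord0 0)).
  by rewrite scale0r addr0.
by case=> [[|[|//]]] Hi; [move: k0 | move: k1] => <-; congr k; exact: val_inj.
Qed.

Lemma free_face3 : free [tuple E0; E1; E2].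
Proof.
apply/freeP => k; rewrite !big_ord_recl big_ord0 addr0 /= addrA => kE.
have [k0 k1 k2] := face_comb_eq0 kE.
by case=> [[|[|[|//]]]] Hi; [move: k0 | move: k1 | move: k2] => <-; congr k;
  exact: val_inj.
Qed.

Lemma Phi_face2 c0 c2 A : 0 < c0 -> 0 < c2 -> face_mx X v c0 0 c2 A ->
  Phi (cone_pi K) A = scone [tuple E0; E2].
Proof.
move=> c00 c20 fA; apply/seteqP; split=> B.
  move/(face_mx_Phi gK n4 even_n lv _ c00 (lexx 0) c20 fA).
  move=> [d0 [d1 [d2 [d00 d10 d20 /(_ erefl) d1E /face_mx_comb ->]]]].
  apply/(sconeP free_face2); exists (fun i => nth 0 [:: d0; d2] i).
    by case=> [[|[|//]]].
  by rewrite d1E scale0r addr0 !big_ord_recl big_ord0 addr0.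
move/(sconeP free_face2) => [c c_ge0 ->];
  rewrite !big_ord_recl big_ord0 addr0 /=.
apply/(face_mx_Phi gK n4 even_n lv _ c00 (lexx 0) c20 fA).
exists (c 0), 0, (c (lift ord0 0)); split=> //.
by apply/face_mx_comb; rewrite scale0r addr0.
Qed.

Lemma Phi_face3 c0 c1 c2 A : 0 < c0 -> 0 < c1 -> 0 < c2 ->
  face_mx X v c0 c1 c2 A -> Phi (cone_pi K) A = scone [tuple E0; E1; E2].
Proof.
move=> c00 c10 c20 fA; apply/seteqP; split=> B.
  move/(face_mx_Phi gK n4 even_n lv _ c00 (ltW c10) c20 fA).
  move=> [d0 [d1 [d2 [d00 d10 d20 _ /face_mx_comb ->]]]].
  apply/(sconeP free_face3); exists (fun i => nth 0 [:: d0; d1; d2] i).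
    by case=> [[|[|[|//]]]].
  by rewrite !big_ord_recl big_ord0 addr0 /= addrA.
move/(sconeP free_face3) => [c c_ge0 ->];
  rewrite !big_ord_recl big_ord0 addr0 /= addrA.
apply/(face_mx_Phi gK n4 even_n lv _ c00 (ltW c10) c20 fA).
exists (c 0), (c (lift ord0 0)), (c (lift ord0 (lift ord0 0))); split=> //.
  by move=> c1E; rewrite c1E ltxx in c10.
exact/face_mx_comb.
Qed.

Lemma face2_rel_interior B : rel_interior (scone [tuple E0; E2]) B <->
  exists d0 d2, [/\ 0 < d0, 0 < d2 & face_mx X v d0 0 d2 B].
Proof.
rewrite (scone_rel_interiorP free_face2); split=> [[c c0 ->]|].
  exists (c 0), (c (lift ord0 0)); split=> //; apply/face_mx_comb.
  by rewrite !big_ord_recl big_ord0 addr0 scale0r addr0.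
move=> [d0 [d2 [d00 d20 /face_mx_comb ->]]]; exists (fun i => nth 0 [:: d0;
  d2] i).
  by case=> [[|[|//]]].
by rewrite !big_ord_recl big_ord0 addr0 scale0r addr0.
Qed.

Lemma face3_rel_interior B : rel_interior (scone [tuple E0; E1; E2]) B <->
  exists d0 d1 d2, [/\ 0 < d0, 0 < d1, 0 < d2 & face_mx X v d0 d1 d2 B].
Proof.
rewrite (scone_rel_interiorP free_face3); split=> [[c c0 ->]|].
  exists (c 0), (c (lift ord0 0)), (c (lift ord0 (lift ord0 0))); split=> //.
  by apply/face_mx_comb; rewrite !big_ord_recl big_ord0 addr0 /= addrA.
move=> [d0 [d1 [d2 [d00 d10 d20 /face_mx_comb ->]]]].
exists (fun i => nth 0 [:: d0; d1; d2] i); first by case=> [[|[|[|//]]]].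
by rewrite !big_ord_recl big_ord0 addr0 /= addrA.
Qed.

End Basis.

Lemma Phi_face_mx2 c0 c2 A : 0 < c0 -> 0 < c2 -> face_mx X v c0 0 c2 A ->
  has_dim (Phi (cone_pi K) A) 2 /\
  forall B, rel_interior (Phi (cone_pi K) A) B <->
    exists d0 d2, [/\ 0 < d0, 0 < d2 & face_mx X v d0 0 d2 B].
Proof.
have [E0 fE0] := face_mx_ex gK n4 even_n lv 1 0 0.
have [E1 fE1] := face_mx_ex gK n4 even_n lv 0 1 0.
have [E2 fE2] := face_mx_ex gK n4 even_n lv 0 0 1.
move=> c00 c20 fA; rewrite (Phi_face2 fE0 fE1 fE2 c00 c20 fA).
split; first exact/scone_dim/(free_face2 fE0 fE1 fE2).
exact: (face2_rel_interior fE0 fE1 fE2).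
Qed.

Lemma Phi_face_mx3 c0 c1 c2 A : 0 < c0 -> 0 < c1 -> 0 < c2 ->
  face_mx X v c0 c1 c2 A ->
  in_P 3 3 (Phi (cone_pi K) A) /\
  forall B, rel_interior (Phi (cone_pi K) A) B <->
    exists d0 d1 d2, [/\ 0 < d0, 0 < d1, 0 < d2 & face_mx X v d0 d1 d2 B].
Proof.
have [E0 fE0] := face_mx_ex gK n4 even_n lv 1 0 0.
have [E1 fE1] := face_mx_ex gK n4 even_n lv 0 1 0.
have [E2 fE2] := face_mx_ex gK n4 even_n lv 0 0 1.
move=> c00 c10 c20 fA; rewrite (Phi_face3 fE0 fE1 fE2 c00 c10 c20 fA).
split; first exact/scone_in_P/(free_face3 fE0 fE1 fE2).
exact: (face3_rel_interior fE0 fE1 fE2).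
Qed.

End FaceStructure.

(** * Automorphisms of the cone *)

Section Equivalence.
Variables (R : realType) (n : nat) (K : set 'cV[R]_n) (X : 'I_n.+1 -> 'cV[R]_n).
Hypothesis gK : minimal_gens K X.
Hypothesis n4 : (4 <= n)%N.
Hypothesis even_n : ~~ odd n.
Local Notation supp := (supp K X).
Local Notation sgn := (rel_sign R).

(** An automorphism permutes the extreme rays and sends the relation to a multiple of itself, so all
    the scaling factors coincide. *)
Lemma automorphism_perm P : cone_automorphism K P ->
  exists (s : 'I_n.+1 -> 'I_n.+1) (d : R), [/\ injective s, 0 < d,
    forall i, P *m X i = d *: X (s i)
    & forall i, lhs_index (s i).+1 = lhs_index i.+1].
Proof.
move=> [uP PK].
have piP : cone_pi K P by move=> y Ky; rewrite -PK; exists y.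
have piV : cone_pi K (invmx P).
  by move=> y; rewrite -{1}PK => -[z Kz <-]; rewrite mulmxA mulVmx // mul1mx.
have PX i : exists j, exists2 a, 0 < a & P *m X i = a *: X j.
  have KP : K (P *m X i) by apply/piP/(KX gK).
  have [|j jP] := supp_neq0 gK KP.
    apply: contraNneq (gen_neq0 gK n4 i) => P0.
    by rewrite -[X i]mul1mx -(mulVmx uP) -mulmxA P0 mulmx0.
  exists j.
  have KV : K (invmx P *m X j) by apply/piV/(KX gK).
  (* Applying the inverse to [P *m X i] gives support [[set i]], and [j] lies in the support of
     [P *m X i]. *)
  have Vsub : supp (invmx P *m X j) \subset [set i].
    have /= := supp_mul gK piV KP.
    rewrite mulmxA mulVmx // mul1mx (suppX gK n4) => ->.
    by apply/fintype.subsetP => k; exact: mem_step jP.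
  have [a a0 [Va _]] := supp_subset1 gK KV Vsub.
  have an : a != 0.
    apply: contraNneq (gen_neq0 gK n4 j) => a_0.
    by rewrite -[X j]mul1mx -(mulmxV uP) -mulmxA Va a_0 scale0r mulmx0.
  exists a^-1; first by rewrite invr_gt0 lt_neqAle eq_sym an.
  have : P *m (invmx P *m X j) = a *: (P *m X i) by rewrite Va scalemxAr.
  by rewrite mulmxA mulmxV // mul1mx => ->; rewrite scalerA mulVf ?scale1r.
have /choice[s sP] := PX.
have /choice[d dP] : forall i, exists a, 0 < a /\ P *m X i = a *: X (s i).
  by move=> i; have [a ? ?] := sP i; exists a.
have inj_s : injective s.
  move=> i j sij; have [di0 Pi] := dP i; have [dj0 Pj] := dP j.
  have E : X i = (d i / d j) *: X j.
    rewrite -[X i]mul1mx -[X j]mul1mx -(mulVmx uP) -!mulmxA Pi Pj sij.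
    by rewrite -!scalemxAr scalerA divfK ?gt_eqF.
  have := suppX gK n4 i; rewrite E (suppZ gK) ?divr_gt0 // (suppX gK n4).
  by move/setP/(_ i); rewrite !inE eqxx => /eqP.
have [_ rel _] := gK.
have s0 : \sum_i sgn i *: X i = 0.
  by rewrite (rel _).2 //; exists 1 => i; rewrite mul1r.
have [s' sK s'K] := injF_bij inj_s.
have [l lE] : exists l, forall j, sgn (s' j) * d (s' j) = l * sgn j.
  apply/rel; rewrite (reindex_inj inj_s) /=.
  apply: etrans (_ : P *m (\sum_i sgn i *: X i) = 0); last by rewrite s0 mulmx0.
  rewrite mulmx_sumr; apply: eq_bigr => i _; rewrite sK -scalemxAr.
  by have [_ ->] := dP i; rewrite scalerA.
have lE' i : sgn i * d i = l * sgn (s i) by rewrite -lE sK.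
have dl i : d i = `|l|.
  have /(congr1 Num.norm) := lE' i; rewrite !normrM; have [d0 _] := dP i.
  have sn (j : 'I_n.+1) : `|sgn j| = 1.
    by rewrite /rel_sign; case: ifP; rewrite ?normrN1 ?normr1.
  by rewrite !sn mul1r mulr1 gtr0_norm.
(* Summing [lE'] over all indices, where the signs add up to 1 on both sides, shows that the two
   sides of the relation are not exchanged. *)
have ln : `|l| = l.
  have := sum_sgn R even_n; rewrite (reindex_inj inj_s) /= => ss.
  have := sum_sgn R even_n => /(congr1 (fun x => x * `|l|)).
  rewrite mulr_suml mul1r.
  under eq_bigr => i _ do rewrite -(dl i) lE'.
  by rewrite -mulr_sumr ss mulr1.
have l0 : 0 < l by rewrite -ln -(dl ord0); have [] := dP ord0.
exists s, l; split=> // i.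
  by have [_ ->] := dP i; rewrite dl ln.
have := lE' i; rewrite dl ln mulrC => /(mulfI (lt0r_neq0 l0)).
by rewrite /rel_sign; case: ifP; case: ifP => // _ _; lra.
Qed.

End Equivalence.

(** * The matrix determines its parameters *)

Section LabelUniqueness.
Variables (R : realType) (n : nat) (K : set 'cV[R]_n) (X : 'I_n.+1 -> 'cV[R]_n).
Hypothesis gK : minimal_gens K X.
Hypothesis n4 : (4 <= n)%N.
Hypothesis even_n : ~~ odd n.
Local Notation supp := (supp K X).

Let I1 : (1 <= 1 <= n.+1)%N. Proof. by []. Qed.
Let I2 : (1 <= 2 <= n.+1)%N. Proof. by rewrite /= ltnS (leq_trans _ n4). Qed.
Let I3 : (1 <= 3 <= n.+1)%N. Proof. by rewrite /= ltnS (leq_trans _ n4). Qed.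
Let In : (1 <= n <= n.+1)%N. Proof. by rewrite leqnSn andbT (leq_trans _ n4).
  Qed.
Let n1 : n.+1 != 1%N.
Proof. by rewrite eqSS; apply/eqP => n0; move: n4; rewrite n0. Qed.
Let In1 : (1 <= n.+1 <= n.+1)%N. Proof. by rewrite leqnn. Qed.

Lemma label_mem2 (v : nat -> 'I_n.+1) i j k : labelling v -> (1 <= i <= n.+1)%N
  ->
  (1 <= j <= n.+1)%N -> (1 <= k <= n.+1)%N ->
  v i \in [set v j; v k] -> i = j \/ i = k.
Proof.
move=> lv iI jI kI; rewrite !inE !(label_eq lv) // => /orP[] /eqP;
  by [left|right].
Qed.

Lemma face_mx_label3 (v w : nat -> 'I_n.+1) c0 c1 c2 d0 d1 d2 A : labelling v
  -> labelling w ->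
  0 < c0 -> 0 <= c1 -> 0 < c2 -> 0 < d0 -> 0 <= d1 -> 0 < d2 ->
  face_mx X v c0 c1 c2 A -> face_mx X w d0 d1 d2 A -> w 1%N = v 1%N ->
  w 2%N = v 2%N /\ w 3%N = v 3%N.
Proof.
move=> lv lw c00 c10 c20 d00 d10 d20 fv fw w1.
have [v1 vn vn1] := supp_face_mx gK n4 even_n lv c00 c10 c20 fv.
have [w1' wn wn1] := supp_face_mx gK n4 even_n lw d00 d10 d20 fw.
have J1 : (1 <= 1 < n)%N by rewrite /= (leq_trans _ n4).
have J2 : (1 <= 2 < n)%N by rewrite /= (leq_trans _ n4).
have w2 : w 2%N = v 2%N by apply: finset.set1_inj; rewrite -w1' // -v1 // w1.
by split=> //; apply: finset.set1_inj; rewrite -w1' // -v1 // w2.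
Qed.

(* If exactly one of c1, d1 vanishes, then the images of one, respectively two
   of the generators fail to be extreme. *)
Lemma face_mx_label_case (v w : nat -> 'I_n.+1) c0 c1 c2 d0 d1 d2 A :
  labelling v -> labelling w ->
  0 < c0 -> 0 <= c1 -> 0 < c2 -> 0 < d0 -> 0 <= d1 -> 0 < d2 ->
  face_mx X v c0 c1 c2 A -> face_mx X w d0 d1 d2 A -> c1 = 0 -> d1 = 0.
Proof.
move=> lv lw c00 c10 c20 d00 d10 d20 fv fw c1E.
have [v1 vn vn1] := supp_face_mx gK n4 even_n lv c00 c10 c20 fv.
have [w1 wn wn1] := supp_face_mx gK n4 even_n lw d00 d10 d20 fw.
rewrite c1E eqxx in vn; apply/eqP/negPn/negP => d1n.
rewrite (negPf d1n) in wn.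
have single i : #|supp (A *m X i)| = 2%N -> i = v n.+1.
  have [u [uI vu _]] := label_inv (proj1 lv); rewrite -(vu i).
  have [->|un] := eqVneq (u i) n; first by rewrite vn cards1.
  have [->//|un1] := eqVneq (u i) n.+1.
  by rewrite v1 ?cards1 //; have := uI i; lia.
have wnE : w n = v n.+1.
  by apply: single; rewrite wn cards2 (label_eq lw) // n1.
have wn1E : w n.+1 = v n.+1.
  by apply: single; rewrite wn1 cards2 (label_eq lw).
have /eqP := proj1 lw n n.+1 In In1 (etrans wnE (esym wn1E)).
by rewrite eqn_leq ltnn andbF.
Qed.

(** The generators whose images are not extreme are those of label n + 1 and possibly n. If the
    labels n + 1 agree, then [w 1 = v 2] would force [v 3 = w 2], which lies in {[v 1], [v 2]}. If
    the labels n and n + 1 were swapped, [v n] would lie in that pair. *)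
Lemma face_mx_label1 (v w : nat -> 'I_n.+1) c0 c1 c2 d0 d1 d2 A : labelling v
  -> labelling w ->
  0 < c0 -> 0 <= c1 -> 0 < c2 -> 0 < d0 -> 0 <= d1 -> 0 < d2 ->
  face_mx X v c0 c1 c2 A -> face_mx X w d0 d1 d2 A -> w 1%N = v 1%N.
Proof.
move=> lv lw c00 c10 c20 d00 d10 d20 fv fw.
have cd := face_mx_label_case lv lw c00 c10 c20 d00 d10 d20 fv fw.
have dc := face_mx_label_case lw lv d00 d10 d20 c00 c10 c20 fw fv.
have [v1 vn vn1] := supp_face_mx gK n4 even_n lv c00 c10 c20 fv.
have [w1 wn wn1] := supp_face_mx gK n4 even_n lw d00 d10 d20 fw.
have [u [uI vu _]] := label_inv (proj1 lv).
have J1 : (1 <= 1 < n)%N by rewrite /= (leq_trans _ n4).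
have J2 : (1 <= 2 < n)%N by rewrite /= (leq_trans _ n4).
have single i : (1 < #|supp (A *m X i)|)%N -> i = v n.+1 \/ i = v n /\ c1 <> 0.
  rewrite -(vu i); have [->|un] := eqVneq (u i) n.
    by rewrite vn; case: eqP => c1E; [rewrite cards1 | right].
  have [->//|un1] := eqVneq (u i) n.+1; first by left.
  by rewrite v1 ?cards1 //; have := uI i; lia.
have w12 : w 1%N \in [set w 1; w 2] by rewrite set21.
have w22 : w 2%N \in [set w 1; w 2] by rewrite set22.
have wn1v : w n.+1 = v n.+1 \/ w n.+1 = v n /\ c1 <> 0.
  by apply: single; rewrite wn1 cards2 (label_eq lw).
case: wn1v => [wE|[wE c1n]].
  rewrite wE vn1 in wn1.
  have w1E : w 1%N = v 1%N \/ w 1%N = v 2%N.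
    by move: w12; rewrite -wn1 !inE => /orP[] /eqP; [left | right].
  have w2E : w 2%N = v 1%N \/ w 2%N = v 2%N.
    by move: w22; rewrite -wn1 !inE => /orP[] /eqP; [left | right].
  case: w1E => // w1E; have v3 : v 3%N = w 2%N.
    by apply: finset.set1_inj; rewrite -w1 // -v1 // w1E.
  by case: w2E; rewrite -v3 => /(proj1 lv) H; have := H I3;
    [move=> /(_ I1) | move=> /(_ I2)].
have d1n : d1 <> 0 by move=> /dc.
have wnE : w n = v n.+1.
  have : (1 < #|supp (A *m X (w n))|)%N.
    by rewrite wn; case: eqP => // _; rewrite cards2 (label_eq lw) // n1.
  case/single => // -[wnE _].
  have /eqP := proj1 lw n n.+1 In In1 (etrans wnE (esym wE)).
  by rewrite eqn_leq ltnn andbF.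
move: wn; rewrite wnE vn1; case: eqP => // _ wn.
have : w n.+1 \in [set v 1; v 2] by rewrite wn set21.
by rewrite wE => /(label_mem2 lv In I1 I2); lia.
Qed.

(** The labels 1, 2, 3 agree, and the images of the generators labelled 1 and 2 show [c2] and [c0].
    If [c1] is nonzero, [v n] is recognised as the only generator whose image involves [v 1] without
    [v 2], and its image shows [c1]. *)
Lemma face_mx_label_uniq (v w : nat -> 'I_n.+1) c0 c1 c2 d0 d1 d2 A :
  labelling v -> labelling w ->
  0 < c0 -> 0 <= c1 -> 0 < c2 -> 0 < d0 -> 0 <= d1 -> 0 < d2 ->
  face_mx X v c0 c1 c2 A -> face_mx X w d0 d1 d2 A ->
  [/\ c0 = d0, c1 = d1 & c2 = d2].
Proof.
move=> lv lw c00 c10 c20 d00 d10 d20 fv fw.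
have w1 := face_mx_label1 lv lw c00 c10 c20 d00 d10 d20 fv fw.
have [w2 w3] := face_mx_label3 lv lw c00 c10 c20 d00 d10 d20 fv fw w1.
have J2 : (2 <= 2 < n)%N by rewrite /= (leq_trans _ n4).
have cI := gen_scaleI gK n4.
have [v1' vn vn1] := supp_face_mx gK n4 even_n lv c00 c10 c20 fv.
have [w1' wn wn1] := supp_face_mx gK n4 even_n lw d00 d10 d20 fw.
have cd := face_mx_label_case lv lw c00 c10 c20 d00 d10 d20 fv fw.
have dc := face_mx_label_case lw lv d00 d10 d20 c00 c10 c20 fw fv.
case: (fv) => A1 A2 A3 _; case: (fw) => B1 B2 B3 B4.
have E0 : c0 = d0 by apply: (cI _ _ (v 3%N)); rewrite -A2 // -w2 -w3 B2.
have E2 : c2 = d2 by apply: (cI _ _ (v 2%N)); rewrite -A1 -w1 -w2 B1.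
split=> //.
have [c1E|c1n] := eqVneq c1 0; first by rewrite cd.
have d1n : d1 != 0 by apply: contraNneq c1n => /dc ->.
have [u [uI vu _]] := label_inv (proj1 lv).
have uniq_in i : v 1%N \in supp (A *m X i) -> v 2%N \notin supp (A *m X i) -> i
  = v n.
  rewrite -(vu i); have := uI i.
  have [->//|un] := eqVneq (u i) n; have [->|un1] := eqVneq (u i) n.+1.
    by rewrite vn1 set21 set22.
  move=> uiI; rewrite v1'; last by lia.
  rewrite inE (label_eq lv) //; [lia|lia].
have wnE : w n = v n.
  apply: uniq_in; rewrite wn (negPf d1n) -?w1 -?w2 ?set22 //.
  by rewrite !inE !(label_eq lw) //; lia.
have wn1E : w n.+1 = v n.+1.
  have : w n.+1 \in [set v n.+1; v 1].
    by move: vn; rewrite (negPf c1n) => <-; rewrite -wnE wn (negPf d1n) set21.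
  rewrite !inE -w1 => /orP[/eqP//|/eqP/(proj1 lw) H].
  by have := H In1 I1; lia.
apply: (cI _ _ (v 1%N)); apply: (addrI (c0 *: X (v n.+1))).
by rewrite -A3 -wnE B3 wn1E w1 E0.
Qed.

(** The common scaling factor of the automorphism cancels in the conjugation, so [A] has the
    parameters of [B] for the labelling [s \o w]. *)
Lemma cone_equivalent_face_mx (v w : nat -> 'I_n.+1) c0 c1 c2 d0 d1 d2 A B :
  labelling v -> labelling w ->
  0 < c0 -> 0 <= c1 -> 0 < c2 -> 0 < d0 -> 0 <= d1 -> 0 < d2 ->
  face_mx X v c0 c1 c2 A -> face_mx X w d0 d1 d2 B ->
  cone_equivalent K K A B -> [/\ c0 = d0, c1 = d1 & c2 = d2].
Proof.
move=> lv lw c00 c10 c20 d00 d10 d20 fv fw [_ _ [P [uP PK AB]]].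
have [s [d [inj_s d_gt0 PX sl]]] := automorphism_perm gK n4 even_n (conj uP PK).
have AP i : A *m X (s i) = d^-1 *: (P *m (B *m X i)).
  rewrite -AB -[invmx P *m A *m P]mulmxA !mulmxA mulmxV // mul1mx -mulmxA PX.
  by rewrite -scalemxAr scalerA mulVf ?gt_eqF // scale1r.
apply: (face_mx_label_uniq (w := s \o w) lv _ c00 c10 c20 d00 d10 d20 fv).
  split=> [i j iI jI /inj_s|k kI]; first exact: (proj1 lw).
  by rewrite /= sl (proj2 lw).
have dd y : d^-1 *: (d *: y) = y :> 'cV[R]_n.
  by rewrite scalerA mulVf ?gt_eqF // scale1r.
case: fw => B1 B2 B3 B4; split=> [|i iI||] /=; rewrite AP.
- by rewrite B1 -scalemxAr PX [d2 *: _]scalerA mulrC -scalerA dd.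
- by rewrite B2 // -scalemxAr PX [d0 *: _]scalerA mulrC -scalerA dd.
- rewrite B3 mulmxDr -!scalemxAr !PX ![_ *: (d *: _)]scalerA ![_ * d]mulrC.
  by rewrite -!scalerA -scalerDr dd.
- rewrite B4 mulmxDr -!scalemxAr !PX ![_ *: (d *: _)]scalerA ![_ * d]mulrC.
  by rewrite -!scalerA -scalerDr dd.
Qed.

End LabelUniqueness.

(** * Passing from the hypotheses to generators *)

Section Generators.
Variables (R : realType) (n : nat) (K : set 'cV[R]_n) (x : nat -> 'cV[R]_n).
Hypothesis hK : minimal_cone K.
Hypothesis hx : extreme_vectors_of n.+1 K x.
Hypothesis hrel : vector_relation x.

Let X (i : 'I_n.+1) := x i.+1.

Let Kconvex : convex_cone K. Proof. by case: hK => -[[]]. Qed.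

Let idxX (i : 'I_n.+1) : idx n.+1 i.+1. Proof. by rewrite /idx /= ltn_ord. Qed.

Let KX i : K (X i).
Proof. by case: hx => ex _; have [] := ex _ (idxX i). Qed.

Lemma minimal_cone_gen y : K y <->
  exists2 c : 'I_n.+1 -> R, forall i, 0 <= c i & y = \sum_i c i *: X i.
Proof.
pose G : set 'cV[R]_n := [set y | exists2 c : 'I_n.+1 -> R,
  forall i, 0 <= c i & y = \sum_i c i *: X i]%classic.
have GX (i : 'I_n.+1) a : 0 <= a -> G (a *: X i).
  move=> a0; exists (fun j => if j == i then a else 0) => [j|];
    first by case: ifP.
  by rewrite (bigD1 i) //= eqxx big1 ?addr0 // => j /negPf ->; rewrite scale0r.
split; last by move=> [c c0 ->]; exact: cone_sum.
have [[[_ clK ptK _] _] _ _] := hK; have [ex [_ _ surj]] := hx.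
apply: (cone_extreme_gen Kconvex clK ptK (G := G)).
  split=> [|_ _ [c c0 ->] [d d0 ->]|a _ a0 [c c0 ->]].
  - by exists (fun=> 0) => //; rewrite big1 // => i _; rewrite scale0r.
  - exists (fun i => c i + d i) => [i|]; first exact: addr_ge0.
    by rewrite -big_split; apply: eq_bigr => i _; rewrite scalerDl.
  - exists (fun i => a * c i) => [i|]; first exact: mulr_ge0.
    by rewrite scaler_sumr; apply: eq_bigr => i _; rewrite scalerA.
move=> e exe; have [|i iI Pie] := surj (Phi K e); first by exists e.
have [_ _ ray] := ex i iI; have : Phi K e e by exact: Phi_id.
rewrite -Pie ray => -[a a0 <-].
have iI' : (i.-1 < n.+1)%N by move: iI; rewrite /idx /=; lia.
have := GX (Ordinal iI') a a0; rewrite /X /= prednK //.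
by move: iI; rewrite /idx /=; lia.
Qed.

Lemma minimal_cone_span (y : 'cV[R]_n) : exists c : 'I_n.+1 -> R, y = \sum_i c
  i *: X i.
Proof.
have [_ [U [UE dU]] _] := hK.
have Ufull : U = fullv.
  apply/eqP; by rewrite eqEdim subvf /= dU dimvf dim_matrix mulr1.
have yU : lin_span K y by rewrite -UE /= Ufull memvf.
have : y \in span [tuple X i | i < n.+1].
  apply: yU => z /minimal_cone_gen[c _ ->]; apply: memv_suml => i _;
    apply/memvZ/memv_span.
  by apply/mapP; exists i; rewrite ?mem_enum.
move/coord_span => ->; exists (fun i => coord [tuple X i | i < n.+1] i y).
by apply: eq_bigr => i _; rewrite -tnth_nth tnth_mktuple.
Qed.

Lemma sgn_relation : \sum_i rel_sign R i *: X i = 0.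
Proof.
have : \sum_(1 <= k < n.+2) lhs_sign R k *: x k = 0.
  rewrite (bigID lhs_index) /=.
  rewrite (eq_bigr (fun k => x k)) => [|k kl];
    last by rewrite /lhs_sign kl scale1r.
  rewrite [X in _ + X](eq_bigr (fun k => - x k)) => [|k kl]; last first.
    by rewrite /lhs_sign (negPf kl) scaleN1r.
  by rewrite sumrN hrel subrr.
by rewrite big_add1 big_mkord.
Qed.

Theorem minimal_gens_of : minimal_gens K X.
Proof.
have [D DE] : exists D : 'M[R]_(n.+1, n), forall y : 'cV_n,
    y = \sum_i (D *m y) i 0 *: X i.
  have /choice[c cE] : forall j : 'I_n, exists c : 'I_n.+1 -> R,
      delta_mx j 0 = \sum_i c i *: X i.
    by move=> j; exact: minimal_cone_span.
  exists (\matrix_(i, j) c j i) => y.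
  rewrite {1}(matrix_sum_delta y).
  under eq_bigr do rewrite big_ord1 cE scaler_sumr.
  rewrite exchange_big; apply: eq_bigr => i _ /=.
  rewrite mxE scaler_suml; apply: eq_bigr => j _.
  by rewrite !mxE scalerA mulrC.
split; [exact: minimal_cone_gen | | by exists D].
pose M : 'M[R]_(n.+1, n) := \matrix_(i, j) X i j 0.
have ME (c : 'I_n.+1 -> R) : (\row_i c i) *m M = (\sum_i c i *: X i)^T.
  apply/rowP => j; rewrite !mxE summxE; apply: eq_bigr => i _.
  by rewrite !mxE.
have MDy (y : 'cV[R]_n) : M^T *m (D *m y) = y.
  apply/colP => j; rewrite {2}(DE y) summxE mxE; apply: eq_bigr => k _.
  by rewrite !mxE mulrC.
have MD : M^T *m D = 1%:M.
  apply/matrixP => i j.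
  have := congr1 (fun y : 'cV_n => y i 0) (MDy (delta_mx j 0)).
  by rewrite mulmxA -colE [LHS]mxE [RHS]mxE eqxx andbT => ->; rewrite mxE.
(* The one-sided inverse makes the rank full, so the relations among the generators form a line,
   spanned by the signs. *)
have rM : \rank M = n.
  apply/eqP; rewrite eqn_leq rank_leq_col /=.
  by have := mxrankM_maxl M^T D; rewrite MD mxrank1 mxrank_tr.
have kM : \rank (kermx M) = 1%N by rewrite mxrank_ker rM subSnn.
pose S : 'rV[R]_n.+1 := \row_i rel_sign R i.
have S0 : S != 0.
  apply/eqP => /rowP/(_ ord0)/eqP; rewrite !mxE.
  by rewrite (_ : rel_sign R ord0 = 1) // oner_eq0.
have SK : (S <= kermx M)%MS.
  by apply/sub_kermxP; rewrite ME sgn_relation trmx0.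
have KS : (kermx M <= S)%MS.
  by rewrite -(geq_leqif (mxrank_leqif_sup SK)) kM rank_rV S0.
move=> c; split=> [c0|[l lE]].
  have : (\row_i c i <= kermx M)%MS by apply/sub_kermxP; rewrite ME c0 trmx0.
  move=> /submx_trans/(_ KS)/sub_rVP[l /rowP lE]; exists l => i.
  by have := lE i; rewrite !mxE.
under eq_bigr do rewrite lE -scalerA.
by rewrite -scaler_sumr sgn_relation scaler0.
Qed.

End Generators.

(** * Permutations of the generators as automorphisms *)

Section Permutations.
Variables (R : realType) (n : nat) (K : set 'cV[R]_n) (X : 'I_n.+1 -> 'cV[R]_n).
Hypothesis gK : minimal_gens K X.
Hypothesis n4 : (4 <= n)%N.
Hypothesis even_n : ~~ odd n.

Lemma label_map_ex (v w : nat -> 'I_n.+1) : labelling v -> labelling w ->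
  exists P : 'M[R]_n, forall k, (1 <= k <= n.+1)%N -> P *m X (v k) = X (w k).
Proof.
move=> lv lw; apply: (mul_label_ex gK (proj1 lv)).
have [_ rel _] := gK; have s0 : \sum_i rel_sign R i *: X i = 0.
  by rewrite (rel _).2 //; exists 1 => i; rewrite mul1r.
rewrite -[RHS]s0 (sum_label (proj1 lw)); apply: eq_big_nat => k kI.
by rewrite !(sgn_label R) //; lia.
Qed.

Lemma label_map_pi (v w : nat -> 'I_n.+1) P : labelling v ->
  (forall k, (1 <= k <= n.+1)%N -> P *m X (v k) = X (w k)) -> cone_pi K P.
Proof.
move=> lv PX; have [u [uI vu _]] := label_inv (proj1 lv).
by apply: (pi_gens gK) => i; rewrite -(vu i) PX //; exact: (KX gK).
Qed.

Lemma automorphismP P Q : cone_pi K P -> cone_pi K Q -> P *m Q = 1%:M ->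
  cone_automorphism K P.
Proof.
move=> piP piQ PQ; split; first by case: (mulmx1_unit PQ).
apply/seteqP; split=> [_ [y Ky <-]|y Ky]; first exact: piP.
by exists (Q *m y); [exact: piQ | rewrite mulmxA PQ mul1mx].
Qed.

Lemma label_map_automorphism (v w : nat -> 'I_n.+1) P :
  labelling v -> labelling w ->
  (forall k, (1 <= k <= n.+1)%N -> P *m X (v k) = X (w k)) ->
  cone_automorphism K P.
Proof.
move=> lv lw PX; have [Q QX] := label_map_ex lw lv.
apply: (@automorphismP _ Q); [exact: label_map_pi PX | exact: label_map_pi QX
  |].
apply: (mul_label_inj gK (proj1 lw)) => k kI.
by rewrite -mulmxA QX // PX // mul1mx.
Qed.

Lemma invmx_automorphism P : cone_automorphism K P -> cone_automorphism K
  (invmx P).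
Proof.
move=> [uP PK]; apply: (@automorphismP _ P).
- by move=> y; rewrite -{1}PK => -[z Kz <-]; rewrite mulmxA mulVmx // mul1mx.
- by move=> y Ky; rewrite -PK; exists y.
- exact: mulVmx.
Qed.

Lemma conj_face_mx (v w : nat -> 'I_n.+1) P c0 c1 c2 A : P \in unitmx ->
  (forall k, (1 <= k <= n.+1)%N -> P *m X (v k) = X (w k)) ->
  face_mx X w c0 c1 c2 A -> face_mx X v c0 c1 c2 (invmx P *m A *m P).
Proof.
move=> uP PX; have VX k : (1 <= k <= n.+1)%N -> invmx P *m X (w k) = X (v k).
  by move=> kI; rewrite -PX // mulmxA mulVmx // mul1mx.
have n2 : (1 <= 2 <= n.+1)%N by rewrite /= ltnS (leq_trans _ n4).
have nI : (1 <= n <= n.+1)%N by rewrite leqnSn andbT (leq_trans _ n4).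
have n1I : (1 <= n.+1 <= n.+1)%N by rewrite leqnn.
move=> [A1 A2 A3 A4]; split.
- by rewrite -!mulmxA PX // A1 -scalemxAr VX.
- move=> i iI; have iI1 : (1 <= i <= n.+1)%N by lia.
  have iI2 : (1 <= i.+1 <= n.+1)%N by lia.
  by rewrite -!mulmxA PX // A2 // -scalemxAr VX.
- by rewrite -!mulmxA PX // A3 mulmxDr -!scalemxAr !VX.
- by rewrite -!mulmxA PX // A4 mulmxDr -!scalemxAr !VX.
Qed.

Lemma conj_cone_equivalent P c B A : cone_automorphism K P -> cone_pi K B ->
  cone_pi K A -> B = c *: (invmx P *m A *m P) -> 0 <= c ->
  cone_equivalent K K B (c *: A).
Proof.
move=> aP piB piA BE c0; have [uP _] := aP;
  have [uV VK] := invmx_automorphism aP.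
have [_ _ KZ] := pi_convex gK.
split=> //; first exact: KZ.
exists (invmx P); split=> //; rewrite invmxK BE -scalemxAr -scalemxAl.
by rewrite !mulmxA mulmxV // mul1mx -mulmxA mulmxV // mulmx1.
Qed.

End Permutations.

(* The circuit x_1, x_2, x_5, x_4, x_7, x_6, ..., x_{n+1}, x_n, x_3 of the
   digraph of A_{alpha, beta}. *)
Definition tau_label (n k : nat) : 'I_n.+1 :=
  inord (if k == n.+1 then 2 else if odd k && (k != 1%N) then k.+1 else k.-1).

(** * The matrices of the theorem as face matrices *)

Section Specifications.
Variables (R : realType) (n : nat) (K : set 'cV[R]_n) (x : nat -> 'cV[R]_n).
Hypothesis n4 : (4 <= n)%N.
Hypothesis even_n : ~~ odd n.
Let X (i : 'I_n.+1) := x i.+1.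

Lemma tau_labelE k : (1 <= k <= n.+1)%N -> (tau_label n k).+1 =
  if k == n.+1 then 3 else if odd k && (k != 1%N) then k.+2 else k.
Proof.
move=> kI; rewrite /tau_label inordK; first by case: ifP => // _;
  case: ifP => //; lia.
case: ifP => [_|/negbT kn]; first by rewrite ltnS (leq_trans _ n4).
case: ifP => [/andP[ok _]|_]; last by lia.
have : k != n by apply: contraTneq ok => ->.
by lia.
Qed.

Lemma tau_labelling : labelling (tau_label n).
Proof.
split=> [i j iI jI|k kI].
  move=> /(congr1 (fun k : 'I_n.+1 => k.+1)); rewrite !tau_labelE //.
  by case: ifP => [/eqP|]; case: ifP => [/eqP|]; do ?[case: ifP]; lia.
rewrite tau_labelE // /lhs_index.
by case: ifP => [/eqP|]; do ?[case: ifP]; lia.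
Qed.

Lemma A1_specP a A : A1_spec x a A <-> face_mx X (id_label n) 1 0 a A.
Proof.
have XE k : (1 <= k <= n.+1)%N -> X (id_label n k) = x k.
  by move=> kI; rewrite /X id_labelE.
have n2 : (1 <= 2 <= n.+1)%N by rewrite /= ltnS (leq_trans _ n4).
have nI : (1 <= n <= n.+1)%N by rewrite leqnSn andbT (leq_trans _ n4).
have n1I : (1 <= n.+1 <= n.+1)%N by rewrite leqnn.
rewrite /A1_spec /face_mx !XE // addr0 !scale1r scale0r addr0.
split=> [[A1 A2 A3]|[A1 A2 An A3]]; split=> //.
- by move=> i iI; rewrite !XE ?A2 ?scale1r //; lia.
- by apply: A2; rewrite leqnn andbT (leq_trans _ n4).
- move=> i iI; have [->//|ni] := eqVneq i n.
  by have := A2 i; rewrite !XE ?scale1r; [apply; lia | lia | lia].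
Qed.

Lemma A2_specP a b A : A2_spec x a b A <-> face_mx X (tau_label n) 1 a b A.
Proof.
have XE k : (1 <= k <= n.+1)%N -> X (tau_label n k) =
    x (if k == n.+1 then 3 else if odd k && (k != 1%N) then k.+2 else k).
  by move=> kI; rewrite /X tau_labelE.
have n2 : (1 <= 2 <= n.+1)%N by rewrite /= ltnS (leq_trans _ n4).
have nI : (1 <= n <= n.+1)%N by rewrite leqnSn andbT (leq_trans _ n4).
have n1I : (1 <= n.+1 <= n.+1)%N by rewrite leqnn.
have X1 : X (tau_label n 1) = x 1%N by rewrite XE // ifF //; apply/eqP; lia.
have X2 : X (tau_label n 2) = x 2%N by rewrite XE // ifF //; apply/eqP; lia.
have Xn : X (tau_label n n) = x n.
  by rewrite XE // (negPf even_n) /= ifF //; apply/eqP; lia.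
have Xn1 : X (tau_label n n.+1) = x 3%N by rewrite XE // eqxx.
have Xe k : (2 <= k < n)%N -> ~~ odd k -> X (tau_label n k) = x k.
  by move=> kI ek; rewrite XE ?(negPf ek) /= ?ifF //; [apply/eqP; lia | lia].
have Xo k : (2 <= k < n)%N -> odd k -> X (tau_label n k) = x k.+2.
  move=> kI ok; rewrite XE ?ok /=; last lia.
  by rewrite ifF ?ifT //; [lia | apply/eqP; lia].
rewrite /A2_spec /face_mx X1 X2 Xn Xn1 !scale1r.
split=> [[A1 A3 An Ae Ao]|[A1 A2 An A3]]; split=> //.
- move=> i iI; rewrite scale1r; have [oi|ei] := boolP (odd i).
    have Xi1 : X (tau_label n i.+1) = x i.+1.
      have [iE|iE] := eqVneq i.+1 n; first by rewrite iE.
      by rewrite Xe //=; [lia | rewrite oi].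
    by rewrite Xo // Xi1 Ao //; lia.
  have ei1 : odd i.+1 by [].
  have [iE|iE] := eqVneq i.+1 n.
    by have on : odd n; [rewrite -iE | case/negP: even_n].
  rewrite Xe // Xo //; last lia.
  by rewrite Ae ?addn3 //; lia.
- move=> i iI ei inn.
  have ei1 : odd i.+1 by [].
  have := A2 i; rewrite scale1r Xe ?Xo // ?addn3; [apply|..]; lia.
- move=> i iI oi i1 i3.
  (* An odd index i other than 1 and 3 sits at position i - 2 of the circuit. *)
  have -> : i = (i - 2).+2 by lia.
  have oi2 : odd (i - 2) by lia.
  have := A2 (i - 2)%N; rewrite scale1r Xo //; last by lia.
  have [iE|iE] := eqVneq (i - 2).+1 n; first by rewrite iE Xn /=; apply; lia.
  by rewrite Xe /=; [apply; lia | lia | lia].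
Qed.

End Specifications.

(** * Admissible permutations and labellings *)

Section AdmissiblePermutations.
Variable n : nat.

Lemma admissible_label (s : nat -> nat) : admissible_perm n s ->
  labelling (fun k => id_label n (s k)).
Proof.
move=> [[sfun sinj ssurj] slhs]; split=> [i j iI jI|k kI].
  move=> /(congr1 (fun k : 'I_n.+1 => k.+1)); rewrite !id_labelE;
    try exact: sfun.
  by apply: sinj; rewrite inE.
rewrite id_labelE; last exact: sfun.
have [lk|lk] := boolP (lhs_index k).
  have : ([set s i | i in idx n.+1 `&` [set i | lhs_index i]])%classic (s k) by
    exists k.
  by rewrite slhs => -[].
apply/negP => lsk; case/negP: lk.
have : (idx n.+1 `&` [set i | lhs_index i])%classic (s k) by split=> //;
  exact: sfun.
by rewrite -slhs => -[j [jI lj] /sinj <-] //; rewrite inE.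
Qed.

(** The permutation is [w] after the inverse of [v]; it preserves the sides because both labellings
    do. *)
Lemma label_admissible (v w : nat -> 'I_n.+1) : labelling v -> labelling w ->
  exists s, admissible_perm n s /\
    forall k, (1 <= k <= n.+1)%N -> s (v k).+1 = (w k).+1.
Proof.
move=> lv lw; have [u [uI vu uv]] := label_inv (proj1 lv).
have [u' [uI' wu' uw']] := label_inv (proj1 lw).
pose s k := (w (u (id_label n k))).+1.
have sv k : (1 <= k <= n.+1)%N -> s (v k).+1 = (w k).+1.
  move=> kI; rewrite /s; have -> : id_label n (v k).+1 = v k.
    by rewrite /id_label /= inord_val.
  by rewrite uv.
have ls k : (1 <= k <= n.+1)%N -> lhs_index (s k) = lhs_index k.
  by move=> kI; rewrite /s (proj2 lw) // -(proj2 lv) // vu id_labelE.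
have sI k : idx n.+1 (s k) by rewrite /idx /= ltn_ord.
have ssurj k : idx n.+1 k -> exists2 j, idx n.+1 j & s j = k.
  move=> kI; exists (v (u' (id_label n k))).+1;
    first by rewrite /idx /= ltn_ord.
  by rewrite sv // wu' id_labelE.
exists s; split=> //; split.
  split=> [k _|i j|k kI]; [exact: sI | rewrite !inE => iI jI | exact: ssurj].
  move=> [] /val_inj /(proj1 lw) uij.
  have {}uij : u (id_label n i) = u (id_label n j) by apply: uij.
  by rewrite -(id_labelE iI) -(id_labelE jI) -(vu (id_label n i)) uij vu.
apply/seteqP; split=> [_ [k [kI lk] <-]|k [kI lk]].
  by split; [exact: sI | rewrite /= ls].
have [j jI sj] := ssurj k kI; exists j => //; split=> //.
by rewrite /= -ls // sj.
Qed.

End AdmissiblePermutations.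

Local Open Scope classical_set_scope.
Unset Implicit Arguments.
Theorem theorem8p3 (R : realType) (n : nat) (hn4 : (4 <= n)%N)
    (hneven : ~~ odd n) (K : set 'cV[R]_n)
    (hKmin : minimal_cone K) (hKind : indecomposable K)
    (hKexp : exp_maximal_cone n.+1 K)
    (x : nat -> 'cV[R]_n) (hx : extreme_vectors_of n.+1 K x)
    (hrel : vector_relation x) :
  (* the matrices of the statement are well defined, as announced there *)
  [/\ (forall a : R, 0 < a ->
         unique (A1_spec x a) (A1 x a) /\ exp_maximal_mx K (A1 x a)),
      (forall a b : R, 0 < a -> 0 < b ->
         unique (A2_spec x a b) (A2 x a b) /\ cone_pi K (A2 x a b))
    & (forall s : nat -> nat, admissible_perm n s ->
         unique (P_spec x s) (Psigma x s) /\
         cone_automorphism K (Psigma x s))] /\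
  [/\ (* (i) *)
      [/\ (forall a : R, 0 < a -> is_face (cone_pi K) (Phi (cone_pi K) (A1 x a)) /\
             has_dim (Phi (cone_pi K) (A1 x a)) 2),
          (forall a a' : R, 0 < a -> 0 < a' ->
             Phi (cone_pi K) (A1 x a) = Phi (cone_pi K) (A1 x a'))
        & (forall a : R, 0 < a ->
             rel_interior (Phi (cone_pi K) (A1 x a)) =
             [set B : 'M[R]_n | exists c a' : R, [/\ 0 < c, 0 < a' & B = c *: A1 x a']])],
      (* (ii) *)
      [/\ (forall a b : R, 0 < a -> 0 < b ->
             [/\ is_face (cone_pi K) (Phi (cone_pi K) (A2 x a b)),
                 has_dim (Phi (cone_pi K) (A2 x a b)) 3
               & simplicial_cone (Phi (cone_pi K) (A2 x a b))]),
          (forall a b a' b' : R, 0 < a -> 0 < b -> 0 < a' -> 0 < b' ->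
             Phi (cone_pi K) (A2 x a b) = Phi (cone_pi K) (A2 x a' b'))
        & (forall a b : R, 0 < a -> 0 < b ->
             rel_interior (Phi (cone_pi K) (A2 x a b)) =
             [set B : 'M[R]_n | exists c a' b' : R,
                [/\ 0 < c, 0 < a', 0 < b' & B = c *: A2 x a' b']])],
      (* (iii) *)
      (forall B : 'M[R]_n, exp_maximal_mx K B ->
         ((exists c a : R, [/\ 0 < c, 0 < a
             & cone_equivalent K K B (c *: A1 x a)]) \/
          (exists c a b : R, [/\ 0 < c, 0 < a, 0 < b
             & cone_equivalent K K B (c *: A2 x a b)])) /\
         (exists s : nat -> nat, admissible_perm n s /\
            ((exists c a : R, [/\ 0 < c, 0 < a
                & B = c *: (invmx (Psigma x s) *m A1 x a *m Psigma x s)]) \/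
             (exists c a b : R, [/\ 0 < c, 0 < a, 0 < b
                & B = c *: (invmx (Psigma x s) *m A2 x a b *m
                            Psigma x s)]))))
    & (* (iv) *)
      [/\ (forall c a c' a' : R, 0 < c -> 0 < a -> 0 < c' -> 0 < a' ->
             (c, a) <> (c', a') ->
             ~ cone_equivalent K K (c *: A1 x a) (c' *: A1 x a')),
          (forall c a b c' a' b' : R, 0 < c -> 0 < a -> 0 < b ->
             0 < c' -> 0 < a' -> 0 < b' -> (c, a, b) <> (c', a', b') ->
             ~ cone_equivalent K K (c *: A2 x a b) (c' *: A2 x a' b'))
        & (forall c a c' a' b' : R, 0 < c -> 0 < a ->
             0 < c' -> 0 < a' -> 0 < b' ->
             ~ cone_equivalent K K (c *: A1 x a) (c' *: A2 x a' b'))]].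
Proof.
have n4 := hn4; have even_n := hneven.
have gK := minimal_gens_of hKmin hx hrel.
set X := (fun i : 'I_n.+1 => x i.+1) in gK.
have lid : labelling (id_label n) := id_labelling n.
have ltau : labelling (tau_label n) := tau_labelling n4 even_n.
have S1 a : A1_spec x a (A1 x a).
  have [A /(A1_specP x n4 even_n) fA] := face_mx_ex gK n4 even_n lid 1 0 a.
  by apply: (xgetPex 0 (P := [set A | A1_spec x a A])); exists A.
have S2 a b : A2_spec x a b (A2 x a b).
  have [A /(A2_specP x n4 even_n) fA] := face_mx_ex gK n4 even_n ltau 1 a b.
  by apply: (xgetPex 0 (P := [set A | A2_spec x a b A])); exists A.
have f1 a : face_mx X (id_label n) 1 0 a (A1 x a) by apply/A1_specP.
have f2 a b : face_mx X (tau_label n) 1 a b (A2 x a b) by apply/A2_specP.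
have U1 a A : face_mx X (id_label n) 1 0 a A -> A1 x a = A.
  exact: (face_mx_inj gK n4 even_n lid (f1 a)).
have U2 a b A : face_mx X (tau_label n) 1 a b A -> A2 x a b = A.
  exact: (face_mx_inj gK n4 even_n ltau (f2 a b)).
have pi1 a : 0 < a -> cone_pi K (A1 x a).
  move=> a0; exact: (face_mx_pi gK n4 even_n lid ler01 (lexx 0) (ltW a0) (f1
    a)).
have pi2 a b : 0 < a -> 0 < b -> cone_pi K (A2 x a b).
  move=> a0 b0; exact: (face_mx_pi gK n4 even_n ltau ler01 (ltW a0) (ltW b0)
    (f2 a b)).
(* Division by [d0] brings the parameters to the form (1, 0, alpha) or (1, alpha, beta) of the
   theorem. *)
have norm v d0 d1 d2 (B : 'M[R]_n) : 0 < d0 -> face_mx X v d0 d1 d2 B ->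
    exists2 A, face_mx X v 1 (d1 / d0) (d2 / d0) A & B = d0 *: A.
  move=> d00 fB; exists (d0^-1 *: B);
    last by rewrite scalerA mulfV ?gt_eqF ?scale1r.
  have := face_mxZ d0^-1 fB.
  by rewrite mulVf ?gt_eqF // ![d0^-1 * _]mulrC.
have PS s : admissible_perm n s ->
    [/\ unique (P_spec x s) (Psigma x s), cone_automorphism K (Psigma x s)
      & forall k, (1 <= k <= n.+1)%N ->
          Psigma x s *m X (id_label n k) = x (s k)].
  move=> as_; have ls := admissible_label as_.
  have [[sfun _ _] _] := as_.
  have XE k : (1 <= k <= n.+1)%N -> X (id_label n k) = x k.
    by move=> kI; rewrite /X id_labelE.
  have PE P : P_spec x s P <-> forall k, (1 <= k <= n.+1)%N ->
      P *m X (id_label n k) = X (id_label n (s k)).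
    split=> HP k kI; first by rewrite !XE ?HP //; exact: sfun.
    by have := HP k kI; rewrite !XE //; exact: sfun.
  have SP : P_spec x s (Psigma x s).
    have [P /PE SP] := label_map_ex gK lid ls.
    by apply: (xgetPex 0 (P := [set P | P_spec x s P])); exists P.
  split.
  - split=> // P /PE PP; apply: (mul_label_inj gK (proj1 lid)) => k kI.
    by rewrite PP // ((PE _).1 SP).
  - exact: (label_map_automorphism gK lid ls ((PE _).1 SP)).
  - by move=> k kI; rewrite ((PE _).1 SP) // XE //; exact: sfun.
split; first split.
- move=> a a0; split; last exact: (exp_maximal_face_mx gK n4 even_n lid ltr01
  a0 (f1 a)).
  by split=> // A /(A1_specP x n4 even_n); exact: U1.
- move=> a b a0 b0; split; last exact: pi2.
  by split=> // A /(A2_specP x n4 even_n); exact: U2.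
- by move=> s /PS[].
split.
- split.
  + move=> a a0; split; first exact: (Phi_face (pi_convex gK) (pi1 a a0)).
    by have [] := Phi_face_mx2 gK n4 even_n lid ltr01 a0 (f1 a).
  + move=> a a' a0 a0'.
    exact: (eq_Phi_face_mx gK n4 even_n lid ltr01 (lexx 0) a0 ltr01 (lexx 0)
      a0' erefl (f1 a) (f1 a')).
  + move=> a a0; have [_ ri] := Phi_face_mx2 gK n4 even_n lid ltr01 a0 (f1 a).
    apply/seteqP; split=> B.
      move=> /ri[d0 [d2 [d00 d20 /norm[//|A]]]]; rewrite mul0r => /U1 <- ->.
      by exists d0, (d2 / d0); rewrite divr_gt0.
    move=> [c [a' [c0 a0' ->]]]; apply/ri; exists (c * 1), (c * a').
    by rewrite mulr1 mulr_gt0 //; split=> //; have := face_mxZ c (f1 a');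
      rewrite mulr1 mulr0.
- split.
  + move=> a b a0 b0; have [P3 _] := Phi_face_mx3 gK n4 even_n ltau ltr01 a0 b0
    (f2 a b).
    split; first exact: (Phi_face (pi_convex gK) (pi2 a b a0 b0)).
      by case: P3.
    by exists 3%N.
  + move=> a b a' b' a0 b0 a0' b0'.
    apply: (eq_Phi_face_mx gK n4 even_n ltau ltr01 (ltW a0) b0 ltr01 (ltW a0')
      b0' _ (f2 a b) (f2 a' b')).
    by rewrite !gt_eqF.
  + move=> a b a0 b0; have [_ ri] := Phi_face_mx3 gK n4 even_n ltau ltr01 a0 b0
    (f2 a b).
    apply/seteqP; split=> B.
      move=> /ri[d0 [d1 [d2 [d00 d10 d20 /norm[//|A /U2 <- ->]]]]].
      by exists d0, (d1 / d0), (d2 / d0); rewrite !divr_gt0.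
    move=> [c [a' [b' [c0 a0' b0' ->]]]]; apply/ri;
      exists c, (c * a'), (c * b').
    by split; rewrite ?mulr_gt0 //; have := face_mxZ c (f2 a' b');
      rewrite mulr1.
- move=> B maxB; have [[piB _] _] := maxB.
  have [v [d0 [d1 [d2 [lv d00 d10 d20 fB]]]]] :=
    exp_maximal_classification gK n4 even_n maxB.
  have [A fA BE] := norm v d0 d1 d2 B d00 fB.
  (* The permutation carries the labelling [v] of [B] to the standard one, [w]. Conjugating [A'] by
     it gives a face matrix for [v] with the parameters of [A], hence [A] itself. *)
  have conj w c1 c2 A' : labelling w -> face_mx X w 1 c1 c2 A' ->
      face_mx X v 1 c1 c2 A -> cone_pi K A' ->
      exists s, [/\ admissible_perm n s, cone_equivalent K K B (d0 *: A')
        & B = d0 *: (invmx (Psigma x s) *m A' *m Psigma x s)].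
    move=> lw fA' fA1 piA'; have [s [as_ sE]] := label_admissible lv lw.
    have [_ autP PX] := PS s as_; have [uP _] := autP.
    have PX' k : (1 <= k <= n.+1)%N -> Psigma x s *m X (v k) = X (w k).
      move=> kI; have := PX (v k).+1; rewrite /= ltn_ord => /(_ isT).
      rewrite sE // /X id_labelE ?ltn_ord //.
    have AE : invmx (Psigma x s) *m A' *m Psigma x s = A.
      exact: (face_mx_inj gK n4 even_n lv (conj_face_mx n4 even_n uP PX' fA')
        fA1).
    have BE' : B = d0 *: (invmx (Psigma x s) *m A' *m Psigma x s) by rewrite AE.
    exists s; split=> //.
    exact: (conj_cone_equivalent gK autP piB piA' BE' (ltW d00)).
  have [d1E|d1n] := eqVneq d1 0.
    rewrite d1E mul0r in fA; have a0 : 0 < d2 / d0 by rewrite divr_gt0.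
    have [s [as_ eqB BE']] := conj _ _ _ _ lid (f1 (d2 / d0)) fA (pi1 _ a0).
    split; first by left; exists d0, (d2 / d0).
    by exists s; split=> //; left; exists d0, (d2 / d0).
  have d1p : 0 < d1 by rewrite lt_neqAle eq_sym d1n.
  have a0 : 0 < d1 / d0 by rewrite divr_gt0.
  have b0 : 0 < d2 / d0 by rewrite divr_gt0.
  have [s [as_ eqB BE']] := conj _ _ _ _ ltau (f2 (d1 / d0) (d2 / d0)) fA (pi2
    _ _ a0 b0).
  split; first by right; exists d0, (d1 / d0), (d2 / d0).
  by exists s; split=> //; right; exists d0, (d1 / d0), (d2 / d0).
- have scl1 c a : 0 < c -> 0 < a -> [/\ 0 < c * 1, 0 <= c * 0, 0 < c * a
      & face_mx X (id_label n) (c * 1) (c * 0) (c * a) (c *: A1 x a)].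
    by move=> c0 a0; rewrite mulr1 mulr0 mulr_gt0 // lexx; split=> //;
      have := face_mxZ c (f1 a); rewrite mulr1 mulr0.
  have scl2 c a b : 0 < c -> 0 < a -> 0 < b -> [/\ 0 < c * 1, 0 <= c * a, 0 < c
    * b
      & face_mx X (tau_label n) (c * 1) (c * a) (c * b) (c *: A2 x a b)].
    move=> c0 a0 b0; split; rewrite ?mulr1 ?mulr_gt0 ?mulr_ge0 ?ltW //.
    by have := face_mxZ c (f2 a b); rewrite mulr1.
  have cancel (c c' u u' : R) : 0 < c -> c * 1 = c' * 1 -> c * u = c' * u' -> c
    = c' /\ u = u'.
    rewrite !mulr1 => c0 <- /(mulfI (lt0r_neq0 c0)) ->; by [].
  split.
  + move=> c a c' a' c0 a0 c0' a0' neq eqv; apply: neq.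
    have [p1 p2 p3 p4] := scl1 c a c0 a0;
      have [q1 q2 q3 q4] := scl1 c' a' c0' a0'.
    have [E0 _ E2] := cone_equivalent_face_mx gK n4 even_n lid lid p1 p2 p3 q1
      q2 q3 p4 q4 eqv.
    by have [-> ->] := cancel _ _ _ _ c0 E0 E2.
  + move=> c a b c' a' b' c0 a0 b0 c0' a0' b0' neq eqv; apply: neq.
    have [p1 p2 p3 p4] := scl2 c a b c0 a0 b0;
      have [q1 q2 q3 q4] := scl2 c' a' b' c0' a0' b0'.
    have [E0 E1 E2] := cone_equivalent_face_mx gK n4 even_n ltau ltau p1 p2 p3
      q1 q2 q3 p4 q4 eqv.
    have [_ ->] := cancel _ _ _ _ c0 E0 E1.
    by have [-> ->] := cancel _ _ _ _ c0 E0 E2.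
  + move=> c a c' a' b' c0 a0 c0' a0' b0' eqv.
    have [p1 p2 p3 p4] := scl1 c a c0 a0;
      have [q1 q2 q3 q4] := scl2 c' a' b' c0' a0' b0'.
    have [_ E1 _] := cone_equivalent_face_mx gK n4 even_n lid ltau p1 p2 p3 q1
      q2 q3 p4 q4 eqv.
    (* The middle parameter is 0 in one family and c' a' > 0 in the other. *)
    by have := mulr_gt0 c0' a0'; rewrite -E1 mulr0 ltxx.
Qed.
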